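(* Let $(\overline M,\bar g)$ be a Riemannian manifold of dimension $m+n$ with a parallel calibration $\Omega$ of rank $m\ge2$, and let $F:M\to\overline M$ be an immersed oriented $m$-dimensional submanifold with $\Omega$-angle $\theta$. If $M$ is closed, has parallel mean curvature and $\cos\theta>0$, then $M$ is minimal.
   Context: A calibration of rank $m$ on $(\overline M,\bar g)$ is a closed $m$-form $\Omega$ with comass one: at each $p$, $|\Omega(X_1,\dots,X_m)|\le1$ for all orthonormal systems, with equality for some system; it is parallel if $\overline\nabla\Omega=0$. $M$ carries the metric $g=F^*\bar g$. $H=\frac1m\mathrm{trace}_gB$ ($B$ the second fundamental form) is the mean curvature vector; parallel means $\nabla^{\bot}H=0$; minimal means $H=0$. The $\Omega$-angle $\theta:M\to[0,\pi]$ is given by $\cos\theta=\Omega(X_1,\dots,X_m)$ for a direct orthonormal frame $X_i$ of $T_pM$. Closed means compact without boundary. *)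

(* Defs.v *)
From HB Require Import structures.
From mathcomp Require Import all_boot all_order all_algebra.
From mathcomp Require Import all_classical all_reals all_analysis.
Set Implicit Arguments.
Unset Strict Implicit.
Unset Printing Implicit Defensive.
Import Order.TTheory GRing.Theory Num.Theory.
Import numFieldNormedType.Exports.
Local Open Scope classical_set_scope.
Local Open Scope ring_scope.

(* Everything is written in local coordinates.  Points of R^k, tangent vectors
   and m-tuples of tangent vectors (the rows of an m x k matrix) are row
   matrices, so the differential of f at x acts by v |-> v *m 'J f x.
   Functions of the coordinates are total; only their values on the relevant
   open set matter. *)

Definition evec (R : realType) (k : nat) (a : 'I_k) : 'rV[R]_k := delta_mx 0 a.

Definition iter_partial (R : realType) (k : nat) (V : normedModType R)
    (s : seq 'I_k) (f : 'rV[R]_k -> V) : 'rV[R]_k -> V :=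
  foldr (fun a h x => 'D_(evec R a) h x) f s.

(* C^oo on an open set U: all iterated partial derivatives exist and are
   continuous on U. *)
Definition smooth_on (R : realType) (k : nat) (V : normedModType R)
    (U : set 'rV[R]_k) (f : 'rV[R]_k -> V) : Prop :=
  forall (s : seq 'I_k) (x : 'rV[R]_k), U x ->
    {for x, continuous (iter_partial s f)} /\
    (forall a : 'I_k, derivable (iter_partial s f) x (evec R a)).

(* A smooth manifold without boundary, given by a smooth atlas (not required to
   be maximal). *)
Record smooth_manifold (R : realType) (k : nat) := SmoothManifold {
  carrier :> topologicalType ;
  mfd_hausdorff : hausdorff_space carrier ;
  mfd_second_countable : @second_countable carrier ;
  chart : Type ;
  dom : chart -> set carrier ;
  coord : chart -> carrier -> 'rV[R]_k ;
  param : chart -> 'rV[R]_k -> carrier ;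
  dom_open : forall i, open (dom i) ;
  dom_cover : forall p, exists i, dom i p ;
  coord_open : forall i, open (coord i @` dom i) ;
  coordK : forall i p, dom i p -> param i (coord i p) = p ;
  coord_continuous : forall i p, dom i p -> {for p, continuous (coord i)} ;
  param_continuous : forall i x, (coord i @` dom i) x ->
    {for x, continuous (param i)} ;
  transition_smooth : forall i j,
    smooth_on (coord i @` (dom i `&` dom j)) (coord j \o param i) }.

Definition image_of (R : realType) (k : nat) (M : smooth_manifold R k)
    (i : chart M) : set 'rV[R]_k := coord i @` dom i.

Definition overlap (R : realType) (k : nat) (M : smooth_manifold R k)
    (i j : chart M) : set 'rV[R]_k := coord i @` (dom i `&` dom j).

Definition transition (R : realType) (k : nat) (M : smooth_manifold R k)
    (i j : chart M) : 'rV[R]_k -> 'rV[R]_k := coord j \o param i.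

(* An orientation of M is given by an atlas with orientation preserving
   transition maps; the direct frames are those with positive determinant in
   the charts of that atlas. *)
Definition oriented (R : realType) (k : nat) (M : smooth_manifold R k) : Prop :=
  forall (i j : chart M) x, overlap i j x -> 0 < \det ('J (transition i j) x).

Definition bil (R : realType) (k : nat) (G : 'M[R]_k) (v w : 'rV[R]_k) : R :=
  (v *m G *m w^T) 0 0.

Record riemannian_metric (R : realType) (k : nat) (M : smooth_manifold R k) :=
    RiemannianMetric {
  gram : chart M -> 'rV[R]_k -> 'M[R]_k ;
  gram_smooth : forall i a b, smooth_on (image_of i) (fun x => gram i x a b) ;
  gram_sym : forall i x, image_of i x -> (gram i x)^T = gram i x ;
  gram_pos : forall i x v, image_of i x -> v != 0 -> 0 < bil (gram i x) v v ;
  gram_compat : forall i j x, overlap i j x ->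
    gram i x = 'J (transition i j) x *m gram j (transition i j x)
               *m ('J (transition i j) x)^T }.

(* [form w i x X] is the value of the m-form w at the point with coordinates x
   in the chart i, on the m vectors whose coordinates are the rows of X. *)
Record diff_form (R : realType) (k : nat) (M : smooth_manifold R k) (m : nat) :=
    DiffForm {
  form : chart M -> 'rV[R]_k -> 'M[R]_(m, k) -> R ;
  form_multilinear : forall i x (A B C : 'M[R]_(m, k)) (r : 'I_m) (b c : R),
    image_of i x ->
    row r A = b *: row r B + c *: row r C ->
    row' r B = row' r A -> row' r C = row' r A ->
    form i x A = b * form i x B + c * form i x C ;
  form_alternate : forall i x (A : 'M[R]_(m, k)) (r s : 'I_m),
    image_of i x -> r != s -> row r A = row s A -> form i x A = 0 ;
  form_smooth : forall i X, smooth_on (image_of i) (fun x => form i x X) ;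
  form_compat : forall i j x X, overlap i j x ->
    form i x X = form j (transition i j x) (X *m 'J (transition i j) x) }.

(* d w = 0, evaluated on coordinate-constant vector fields (whose brackets
   vanish). *)
Definition closed_form (R : realType) (k : nat) (M : smooth_manifold R k)
    (m : nat) (w : diff_form M m) : Prop :=
  forall (i : chart M) x (X : 'M[R]_(m.+1, k)), image_of i x ->
    \sum_(r < m.+1)
      (-1) ^+ r * 'D_(row r X) (fun y => form w i y (row' r X)) x = 0.

(* Coordinates of the Levi-Civita derivative nabla_v W at x, where W is the
   vector field with constant coordinates w.  It is the vector u with
   2 g(u, z) = v.g(w, z) + w.g(v, z) - z.g(v, w) for constant z, i.e.
   Gamma^c_ab v^a w^b with the usual Christoffel symbols. *)
Definition christoffel (R : realType) (k : nat) (G : 'rV[R]_k -> 'M[R]_k)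
    (x v w : 'rV[R]_k) : 'rV[R]_k :=
  (\row_l (2^-1 * ('D_v (fun y => bil (G y) w (evec R l)) x
                   + 'D_w (fun y => bil (G y) v (evec R l)) x
                   - 'D_(evec R l) (fun y => bil (G y) v w) x)))
  *m invmx (G x).

Definition set_row (R : realType) (m k : nat) (r : 'I_m) (u : 'rV[R]_k)
    (X : 'M[R]_(m, k)) : 'M[R]_(m, k) :=
  \matrix_(s < m) (if s == r then u else row s X).

(* (nabla_v w)(X_1, ..., X_m) at x, for the coordinate vectors v and X_r. *)
Definition cov_form (R : realType) (k : nat) (M : smooth_manifold R k)
    (g : riemannian_metric M) (m : nat) (w : diff_form M m)
    (i : chart M) (x v : 'rV[R]_k) (X : 'M[R]_(m, k)) : R :=
  'D_v (fun y => form w i y X) x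
  - \sum_(r < m)
      form w i x (set_row r (christoffel (gram g i) x v (row r X)) X).

Definition parallel_form (R : realType) (k : nat) (M : smooth_manifold R k)
    (g : riemannian_metric M) (m : nat) (w : diff_form M m) : Prop :=
  forall (i : chart M) x v X, image_of i x -> cov_form g w i x v X = 0.

Definition orthonormal_frame (R : realType) (m k : nat) (G : 'M[R]_k)
    (X : 'M[R]_(m, k)) : Prop := X *m G *m X^T = 1%:M.

Definition comass_one (R : realType) (k : nat) (M : smooth_manifold R k)
    (g : riemannian_metric M) (m : nat) (w : diff_form M m) : Prop :=
  forall (i : chart M) x, image_of i x ->
    (forall X, orthonormal_frame (gram g i x) X -> `|form w i x X| <= 1) /\
    (exists X, orthonormal_frame (gram g i x) X /\ `|form w i x X| = 1).

Definition calibration (R : realType) (k : nat) (M : smooth_manifold R k)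
    (g : riemannian_metric M) (m : nat) (w : diff_form M m) : Prop :=
  closed_form w /\ comass_one g w.

(* Coordinate expression of F : M -> N in the charts i and j, and its domain. *)
Definition local_expr (R : realType) (m k : nat) (M : smooth_manifold R m)
    (N : smooth_manifold R k) (F : M -> N) (i : chart M) (j : chart N) :
    'rV[R]_m -> 'rV[R]_k := coord j \o F \o param i.

Definition local_dom (R : realType) (m k : nat) (M : smooth_manifold R m)
    (N : smooth_manifold R k) (F : M -> N) (i : chart M) (j : chart N) :
    set 'rV[R]_m := coord i @` (dom i `&` F @^-1` dom j).

Definition immersion (R : realType) (m k : nat) (M : smooth_manifold R m)
    (N : smooth_manifold R k) (F : M -> N) : Prop :=
  continuous F /\
  forall i j, smooth_on (local_dom F i j) (local_expr F i j) /\
    (forall x, local_dom F i j x -> injective ('d (local_expr F i j) x)).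

(* Extrinsic geometry of f : R^m -> R^k for the metric G on R^k.  The following
   notions only depend on the germ of f at x. *)

Definition induced_gram (R : realType) (m k : nat) (G : 'rV[R]_k -> 'M[R]_k)
    (f : 'rV[R]_m -> 'rV[R]_k) (x : 'rV[R]_m) : 'M[R]_m :=
  'J f x *m G (f x) *m ('J f x)^T.

(* Orthogonal projection onto the complement of the tangent space
   df(R^m), the row space of 'J f x. *)
Definition normal_part (R : realType) (m k : nat) (G : 'rV[R]_k -> 'M[R]_k)
    (f : 'rV[R]_m -> 'rV[R]_k) (x : 'rV[R]_m) (u : 'rV[R]_k) : 'rV[R]_k :=
  u - u *m G (f x) *m ('J f x)^T *m invmx (induced_gram G f x) *m 'J f x.

(* Ambient Levi-Civita derivative, in the direction df(v), of a vector field V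
   along f. *)
Definition cov_along (R : realType) (m k : nat) (G : 'rV[R]_k -> 'M[R]_k)
    (f : 'rV[R]_m -> 'rV[R]_k) (V : 'rV[R]_m -> 'rV[R]_k) (x v : 'rV[R]_m) :
    'rV[R]_k :=
  'D_v V x + christoffel G (f x) (v *m 'J f x) (V x).

(* B(v, w) is the normal part of nabla_v (df(w)), w extended with constant
   coordinates. *)
Definition second_ff (R : realType) (m k : nat) (G : 'rV[R]_k -> 'M[R]_k)
    (f : 'rV[R]_m -> 'rV[R]_k) (x v w : 'rV[R]_m) : 'rV[R]_k :=
  normal_part G f x (cov_along G f (fun y => w *m 'J f y) x v).

Definition mean_curvature (R : realType) (m k : nat) (G : 'rV[R]_k -> 'M[R]_k)
    (f : 'rV[R]_m -> 'rV[R]_k) (x : 'rV[R]_m) : 'rV[R]_k :=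
  m%:R^-1 *: \sum_(a < m) \sum_(b < m)
    invmx (induced_gram G f x) a b *: second_ff G f x (evec R a) (evec R b).

Definition normal_derivative (R : realType) (m k : nat)
    (G : 'rV[R]_k -> 'M[R]_k) (f : 'rV[R]_m -> 'rV[R]_k)
    (V : 'rV[R]_m -> 'rV[R]_k) (x v : 'rV[R]_m) : 'rV[R]_k :=
  normal_part G f x (cov_along G f V x v).

Definition parallel_mean_curvature (R : realType) (m k : nat)
    (M : smooth_manifold R m) (N : smooth_manifold R k)
    (g : riemannian_metric N) (F : M -> N) : Prop :=
  forall (i : chart M) (j : chart N) x v, local_dom F i j x ->
    normal_derivative (gram g j) (local_expr F i j)
      (mean_curvature (gram g j) (local_expr F i j)) x v = 0.

Definition minimal (R : realType) (m k : nat)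
    (M : smooth_manifold R m) (N : smooth_manifold R k)
    (g : riemannian_metric N) (F : M -> N) : Prop :=
  forall (i : chart M) (j : chart N) x, local_dom F i j x ->
    mean_curvature (gram g j) (local_expr F i j) x = 0.

(* theta takes its values in [0, pi] and cos theta = w(dF X_1, ..., dF X_m) for
   the direct frames X_r that are orthonormal for the induced metric. *)
Definition is_angle (R : realType) (m k : nat)
    (M : smooth_manifold R m) (N : smooth_manifold R k)
    (g : riemannian_metric N) (w : diff_form N m) (F : M -> N)
    (theta : M -> R) : Prop :=
  forall p : M, 0 <= theta p <= pi /\
    forall (i : chart M) (j : chart N), dom i p -> dom j (F p) ->
    forall X : 'M[R]_m, 0 < \det X ->
      orthonormal_frame
        (induced_gram (gram g j) (local_expr F i j) (coord i p)) X ->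
      cos (theta p) =
      form w j (coord j (F p)) (X *m 'J (local_expr F i j) (coord i p)).

(* Main.v *)
(* Insert the mean curvature vector H into slot a of Omega:
     V^a = Omega (dF e_1, ..., H, ..., dF e_m).
   Changing charts multiplies V by a Jacobian determinant, so that V is a vector
   field times a density on M.  In its divergence the derivatives of Omega vanish
   and the second derivatives of F cancel by antisymmetry, which leaves
     div V = sum_a Omega (dF e_1, ..., nabla_a H, ..., dF e_m).
   As H is parallel, nabla_a H is tangential, so div V is tr (nabla H) times
   Omega (dF e_1, ..., dF e_m); differentiating <H, dF e_b> = 0 identifies the
   trace with - m |H|^2.  Since cos theta > 0, div V <= 0, while the integral of
   div V over the closed manifold M vanishes; hence |H|^2 = 0. *)
From HB Require Import structures.
From mathcomp Require Import all_boot all_order all_algebra.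
From mathcomp Require Import all_classical all_reals all_analysis.
From mathcomp Require Import fingroup perm zify ring lra.
Require Import Defs.
Set Implicit Arguments.
Unset Strict Implicit.
Unset Printing Implicit Defensive.
Import Order.TTheory GRing.Theory Num.Theory.
Import numFieldNormedType.Exports.
Local Open Scope classical_set_scope.
Local Open Scope ring_scope.

(** * C^n germs *)

(** That the integral of div V vanishes is where most of the work lies, and it decides the choice of
    tools. The integral on R^m is a limit of Riemann sums along an ultrafilter; it kills partial
    derivatives of compactly supported functions because a shift by one mesh permutes the grid.
    Change of variables is established for functions supported near one point: there the coordinate
    change is deformed to its affine approximation, and the derivative of the pullback along the
    deformation is itself a divergence. Partitions of unity reduce the closed manifold to this local
    statement. The cancellation of second derivatives by antisymmetry serves three times: for that
    deformation, for the independence of div V from the chart, and, with covariant derivatives, for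
    the formula for div V. Few derivatives are consumed, so regularity is counted by [ck n] and
    bumps of finite smoothness suffice. As V carries the density factor, div V is integrated without
    choosing a volume form. Jacobian determinants enter with their sign; the orientation makes those
    of the transition maps positive. *)

Lemma near_preim (T U : topologicalType) (f : T -> U) (x : T) (P : set U) :
  {for x, continuous f} -> (\forall y \near f x, P y) ->
  \forall y \near x, P (f y).
Proof. by move=> cf Pf; apply: cf. Qed.

Lemma near_near (T : topologicalType) (x : T) (P : set T) :
  (\forall y \near x, P y) -> \forall y \near x, \forall z \near y, P z.
Proof. by move=> /nbhs_interior. Qed.

Lemma near_forall (T : topologicalType) (I : finType) (x : T)
    (P : I -> set T) :
  (forall i, \forall y \near x, P i y) -> \forall y \near x, forall i, P i y.
Proof. exact: filter_forall. Qed.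

Lemma near_normP (R : realType) (V : normedModType R) (x : V) (P : set V) :
  (\forall y \near x, P y) <->
  exists2 d : R, 0 < d & forall y, `|x - y| < d -> P y.
Proof.
split => [/nbhs_normP[d /= d0 dP]|[d d0 dP]]; first by exists d.
by apply/nbhs_normP; exists d.
Qed.

Lemma near0_norm_lt (R : realType) (V : normedModType R) (d : R) : 0 < d ->
  \forall h \near (0 : V), `|h| < d.
Proof.
by move=> d0; apply/near_normP; exists d => // y; rewrite sub0r normrN.
Qed.

Lemma continuous_sum_at (R : realType) (T : topologicalType) (I : Type)
    (r : seq I) (F : I -> T -> R) x :
  (forall i, {for x, continuous (F i)}) ->
  {for x, continuous (fun y => \sum_(i <- r) F i y)}.
Proof.
move=> Fc; elim: r => [|i r IH].
  have -> : (fun y => \sum_(i <- [::]) F i y) = cst 0.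
    by apply/funext => y; rewrite big_nil.
  exact: cst_continuous.
have -> : (fun y => \sum_(j <- i :: r) F j y) =
    F i + (fun y => \sum_(j <- r) F j y).
  by apply/funext => y; rewrite big_cons.
exact: continuousD.
Qed.

Lemma line_quotient (R : realType) (V W : normedModType R) (f : V -> W) z v t :
  (fun h : R => h^-1 *: (((fun s : R => f (z + s *: v)) \o shift t) (h *: 1)
     - f (z + t *: v))) =
  (fun h : R => h^-1 *: ((f \o shift (z + t *: v)) (h *: v) - f (z + t *: v))).
Proof.
apply/funext => h /=; congr (_ *: (f _ - _)).
by rewrite [h *: 1]mulr1 scalerDl addrCA.
Qed.

Lemma derivable_line (R : realType) (V W : normedModType R) (f : V -> W) z v t :
  derivable (fun s : R => f (z + s *: v)) t 1 <-> derivable f (z + t *: v) v.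
Proof. by rewrite /derivable line_quotient. Qed.

Lemma derive_line (R : realType) (V W : normedModType R) (f : V -> W) z v t :
  'D_1 (fun s : R => f (z + s *: v)) t = 'D_v f (z + t *: v).
Proof. by rewrite /derive line_quotient. Qed.

Lemma mean_value_line (R : realType) (V : normedModType R) (f : V -> R)
    (z v : V) (a b : R) : a <= b ->
  (forall s, a <= s <= b -> derivable f (z + s *: v) v) ->
  exists2 c, a <= c <= b & f (z + b *: v) - f (z + a *: v)
    = (b - a) * 'D_v f (z + c *: v).
Proof.
move=> ab fd.
have [||c cab ->] := @MVT_segment R (fun s => f (z + s *: v))
  (fun s => 'D_v f (z + s *: v)) a b ab.
- move=> s; rewrite in_itv /= => /andP[as_ sb].
  rewrite -derive_line; apply: derivableP; apply/derivable_line; apply: fd.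
  by rewrite !ltW.
- apply: derivable_within_continuous => s; rewrite in_itv /= => sab.
  by apply/derivable_line/fd.
- by exists c; [move: cab; rewrite in_itv | rewrite mulrC].
Qed.

Lemma differentiable_linear_approx (R : realType) (V W : normedModType R)
    (f : V -> W) (df : {linear V -> W}) x : continuous df ->
  (forall e : R, 0 < e ->
    \forall h \near 0, `|f (x + h) - f x - df h| <= e * `|h|) ->
  differentiable f x.
Proof.
move=> dfc small.
suff E : f \o shift x = cst (f x) + df +o_ 0 id.
  by apply/diff_locallyP; rewrite (diff_unique dfc E).
apply/eqaddoP => e e0; apply: filterS (small e e0) => h.
by rewrite -[(_ - _ : _ -> _) h]/(f (h + x) - (f x + df h)) opprD addrA addrC
  [h + x]addrC addrC.
Qed.

(* Germ version of C^n: the condition at x constrains f in a neighbourhood. *)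
Fixpoint ck (R : realType) (k n : nat) (f : 'rV[R]_k -> R) (x : 'rV[R]_k)
    : Prop :=
  if n is n'.+1 then
    (\forall y \near x, differentiable f y) /\
    (forall a, ck n' ('D_(evec R a) f) x)
  else {for x, continuous f}.

Section DifferentiableFromPartials.
Context {R : realType} {k : nat}.
Implicit Types (f : 'rV[R]_k -> R) (x h : 'rV[R]_k).

(** The vertices of the staircase from 0 to [h] that changes one coordinate at a time. *)
Definition low_part (j : nat) h : 'rV[R]_k :=
  \row_i (if (i < j)%N then h 0 i else 0).

Lemma low_part_succ (j : 'I_k) h :
  low_part j.+1 h = low_part j h + h 0 j *: evec R j.
Proof.
apply/rowP => i; rewrite !mxE /= ltnS leq_eqVlt -val_eqE /=.
have [/val_inj ->|_] := eqVneq (val i) (val j); rewrite ?ltnn /=.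
  by rewrite mulr1 add0r.
by rewrite mulr0 addr0.
Qed.

Lemma rV_coord_norm h i : `|h 0 i| <= `|h|.
Proof.
rewrite [leRHS]/Num.Def.normr/= mx_normrE.
exact: (le_bigmax _ (fun ij => `|h ij.1 ij.2|) (0, i)).
Qed.

Lemma rV_norm_le h (c : R) : 0 <= c -> (forall i, `|h 0 i| <= c) -> `|h| <= c.
Proof.
move=> c0 hc; rewrite [leLHS]/Num.Def.normr/= mx_normrE.
by apply: bigmax_le => // -[i j] _ /=; rewrite (ord1 i); apply: hc.
Qed.

Lemma low_part_segment (j : 'I_k) h (s : R) : `|s| <= `|h 0 j| ->
  `|low_part j h + s *: evec R j| <= `|h|.
Proof.
move=> sh; apply: rV_norm_le => // i; rewrite !mxE /=.
have [->|ij] := eqVneq i j.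
  by rewrite ltnn add0r mulr1 (le_trans sh)// rV_coord_norm.
rewrite mulr0 addr0; case: ifP => _; first exact: rV_coord_norm.
by rewrite normr0.
Qed.

(** The increment from [x] to [x + h] telescopes along the staircase [low_part]. On each edge the
    mean value theorem yields a partial derivative at a point within [|h|] of [x], which continuity
    at [x] compares with the one at [x]. *)
Lemma differentiable_partials f x :
  (forall a, \forall y \near x, derivable f y (evec R a)) ->
  (forall a, {for x, continuous ('D_(evec R a) f)}) ->
  differentiable f x.
Proof.
move=> fd fc.
pose df h := \sum_a h 0 a * 'D_(evec R a) f x.
have df_lin : linear df.
  move=> c u v; rewrite /df scaler_sumr -big_split /=; apply: eq_bigr => a _.
  by rewrite !mxE mulrDl -mulrA.
pose dfM := GRing.isLinear.Build _ _ _ _ _ df_lin.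
pose dfL : {linear 'rV[R]_k -> R} := HB.pack df dfM.
have dfc : continuous dfL.
  move=> u; apply: continuous_sum_at => a.
  by apply: continuousM; [exact: matrix_normedtype.coord_continuous|exact: cst_continuous].
apply: (@differentiable_linear_approx _ _ _ f dfL x dfc) => e e0.
(* Each of the [k] edges gets this share of the error; the successor keeps the quotient meaningful
   when [k = 0]. *)
have e' : 0 < e / k.+1%:R by rewrite divr_gt0.
have N1 : \forall y \near x, forall a, derivable f y (evec R a).
  by apply: near_forall => a; exact: fd.
have N2 : \forall y \near x, forall a,
    `|'D_(evec R a) f x - 'D_(evec R a) f y| < e / k.+1%:R.
  apply: near_forall => a; move/cvgrPdist_lt: (fc a); exact.
have [d /= d0 dN] : exists2 d : R, 0 < d & forall y, `|x - y| < d ->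
   forall a, derivable f y (evec R a) /\
    `|'D_(evec R a) f x - 'D_(evec R a) f y| < e / k.+1%:R.
  have /near_normP[d d0 dN] : \forall y \near x,
      (forall a, derivable f y (evec R a)) /\
      (forall a, `|'D_(evec R a) f x - 'D_(evec R a) f y| < e / k.+1%:R).
    by near=> y; split; near: y.
  by exists d => // y xy a; have [] := dN y xy.
near=> h.
have hd : `|h| < d by near: h; exact: (@near0_norm_lt R 'rV[R]_k).
have step (j : 'I_k) : `|f (x + low_part j.+1 h) - f (x + low_part j h)
    - h 0 j * 'D_(evec R j) f x| <= e / k.+1%:R * `|h|.
  have [c ch ->] : exists2 c : R, `|c| <= `|h 0 j| &
     f (x + low_part j.+1 h) - f (x + low_part j h) =
     h 0 j * 'D_(evec R j) f (x + low_part j h + c *: evec R j).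
    rewrite low_part_succ addrA.
    have dd s : `|s| <= `|h 0 j| ->
        derivable f (x + low_part j h + s *: evec R j) (evec R j).
      move=> sh; have [] // := dN (x + low_part j h + s *: evec R j) _ j.
      rewrite -addrA opprD addrA subrr add0r normrN.
      exact: (le_lt_trans (low_part_segment sh)).
    have [h0|h0] := leP 0 (h 0 j).
      have [|c /andP[c0 c1]] := @mean_value_line R _ f (x + low_part j h)
        (evec R j) 0 (h 0 j) h0.
        by move=> s /andP[s0 s1]; apply: dd; rewrite !ger0_norm.
      rewrite scale0r addr0 subr0 => ->; exists c => //.
      by rewrite !ger0_norm.
    have [|c /andP[c0 c1]] := @mean_value_line R _ f (x + low_part j h)
        (evec R j) (h 0 j) 0 (ltW h0).
      by move=> s /andP[s0 s1]; apply: dd; rewrite !ler0_norm ?lerN2// ltW.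
    rewrite scale0r addr0 sub0r => E; exists c.
      by rewrite !ler0_norm ?lerN2// ltW.
    by rewrite -opprB E mulNr opprK.
  rewrite -mulrBr normrM mulrC ler_pM// ?rV_coord_norm//.
  have [|_ /ltW] := dN (x + low_part j h + c *: evec R j) _ j.
    rewrite -addrA opprD addrA subrr add0r normrN.
    exact: (le_lt_trans (low_part_segment ch)).
  by rewrite distrC.
have -> : f (x + h) - f x - dfL h =
  \sum_(j < k) (f (x + low_part j.+1 h) - f (x + low_part j h)
    - h 0 j * 'D_(evec R j) f x).
  rewrite sumrB; congr (_ - _).
  rewrite -(big_mkord predT
    (fun j => f (x + low_part j.+1 h) - f (x + low_part j h))).
  rewrite telescope_sumr//; congr (f _ - f _).
    by congr (_ + _); apply/rowP => i; rewrite mxE ltn_ord.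
  by rewrite -[LHS]addr0; congr (_ + _); apply/rowP => i; rewrite !mxE.
apply: (le_trans (ler_norm_sum _ _ _)).
apply: (le_trans (ler_sum _ (fun j _ => step j))).
rewrite sumr_const card_ord -[_ *+ k]mulr_natr mulrAC.
suff : e / k.+1%:R * k%:R <= e by move=> ek; exact: ler_wpM2r.
by rewrite -mulrA ler_piMr ?(ltW e0)// mulrC ler_pdivrMr// mul1r ler_nat.
Unshelve. all: by end_near.
Qed.

End DifferentiableFromPartials.

Lemma near_all (T : topologicalType) (x : T) (P : set T) :
  (forall y, P y) -> \forall y \near x, P y.
Proof. exact: nearW. Qed.

Lemma nearS (T : topologicalType) (x : T) (P Q : set T) :
  (forall y, P y -> Q y) -> (\forall y \near x, P y) ->
  \forall y \near x, Q y.
Proof. exact: filterS. Qed.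

Lemma nearS2 (T : topologicalType) (x : T) (P Q S : set T) :
  (forall y, P y -> Q y -> S y) ->
  (\forall y \near x, P y) -> (\forall y \near x, Q y) ->
  \forall y \near x, S y.
Proof. exact: filterS2. Qed.

Lemma differentiable_approx (R : realType) (V W : normedModType R)
    (f : V -> W) x (e : R) : differentiable f x -> 0 < e ->
  \forall h \near 0, `|f (x + h) - f x - 'd f x h| <= e * `|h|.
Proof.
move=> fd e0; have /diff_locallyP[_ /eqaddoP/(_ e e0) fh] := fd.
have {}fh : \forall h \near 0, `|f (h + x) - (f x + 'd f x h)| <= e * `|h|.
  exact: fh.
by apply: nearS fh => h; rewrite opprD addrA [h + x]addrC.
Qed.

Lemma near_eq_differentiable (R : realType) (V W : normedModType R)
    (f g : V -> W) x :
  (\forall y \near x, f y = g y) -> differentiable f x -> differentiable g x.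
Proof.
move=> fg fd.
apply: (@differentiable_linear_approx _ _ _ _ ('d f x)).
  exact: diff_continuous.
move=> e e0; have /near_normP[d1 d10 fh] := differentiable_approx fd e0.
move: fg => /near_normP[d2 d20 fg].
apply/near_normP; exists (Num.min d1 d2) => [|h]; first by rewrite lt_min d10.
rewrite lt_min => /andP[hd1]; rewrite sub0r normrN => hd2.
rewrite -!fg ?subrr ?normr0//; last by rewrite opprD addrA subrr add0r normrN.
exact: fh.
Qed.

Lemma near_eq_continuous (T U : topologicalType) (f g : T -> U) x :
  (\forall y \near x, f y = g y) -> {for x, continuous f} ->
  {for x, continuous g}.
Proof.
move=> fg fc P; rewrite -(nbhs_singleton fg) => /fc fP.
have {}fP : \forall y \near x, P (f y) := fP.
suff : \forall y \near x, P (g y) by [].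
by apply: nearS2 _ fg fP => y <-.
Qed.

Lemma near_neq0 (R : realType) (T : topologicalType) (f : T -> R) x :
  {for x, continuous f} -> f x != 0 -> \forall y \near x, f y != 0.
Proof.
move=> fc fx0; apply: (near_preim (P := fun z => z != 0) fc).
apply/(@near_normP R R^o); exists `|f x|; first by rewrite normr_gt0.
by move=> y; apply: contraTneq => ->; rewrite subr0 ltxx.
Qed.

Lemma derivable_coord (R : realType) (V : normedModType R) (m n : nat)
    (f : V -> 'M[R]_(m, n)) x v i j : derivable f x v ->
  'D_v f x i j = 'D_v (fun y => f y i j) x.
Proof. by move=> fd; rewrite derive_mx// mxE. Qed.

Lemma differentiable_rV (R : realType) (V : normedModType R) (n : nat)
    (f : V -> 'rV[R]_n) x :
  (forall j, differentiable (fun y => f y 0 j) x) -> differentiable f x.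
Proof.
move=> fd.
have -> : f = \sum_(j < n) (fun y => f y 0 j *: evec R j).
  apply/funext => y; rewrite fct_sumE; apply/rowP => j.
  rewrite summxE (bigD1 j)//= big1 ?addr0 => [|i ij].
    by rewrite !mxE !eqxx mulr1.
  by rewrite !mxE eq_sym (negbTE ij) mulr0.
by apply: differentiable_sum => j; exact: differentiableZl.
Qed.

Lemma continuous_mx (R : realType) (T : topologicalType) (m n : nat)
    (f : T -> 'M[R]_(m, n)) x :
  (forall i j, {for x, continuous (fun y => f y i j)}) ->
  {for x, continuous f}.
Proof.
move=> fc; apply/cvgrPdist_le => /= e e0.
suff : \forall y \near x, forall ij : 'I_m * 'I_n,
    `|f x ij.1 ij.2 - f y ij.1 ij.2| <= e.
  apply: nearS _ => y H; rewrite [leLHS]/Num.Def.normr/= mx_normrE.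
  by apply: bigmax_le; rewrite ?(ltW e0)// => ij _; rewrite !mxE; exact: H.
by apply: near_forall => -[i j] /=; have /cvgrPdist_le := fc i j; exact.
Qed.

Lemma derive_linear_rV (R : realType) k (f : 'rV[R]_k -> R) x v :
  differentiable f x -> 'D_v f x = \sum_a v 0 a * 'D_(evec R a) f x.
Proof.
move=> fd; rewrite deriveE// {1}(row_sum_delta v) linear_sum.
by apply: eq_bigr => a _; rewrite linearZ deriveE.
Qed.

Lemma translate_quotient (R : realType) (V W : normedModType R) (f : V -> W)
    c x v :
  (fun h : R => h^-1 *: (((fun y => f (y + c)) \o shift x) (h *: v)
    - f (x + c))) =
  (fun h : R => h^-1 *: ((f \o shift (x + c)) (h *: v) - f (x + c))).
Proof. by apply/funext => h /=; rewrite addrA. Qed.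

Lemma is_derive_translate (R : realType) (V W : normedModType R) (f : V -> W)
    c x v : derivable f (x + c) v ->
  is_derive x v (fun y => f (y + c)) ('D_v f (x + c)).
Proof.
by move=> fd; split; rewrite ?/derivable /derive translate_quotient.
Qed.

Lemma dist_le_splitr (R : realType) (a b c e : R) :
  `|a - b| < e / 2 -> `|b - c| < e / 2 -> `|a - c| <= e.
Proof.
move=> ab bc; apply/ltW; apply: le_lt_trans (ler_distD b _ _) _.
by rewrite [ltRHS]splitr ltrD.
Qed.

Section CkCalculus.
Context {R : realType}.

Lemma ck_differentiable k n (f : 'rV[R]_k -> R) x :
  ck n.+1 f x -> differentiable f x.
Proof. by case=> /nbhs_singleton. Qed.

Lemma ck_continuous k n (f : 'rV[R]_k -> R) x :
  ck n f x -> {for x, continuous f}.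
Proof.
by case: n => [//|n] /ck_differentiable fd; exact: differentiable_continuous.
Qed.

(** Working with germs makes the induction close: an equality near [x] also holds near every nearby
    point, so the partial derivatives again agree near [x]. *)
Lemma ck_congr k n (f g : 'rV[R]_k -> R) x :
  (\forall y \near x, f y = g y) -> ck n f x -> ck n g x.
Proof.
elim: n f g => [|n IH] f g fg /=; first exact: near_eq_continuous.
have fg2 := near_near fg.
case=> fd Df; split.
  by apply: nearS2 _ fg2 fd => y; exact: near_eq_differentiable.
by move=> a; apply: IH (Df a); apply: nearS _ fg2 => y; exact: near_eq_derive.
Qed.

Lemma ckS k n (f : 'rV[R]_k -> R) x : ck n.+1 f x -> ck n f x.
Proof.
elim: n f => [|n IH] f; first exact: ck_continuous.
by case=> fd Df; split => // a; exact: IH.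
Qed.

Lemma ck_partial k n (f : 'rV[R]_k -> R) x a :
  ck n.+1 f x -> ck n ('D_(evec R a) f) x.
Proof. by move=> [_]; apply. Qed.

Lemma ck_cst k n (c : R) (x : 'rV[R]_k) : ck n (fun=> c) x.
Proof.
elim: n c => [|n IH] c /=; first exact: cst_continuous.
split; first by apply: near_all => y; exact: differentiable_cst.
move=> a; apply: (@ck_congr _ _ (fun=> 0)) (IH 0).
by apply: near_all => y; rewrite derive_cst.
Qed.

Lemma ckD k n (f g : 'rV[R]_k -> R) x :
  ck n f x -> ck n g x -> ck n (fun y => f y + g y) x.
Proof.
elim: n f g => [|n IH] f g; first exact: continuousD.
move=> [fd Df] [gd Dg] /=; split.
  by apply: nearS2 _ fd gd => y ? ?; exact: differentiableD.
move=> a; apply: (ck_congr _ (IH _ _ (Df a) (Dg a))).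
apply: nearS2 _ fd gd => y fy gy.
by rewrite [RHS]deriveD//; exact: diff_derivable.
Qed.

Lemma ckM k n (f g : 'rV[R]_k -> R) x :
  ck n f x -> ck n g x -> ck n (fun y => f y * g y) x.
Proof.
elim: n f g => [|n IH] f g; first exact: continuousM.
move=> cf cg; have [[fd Df] [gd Dg]] := (cf, cg) => /=; split.
  by apply: nearS2 _ fd gd => y ? ?; exact: differentiableM.
move=> a; apply: (ck_congr _ (ckD (IH _ _ (ckS cf) (Dg a))
  (IH _ _ (ckS cg) (Df a)))).
apply: nearS2 _ fd gd => y fy gy.
by rewrite [RHS]deriveM//; exact: diff_derivable.
Qed.

Lemma ckN k n (f : 'rV[R]_k -> R) x : ck n f x -> ck n (fun y => - f y) x.
Proof.
move=> cf; apply: (ck_congr _ (ckM (ck_cst n (-1) x) cf)).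
by apply: near_all => y; rewrite mulN1r.
Qed.

Lemma ckB k n (f g : 'rV[R]_k -> R) x :
  ck n f x -> ck n g x -> ck n (fun y => f y - g y) x.
Proof. by move=> cf cg; apply: ckD cf _; exact: ckN. Qed.

Lemma ck_sum k n (I : Type) (r : seq I) (P : pred I)
    (F : I -> 'rV[R]_k -> R) x :
  (forall i, P i -> ck n (F i) x) -> ck n (fun y => \sum_(i <- r | P i) F i y) x.
Proof.
move=> cF; elim: r => [|i r IH].
  by apply: ck_congr (ck_cst n 0 x); apply: near_all => y; rewrite big_nil.
case Pi: (P i); last first.
  by apply: ck_congr IH; apply: near_all => y; rewrite big_cons Pi.
apply: (ck_congr _ (ckD (cF i Pi) IH)).
by apply: near_all => y; rewrite big_cons Pi.
Qed.

Lemma ck_prod k n (I : Type) (r : seq I) (P : pred I)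
    (F : I -> 'rV[R]_k -> R) x :
  (forall i, P i -> ck n (F i) x) ->
  ck n (fun y => \prod_(i <- r | P i) F i y) x.
Proof.
move=> cF; elim: r => [|i r IH].
  by apply: ck_congr (ck_cst n 1 x); apply: near_all => y; rewrite big_nil.
case Pi: (P i); last first.
  by apply: ck_congr IH; apply: near_all => y; rewrite big_cons Pi.
apply: (ck_congr _ (ckM (cF i Pi) IH)).
by apply: near_all => y; rewrite big_cons Pi.
Qed.

Lemma ckV k n (f : 'rV[R]_k -> R) x : f x != 0 ->
  ck n f x -> ck n (fun y => (f y)^-1) x.
Proof.
move=> fx0; elim: n => [|n IH]; first by move=> fc; exact: continuousV.
move=> cf; have [fd Df] := cf.
have f0 : \forall y \near x, f y != 0.
  exact: near_neq0 (ck_continuous cf) fx0.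
split=> /=.
  by apply: nearS2 _ fd f0 => y fy y0; exact: differentiableV.
move=> a; have cV := IH (ckS cf).
apply: (ck_congr _ (ckN (ckM (ckM cV cV) (Df a)))).
apply: nearS2 _ fd f0 => y fy y0.
rewrite [RHS]deriveV//; last exact: diff_derivable.
by rewrite expr2 invfM -scaleNr.
Qed.

Lemma ck_coord k n (x : 'rV[R]_k) b : ck n (fun y => y 0 b) x.
Proof.
case: n => [|n] /=; first exact: matrix_normedtype.coord_continuous.
have cd y : differentiable (fun y : 'rV[R]_k => y 0 b) y.
  exact: differentiable_coord.
split; first by apply: near_all.
move=> a; apply: (ck_congr _ (ck_cst n (evec R a 0 b) x)).
by apply: near_all => y; rewrite -derivable_coord ?derive_id//.
Qed.

Definition vck k l n (f : 'rV[R]_k -> 'rV[R]_l) x :=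
  forall b, ck n (fun y => f y 0 b) x.

Lemma vck_near_differentiable k l n (f : 'rV[R]_k -> 'rV[R]_l) x :
  vck n.+1 f x -> \forall y \near x, differentiable f y.
Proof.
move=> cf; suff : \forall y \near x, forall b,
    differentiable (fun z => f z 0 b) y.
  by apply: nearS _ => y; exact: differentiable_rV.
by apply: near_forall => b; have [] := cf b.
Qed.

Lemma vck_differentiable k l n (f : 'rV[R]_k -> 'rV[R]_l) x :
  vck n.+1 f x -> differentiable f x.
Proof. by move=> /vck_near_differentiable/nbhs_singleton. Qed.

Lemma vck_continuous k l n (f : 'rV[R]_k -> 'rV[R]_l) x :
  vck n f x -> {for x, continuous f}.
Proof.
move=> cf; apply: continuous_mx => i b; rewrite (ord1 i).
exact: ck_continuous (cf b).
Qed.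

Lemma vckS k l n (f : 'rV[R]_k -> 'rV[R]_l) x : vck n.+1 f x -> vck n f x.
Proof. by move=> cf b; exact: ckS. Qed.

Lemma derive_comp_rV k l (f : 'rV[R]_k -> 'rV[R]_l) (g : 'rV[R]_l -> R) x v :
  differentiable f x -> differentiable g (f x) ->
  'D_v (fun y => g (f y)) x =
  \sum_b 'D_v (fun y => f y 0 b) x * 'D_(evec R b) g (f x).
Proof.
move=> fd gd.
rewrite deriveE; last exact: differentiable_comp.
rewrite diff_comp//= -deriveE// -deriveE// derive_linear_rV//.
apply: eq_bigr => b _; rewrite derivable_coord//; exact: diff_derivable.
Qed.

Lemma ck_comp k l n (f : 'rV[R]_k -> 'rV[R]_l) (g : 'rV[R]_l -> R) x :
  vck n f x -> ck n g (f x) -> ck n (fun y => g (f y)) x.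
Proof.
elim: n g => [|n IH] g cf cg.
  by apply: continuous_comp => //; exact: vck_continuous cf.
have fd := vck_near_differentiable cf.
have gd : \forall y \near x, differentiable g (f y).
  apply: (near_preim (P := fun z => differentiable g z)).
    exact: vck_continuous cf.
  by case: cg.
split=> /=.
  by apply: nearS2 _ fd gd => y fy gy; exact: differentiable_comp.
move=> a.
apply: (@ck_congr _ _ (fun y => \sum_b 'D_(evec R a) (fun z => f z 0 b) y *
  'D_(evec R b) g (f y))).
  by apply: nearS2 _ fd gd => y fy gy; rewrite derive_comp_rV.
apply: ck_sum => b _; apply: ckM; first exact: ck_partial.
by apply: (IH ('D_(evec R b) g)); [exact: vckS|exact: ck_partial].
Qed.

Lemma ck_derive k n (f : 'rV[R]_k -> R) x v :
  ck n.+1 f x -> ck n ('D_v f) x.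
Proof.
move=> cf; apply: (@ck_congr _ _ (fun y => \sum_a v 0 a * 'D_(evec R a) f y)).
  by case: cf => fd _; apply: nearS _ fd => y fy; rewrite [RHS]derive_linear_rV.
by apply: ck_sum => a _; apply: ckM; [exact: ck_cst|exact: ck_partial].
Qed.

(** Schwarz's theorem. The second difference of [f] over a small parallelogram equals [h ^+ 2] times
    either mixed derivative at some point of it, according to the order in which the mean value
    theorem is applied; continuity of both then forces equality at [x]. *)
Lemma derive_swap k (f : 'rV[R]_k -> R) x v w :
  ck 2 f x -> 'D_v ('D_w f) x = 'D_w ('D_v f) x.
Proof.
move=> cf; have cDv := ck_derive v cf; have cDw := ck_derive w cf.
have cvw := ck_continuous (ck_derive v cDw).
have cwv := ck_continuous (ck_derive w cDv).
have [fd _] := cf; have [fdv _] := cDv; have [fdw _] := cDw.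
apply/eqP; rewrite -subr_eq0 -normr_le0; apply/ler_addgt0Pr => e e0; rewrite add0r.
have e2 : 0 < e / 2 by rewrite divr_gt0.
have /near_normP[d d0 dP] : \forall y \near x,
    ((differentiable f y /\ differentiable ('D_v f) y) /\
     differentiable ('D_w f) y) /\
    (`|'D_v ('D_w f) x - 'D_v ('D_w f) y| < e / 2 /\
     `|'D_w ('D_v f) y - 'D_w ('D_v f) x| < e / 2).
  have /cvgrPdist_lt/(_ _ e2) c1 := cvw; have /cvgrPdistC_lt/(_ _ e2) c2 := cwv.
  have C : \forall y \near x, `|'D_v ('D_w f) x - 'D_v ('D_w f) y| < e / 2 /\
     `|'D_w ('D_v f) y - 'D_w ('D_v f) x| < e / 2.
    exact: nearS2 (fun y => @conj _ _) c1 c2.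
  have D : \forall y \near x, differentiable f y /\ differentiable ('D_v f) y.
    exact: nearS2 (fun y => @conj _ _) fd fdv.
  exact: nearS2 (fun y => @conj _ _) (nearS2 (fun y => @conj _ _) D fdw) C.
(* The parallelogram with sides [h *: v] and [h *: w] has to fit into the ball of radius [d]; the
   summand 1 in the witness covers the case where [v] and [w] both vanish. *)
have [h h0 hd] : exists2 h : R, 0 < h & h * `|v| + h * `|w| < d.
  exists (d / 2 / (`|v| + `|w| + 1)).
    by rewrite !divr_gt0// ltr_wpDl.
  rewrite -mulrDr -mulrA (@le_lt_trans _ _ (d / 2))//; last by lra.
  by rewrite ler_piMr ?divr_ge0 ?(ltW d0)// mulrC ler_pdivrMr ?ltr_wpDl//
    mul1r lerDl.
have small s t : 0 <= s <= h -> 0 <= t <= h ->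
    `|x - (x + s *: v + t *: w)| < d.
  move=> /andP[s0 sh] /andP[t0 th].
  rewrite -addrA opprD addrA subrr add0r normrN (le_lt_trans _ hd)//.
  rewrite (le_trans (ler_normD _ _))// !normrZ !ger0_norm//.
  by rewrite lerD// ler_wpM2r.
have h00 : (0 : R) <= 0 <= h by rewrite lexx ltW.
have hh : 0 <= h <= h by rewrite lexx ltW.
(* The second difference is the increment in direction [u2] of the first difference [g] in direction
   [u1]. It is symmetric in [u1] and [u2] up to reordering, hence usable for both orders. *)
have second_difference (u1 u2 : 'rV[R]_k) :
    (forall s t, 0 <= s <= h -> 0 <= t <= h ->
       differentiable f (x + t *: u2 + s *: u1) /\
       differentiable ('D_u2 f) (x + t *: u2 + s *: u1)) ->
    exists s t, [/\ 0 <= s <= h, 0 <= t <= h &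
      f (x + h *: u2 + h *: u1) - f (x + h *: u2) - (f (x + h *: u1) - f x)
      = h * (h * 'D_u1 ('D_u2 f) (x + t *: u2 + s *: u1))].
  move=> D.
  pose g y := f (y + h *: u1) - f y.
  have gd t : 0 <= t <= h -> is_derive (x + t *: u2) u2 g
     ('D_u2 f (x + t *: u2 + h *: u1) - 'D_u2 f (x + t *: u2)).
    move=> th; apply: is_deriveB.
      by apply: is_derive_translate; apply: diff_derivable; have [] := D h t hh th.
    have [+ _] := D 0 t h00 th; rewrite scale0r addr0 => fd'.
    exact/derivableP/diff_derivable.
  have [|t th] := @mean_value_line _ _ g x u2 0 h (ltW h0).
    by move=> t /gd[].
  have [_ ->] := gd t th; rewrite scale0r addr0 subr0 => E1.
  have [|s sh] := @mean_value_line _ _ ('D_u2 f) (x + t *: u2) u1 0 h (ltW h0).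
    by move=> s sh; apply: diff_derivable; have [] := D s t sh th.
  rewrite scale0r addr0 subr0 => E2.
  by exists s, t; split => //; rewrite -E2 -E1.
have [|s [t [sh th E1]]] := second_difference v w.
  move=> s t sh th; have [] := dP (x + t *: w + s *: v).
    by rewrite addrAC; exact: small.
  by case=> -[].
have [|s' [t' [sh' th' E2]]] := second_difference w v.
  move=> s' t' sh' th'; have [] := dP (x + t' *: v + s' *: w).
    exact: small.
  by case=> -[].
have E3 : 'D_v ('D_w f) (x + t *: w + s *: v) =
    'D_w ('D_v f) (x + t' *: v + s' *: w).
  have xC : x + h *: w + h *: v = x + h *: v + h *: w by rewrite addrAC.
  have alg (a b c e' : R) : a - b - (c - e') = a - c - (b - e') by ring.
  rewrite xC in E1.
  exact: (mulfI (lt0r_neq0 h0) (mulfI (lt0r_neq0 h0)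
    (etrans (esym E1) (etrans (alg _ _ _ _) E2)))).
have [|_ [A _]] := dP (x + t *: w + s *: v).
  by rewrite addrAC; exact: small.
have [|_ [_ B]] := dP (x + t' *: v + s' *: w); first exact: small.
by rewrite E3 in A; exact: dist_le_splitr A B.
Qed.

End CkCalculus.

(** * Alternating multilinear forms *)

Section AlternatingForms.
Context {R : realType}.

Lemma set_rowE m k r (u : 'rV[R]_k) (X : 'M[R]_(m, k)) s b :
  set_row r u X s b = if s == r then u 0 b else X s b.
Proof. by rewrite mxE; case: eqP; rewrite ?mxE. Qed.

Lemma row_set_row m k r (u : 'rV[R]_k) (X : 'M[R]_(m, k)) s :
  row s (set_row r u X) = if s == r then u else row s X.
Proof. by rewrite rowK. Qed.

Lemma set_row_id m k r (X : 'M[R]_(m, k)) : set_row r (row r X) X = X.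
Proof.
by apply/matrixP => s b; rewrite set_rowE; case: eqP => // ->; rewrite mxE.
Qed.

Lemma set_row_same m k r (u v : 'rV[R]_k) (X : 'M[R]_(m, k)) :
  set_row r u (set_row r v X) = set_row r u X.
Proof. by apply/matrixP => s b; rewrite !set_rowE; case: eqP. Qed.

Lemma set_rowC m k r s (u v : 'rV[R]_k) (X : 'M[R]_(m, k)) : r != s ->
  set_row r u (set_row s v X) = set_row s v (set_row r u X).
Proof.
move=> rs; apply/matrixP => t b; rewrite !set_rowE.
by case: eqVneq => [->|//]; rewrite (negbTE rs).
Qed.

Lemma mul_set_row m k l r (u : 'rV[R]_k) (X : 'M[R]_(m, k)) (Y : 'M[R]_(k, l)) :
  set_row r u X *m Y = set_row r (u *m Y) (X *m Y).
Proof.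
by apply/row_matrixP => s; rewrite row_mul !row_set_row; case: eqP;
  rewrite ?row_mul.
Qed.

Definition multilinear m k (D : 'M[R]_(m, k) -> R) := forall r X b u c v,
  D (set_row r (b *: u + c *: v) X) =
  b * D (set_row r u X) + c * D (set_row r v X).

Definition alternating m k (D : 'M[R]_(m, k) -> R) := forall X r s,
  r != s -> row r X = row s X -> D X = 0.

Lemma multilinear0 m k (D : 'M[R]_(m, k) -> R) r X : multilinear D ->
  D (set_row r 0 X) = 0.
Proof.
by move=> /(_ r X 0 0 0 0); rewrite !scale0r addr0 !mul0r addr0.
Qed.

Lemma multilinear_sum m k (D : 'M[R]_(m, k) -> R) (I : Type) (s : seq I)
    (P : pred I) r (c : I -> R) (u : I -> 'rV[R]_k) X : multilinear D ->
  D (set_row r (\sum_(i <- s | P i) c i *: u i) X) =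
  \sum_(i <- s | P i) c i * D (set_row r (u i) X).
Proof.
move=> mD; elim: s => [|i s IH]; first by rewrite !big_nil multilinear0.
rewrite !big_cons; case: (P i) => //.
by rewrite -[X in _ + X]scale1r mD mul1r IH.
Qed.

Lemma multilinearD m k (D : 'M[R]_(m, k) -> R) r u v X : multilinear D ->
  D (set_row r (u + v) X) = D (set_row r u X) + D (set_row r v X).
Proof. by move=> mD; rewrite -[u]scale1r -[v]scale1r mD !scale1r !mul1r. Qed.

Lemma multilinearZ m k (D : 'M[R]_(m, k) -> R) r c u X : multilinear D ->
  D (set_row r (c *: u) X) = c * D (set_row r u X).
Proof. by move=> mD; rewrite -[c *: u]addr0 -(scale0r 0) mD mul0r addr0. Qed.

Definition basis_mx m k (phi : {ffun 'I_m -> 'I_k}) : 'M[R]_(m, k) :=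
  \matrix_r evec R (phi r).

Lemma row_expand m k (X : 'M[R]_(m, k)) r :
  row r X = \sum_b X r b *: evec R b.
Proof.
by rewrite {1}(row_sum_delta (row r X)); apply: eq_bigr => b _; rewrite mxE.
Qed.

(** Induction on the number [j] of leading rows that are still arbitrary: expanding the last of
    these in the standard basis leaves [j - 1] of them. *)
Lemma multilinear_ext m k (D E : 'M[R]_(m, k) -> R) :
  multilinear D -> multilinear E ->
  (forall phi, D (basis_mx phi) = E (basis_mx phi)) -> D =1 E.
Proof.
move=> mD mE DE.
suff H j : (j <= m)%N -> forall X : 'M[R]_(m, k),
    (forall r : 'I_m, (j <= r)%N -> exists b, row r X = evec R b) -> D X = E X.
  by move=> X; apply: (H m) => // r; rewrite leqNgt ltn_ord.
elim: j => [_ X bX|j IH jm X bX].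
  have {bX} bX r : exists b, row r X = evec R b by exact: bX.
  have [phi Xphi] := fin_all_exists bX.
  suff -> : X = basis_mx [ffun r => phi r] by [].
  by apply/row_matrixP => r; rewrite rowK ffunE Xphi.
rewrite -(set_row_id (Ordinal jm) X) row_expand !multilinear_sum//.
apply: eq_bigr => b _; congr (_ * _); apply: IH; first exact: ltnW.
move=> r; rewrite leq_eqVlt row_set_row -val_eqE /= eq_sym.
by case: eqP => [_ _|_ jr]; [exists b|exact: bX].
Qed.

Lemma det_multilinear m : multilinear (fun X : 'M[R]_m => \det X).
Proof.
move=> r X b u c v.
apply: (@determinant_multilinear _ _ _ _ _ r).
- by rewrite !row_set_row eqxx.
- by apply/matrixP => s t; rewrite !mxE !(eq_sym _ r) (negbTE (neq_lift r s)).
- by apply/matrixP => s t; rewrite !mxE !(eq_sym _ r) (negbTE (neq_lift r s)).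
Qed.

Lemma det_alternating m : alternating (fun X : 'M[R]_m => \det X).
Proof.
move=> X r s rs Xrs; apply: (determinant_alternate rs) => j.
by have /rowP/(_ j) := Xrs; rewrite !mxE.
Qed.

Lemma det_set_row1 m (v : 'rV[R]_m) b : \det (set_row b v 1%:M) = v 0 b.
Proof.
rewrite [X in set_row _ X _](row_sum_delta v).
rewrite (multilinear_sum _ _ _ _ _ _ (@det_multilinear m)) (bigD1 b)//=.
have row1 c : row c 1%:M = evec R c by apply/rowP => j; rewrite !mxE eqxx eq_sym.
rewrite -[delta_mx 0 b]/(evec R b) -row1 set_row_id det1 mulr1.
rewrite big1 ?addr0// => c cb.
rewrite (@det_alternating _ (set_row b (delta_mx 0 c) 1%:M) b c) ?mulr0//.
  by rewrite eq_sym.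
by rewrite !row_set_row eqxx (negbTE cb) row1.
Qed.

(** Polarization: inserting [u + v] in both slots gives zero, and so do the two pure terms of its
    expansion. *)
Lemma alternating_swap m k (D : 'M[R]_(m, k) -> R) r s u v X :
  multilinear D -> alternating D -> r != s ->
  D (set_row r u (set_row s v X)) = - D (set_row r v (set_row s u X)).
Proof.
move=> mD aD rs.
have alt w : D (set_row r w (set_row s w X)) = 0.
  apply: (aD _ r s) => //; rewrite !row_set_row eqxx eq_sym (negbTE rs).
  by rewrite eqxx.
have := alt (u + v); rewrite multilinearD// ![set_row r _ (set_row s _ X)]set_rowC//.
rewrite !multilinearD// -![set_row s _ (set_row r _ X)]set_rowC// !alt.
by rewrite add0r addr0 => /eqP; rewrite addr_eq0 => /eqP.
Qed.

Lemma alternating_perm m (D : 'M[R]_m -> R) (s : 'S_m) (X : 'M[R]_m) :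
  multilinear D -> alternating D -> D (row_perm s X) = (-1) ^+ s * D X.
Proof.
move=> mD aD; rewrite -[s]fingroup.invgK.
have [ts -> dts] := prod_tpermP (s^-1)%g.
elim: ts dts X => [_ X|[i j] ts IH /= /andP[ij dts] X].
  rewrite big_nil fingroup.invg1 odd_perm1 expr0 mul1r; congr D.
  by apply/matrixP => a b; rewrite mxE perm1.
rewrite big_cons fingroup.invMg odd_permM tpermV.
rewrite (_ : row_perm _ X = row_perm (\prod_(t <- ts) tperm t.1 t.2)^-1%g
   (row_perm (tperm i j) X)); last first.
  by apply/matrixP => a b; rewrite !mxE permM.
rewrite IH// signr_addb odd_tperm ij expr1 -mulrA; congr (_ * _).
have -> : row_perm (tperm i j) X = set_row i (row j X) (set_row j (row i X) X).
  apply/matrixP => a b; rewrite !(mxE, set_rowE).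
  by case: tpermP => [->|->|/eqP/negbTE -> /eqP/negbTE ->]; rewrite ?eqxx//;
    case: eqP => // ->.
rewrite alternating_swap// -set_rowC 1?eq_sym// set_row_id.
by rewrite set_row_id mulN1r.
Qed.

(** Both sides are multilinear, so rows from the standard basis suffice. If two rows coincide both
    sides vanish; otherwise the matrix is a permutation matrix and both sides are its sign times
    [D 1%:M]. *)
Lemma alternating_det m (D : 'M[R]_m -> R) :
  multilinear D -> alternating D -> forall S, D S = \det S * D 1%:M.
Proof.
move=> mD aD.
have mE : multilinear (fun S : 'M[R]_m => \det S * D 1%:M).
  by move=> r X b u c v; rewrite det_multilinear mulrDl !mulrA.
apply: multilinear_ext => // phi.
have [/injectiveP iphi|/injectivePn[r [s rs prs]]] := boolP (injectiveb phi).
  rewrite (_ : basis_mx phi = row_perm (perm iphi) 1%:M); last first.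
    by apply/matrixP => a b; rewrite !mxE permE eqxx /= eq_sym.
  rewrite alternating_perm// (alternating_perm _ _ (@det_multilinear _)
    (@det_alternating _)).
  by rewrite det1 mulr1.
have E : row r (basis_mx phi) = row s (basis_mx phi) by rewrite !rowK prs.
by rewrite (aD _ _ _ rs E) (det_alternating rs E) mul0r.
Qed.

Lemma alternating_mul m k (D : 'M[R]_(m, k) -> R) (S : 'M[R]_m)
    (X : 'M[R]_(m, k)) :
  multilinear D -> alternating D -> D (S *m X) = \det S * D X.
Proof.
move=> mD aD; rewrite (@alternating_det _ (fun T => D (T *m X))) ?mul1mx//.
  by move=> r Y b u c v; rewrite !mul_set_row mulmxDl -!scalemxAl mD.
by move=> Y r s rs Yrs; apply: (aD _ r s) => //; rewrite !row_mul Yrs.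
Qed.

(** This reduces the regularity of a field of forms to that of its finitely many coefficients
    [D (basis_mx phi)], and makes the dependence on the rows polynomial. *)
Lemma multilinear_expand m k (D : 'M[R]_(m, k) -> R) X : multilinear D ->
  D X = \sum_(phi : {ffun 'I_m -> 'I_k})
    (\prod_r X r (phi r)) * D (basis_mx phi).
Proof.
move=> mD; move: X; apply: multilinear_ext => // [r X b u c v|psi].
  rewrite !mulr_sumr -big_split /=; apply: eq_bigr => phi _.
  rewrite !mulrA -mulrDl; congr (_ * _).
  rewrite (bigD1 r)//= [in X in _ = X + _](bigD1 r)//=.
  rewrite [in X in _ = _ + X](bigD1 r)//= !set_rowE eqxx !mxE !mulrA mulrDl.
  by congr (_ * _ + _ * _); apply: eq_bigr => s /negbTE sr;
    rewrite !set_rowE sr.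
rewrite (bigD1 psi)//= [X in _ = _ + X]big1 => [|phi pp].
  rewrite addr0 big1 ?mul1r// => r _.
  by rewrite !mxE !eqxx.
have [r pr] : exists r, psi r != phi r.
  apply/existsP; apply: contraR pp; rewrite negb_exists => /forallP pp.
  by apply/eqP/ffunP => r; apply/esym/eqP; have := pp r; rewrite negbK.
by rewrite (bigD1 r)//= !mxE eqxx /= eq_sym (negbTE pr) !mul0r.
Qed.

(* Cofactor identity for the (m-1)-forms obtained by inserting h; when D is a
   determinant and J = 1 it is Cramer's rule. *)
Lemma alternating_cofactor m k (D : 'M[R]_(m, k) -> R) (S : 'M[R]_m)
    (J : 'M[R]_(m, k)) (h : 'rV[R]_k) b :
  multilinear D -> alternating D ->
  \sum_a S a b * D (set_row a h (S *m J)) = \det S * D (set_row b h J).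
Proof.
move=> mD aD.
(* As a function of the rows of [T] the left-hand side is itself alternating and multilinear, hence
   determined by its value at the identity, where only the summand [a = b] survives. *)
pose E (T : 'M[R]_m) := \sum_a T a b * D (set_row a h (T *m J)).
rewrite -[LHS]/(E S) (@alternating_det _ E).
- congr (_ * _); rewrite /E (bigD1 b)//= mul1mx big1 => [|a /negbTE ab].
    by rewrite mxE eqxx mul1r addr0.
  by rewrite mxE ab mul0r.
- move=> r X c u d v; rewrite /E (bigD1 r)//= [in RHS](bigD1 r)//=.
  rewrite [X in _ = _ + _ * X](bigD1 r)//= !set_rowE eqxx !mul_set_row.
  rewrite !set_row_same !mxE !mulrDr addrACA mulrDl !mulrA; congr (_ + _).
  rewrite !mulr_sumr -big_split /=; apply: eq_bigr => a ar.
  rewrite !set_rowE (negbTE ar) !(set_rowC _ _ _ ar).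
  by rewrite mulmxDl -!scalemxAl mD mulrDr !mulrA ![X a b * _]mulrC.
- move=> X r s rs Xrs; rewrite /E (bigD1 r)//= (bigD1 s) 1?eq_sym//=.
  rewrite big1 ?addr0; last first.
    move=> a /andP[ar as_]; rewrite (aD _ r s) ?mulr0// !row_set_row.
    by rewrite ![_ == a]eq_sym (negbTE ar) (negbTE as_) !row_mul Xrs.
  have -> : X r b = X s b by have /rowP/(_ b) := Xrs; rewrite !mxE.
  have Yrs : row r (X *m J) = row s (X *m J) by rewrite !row_mul Xrs.
  have -> : D (set_row r h (X *m J)) = - D (set_row s h (X *m J)).
    rewrite -{1}(set_row_id s (X *m J)) -Yrs alternating_swap//.
    by rewrite set_rowC// set_row_id.
  by rewrite -mulrDr addNr mulr0.
Qed.

(** Row [a] of [T *m X] is a combination of the rows of [X]; every term except the multiple [T a a]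
    of row [a] repeats a row of [X]. *)
Lemma alternating_trace m k (D : 'M[R]_(m, k) -> R) (T : 'M[R]_m)
    (X : 'M[R]_(m, k)) :
  multilinear D -> alternating D ->
  \sum_a D (set_row a (row a (T *m X)) X) = \tr T * D X.
Proof.
move=> mD aD; rewrite /mxtrace mulr_suml; apply: eq_bigr => a _.
rewrite row_mul mulmx_sum_row multilinear_sum// (bigD1 a)//= set_row_id mxE.
rewrite big1 ?addr0// => b ba; rewrite (aD _ a b) ?mulr0 1?eq_sym//.
by rewrite !row_set_row eqxx (negbTE ba).
Qed.

(** Exchanging the names [a] and [b] swaps two slots and leaves [S] unchanged, so the sum equals its
    own negative. [S] will be an array of second derivatives, ordinary or covariant. *)
Lemma alternating_sym_cancel m k (D : 'M[R]_(m, k) -> R)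
    (S : 'I_m -> 'I_m -> 'rV[R]_k) h X :
  multilinear D -> alternating D -> (forall a b, S a b = S b a) ->
  \sum_a \sum_(b | b != a) D (set_row b (S a b) (set_row a h X)) = 0.
Proof.
move=> mD aD SC; set T := LHS.
suff TN : T = - T by apply/eqP; rewrite -[_ == _](mulrn_eq0 T 2) mulr2n {1}TN addNr.
rewrite {1}/T (exchange_big_dep predT)//= /T -sumrN; apply: eq_bigr => b _.
rewrite -sumrN; apply: eq_big => [a|a ab]; first by rewrite eq_sym.
by rewrite alternating_swap// SC set_rowC// eq_sym.
Qed.

End AlternatingForms.

(** * Integration of compactly supported functions on R^m *)

Section RiemannSums.
Context {R : realType} {m : nat}.
Implicit Types (f g : 'rV[R]_m -> R) (x : 'rV[R]_m) (N : nat) (K : R).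

(* The grid of mesh 1/n in the box [-n, n]^m, with n = N + 1. *)
Definition grid_size N : nat := (N.+1 * N.+1).*2.+1.

Definition grid_coord N (j : 'I_(grid_size N)) : R :=
  (j%:R - (N.+1 * N.+1)%:R) / N.+1%:R.

Definition grid_point N (z : {ffun 'I_m -> 'I_(grid_size N)}) : 'rV[R]_m :=
  \row_a grid_coord (z a).

Definition riemann_sum N f : R :=
  N.+1%:R ^- m * \sum_(z : {ffun 'I_m -> 'I_(grid_size N)}) f (grid_point z).

Definition supported K f := forall x, K < `|x| -> f x = 0.

Lemma riemann_sumD N f g :
  riemann_sum N (fun x => f x + g x) = riemann_sum N f + riemann_sum N g.
Proof. by rewrite /riemann_sum big_split mulrDr. Qed.

Lemma riemann_sumZ N c f :
  riemann_sum N (fun x => c * f x) = c * riemann_sum N f.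
Proof. by rewrite /riemann_sum -mulr_sumr mulrCA. Qed.

Lemma riemann_sum_le N f g : (forall x, f x <= g x) ->
  riemann_sum N f <= riemann_sum N g.
Proof.
by move=> fg; rewrite ler_pM2l ?invr_gt0 ?exprn_gt0//; apply: ler_sum.
Qed.

Lemma riemann_sum_norm N f :
  `|riemann_sum N f| <= riemann_sum N (fun x => `|f x|).
Proof.
rewrite normrM ger0_norm ?invr_ge0 ?exprn_ge0//.
by rewrite ler_pM2l ?invr_gt0 ?exprn_gt0//; exact: ler_norm_sum.
Qed.

Lemma riemann_sum_prod N (F : 'I_m -> R -> R) :
  riemann_sum N (fun x => \prod_a F a (x 0 a)) =
  \prod_a (N.+1%:R^-1 * \sum_(j < grid_size N) F a (grid_coord j)).
Proof.
rewrite big_split /= prodr_const card_ord exprVn; congr (_ * _).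
rewrite bigA_distr_bigA; apply: eq_bigr => z _.
by apply: eq_bigr => a _; rewrite mxE.
Qed.

Lemma grid_count_le N K : 0 <= K ->
  \sum_(j < grid_size N) ((`|grid_coord j| <= K)%R : nat)%:R <=
  (2 * K + 1) * N.+1%:R :> R.
Proof.
move=> K0; set n := N.+1; have n0 : (0 : R) < n%:R by [].
pose t := Num.truncn (K * n%:R).
have tK : t%:R <= K * n%:R by rewrite truncn_le mulr_ge0.
rewrite -natr_sum.
pose P : pred 'I_(grid_size N) := fun j => `|grid_coord j| <= K.
have -> : (\sum_(j < grid_size N) ((`|grid_coord j| <= K)%R : nat))%N = #|P|.
  rewrite -sum1_card [RHS]big_mkcond /=; apply: eq_bigr => j _.
  by rewrite unfold_in /P; case: ifP.
apply: (@le_trans _ _ (t.*2.+1)%:R).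
  rewrite ler_nat -[leqRHS]card_ord.
  (* The indices that count lie within [t] of the central index [n * n]. Shifting them to start at 0
     embeds them in [2 t + 1] values; for them the truncated subtraction is exact. *)
  pose h (j : 'I_(grid_size N)) : 'I_t.*2.+1 := inord (j + t - n * n).
  have bnd (j : 'I_(grid_size N)) : `|grid_coord j| <= K ->
      (n * n <= j + t)%N /\ (j <= n * n + t)%N.
    rewrite normrM [`|_^-1|]ger0_norm ?invr_ge0 ?(ltW n0)// ler_pdivrMr//.
    have [jn|/ltnW jn] := leqP (n * n) j.
      rewrite -natrB// ger0_norm// -truncn_ge_nat ?mulr_ge0// -/t; lia.
    rewrite distrC -natrB// ger0_norm// -truncn_ge_nat ?mulr_ge0// -/t; lia.
  rewrite -(card_in_imset (f := h)); last first.
    move=> i j /bnd[i1 i2] /bnd[j1 j2] /(congr1 val) /=.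
    have inr (l : 'I_(grid_size N)) : (n * n <= l + t)%N -> (l <= n * n + t)%N ->
        (l + t - n * n < t.*2.+1)%N by lia.
    rewrite !inordK ?inr// => E; apply/val_inj => /=; lia.
  exact: max_card.
rewrite -addn1 natrD -muln2 natrM mulrDl mul1r.
by rewrite lerD ?ler1n// mulrC -mulrA ler_pM2l.
Qed.

(** The norm is the maximum of the coordinates, so the indicator of the ball of radius [K] is a
    product and its Riemann sum factors into one-dimensional counts. The bound does not depend on
    [N], which is what makes ultrafilter limits exist. *)
Lemma riemann_sum_bound N f C K : 0 <= K -> (forall x, `|f x| <= C) ->
  supported K f -> `|riemann_sum N f| <= C * (2 * K + 1) ^+ m.
Proof.
move=> K0 fC fK; apply: le_trans (riemann_sum_norm _ _) _.
have C0 : 0 <= C by apply: le_trans (fC 0).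
pose F (a : 'I_m) (t : R) : R := ((`|t| <= K)%R : nat)%:R.
apply: le_trans (riemann_sum_le _ (g := fun x => C * \prod_a F a (x 0 a)) _) _.
  move=> x; have [xK|xK] := leP `|x| K; last first.
    by rewrite fK// normr0 mulr_ge0// prodr_ge0// => a _; rewrite ler0n.
  rewrite big1 ?mulr1// => a _; rewrite /F (le_trans _ xK)//.
  exact: rV_coord_norm.
rewrite riemann_sumZ ler_wpM2l// riemann_sum_prod.
rewrite -[X in _ <= _ ^+ X]card_ord -prodr_const.
apply: ler_prod => a _; rewrite mulr_ge0 ?sumr_ge0//= mulrC.
by rewrite ler_pdivrMr// grid_count_le.
Qed.

End RiemannSums.

Lemma ultra_fmap (T U : Type) (f : T -> U) (F : set_system T) :
  UltraFilter F -> UltraFilter (f @ F).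
Proof.
move=> UF; split=> [|G PG FG]; first exact: fmap_proper_filter.
apply/seteqP; split=> A; last exact: FG.
move=> GA; have [//|FC] := in_ultra_setVsetC (f @^-1` A) UF.
have GC : G (~` A) by exact: FG.
have GN : G (A `&` ~` A) by exact: filterI.
by have [x []] := filter_ex GN.
Qed.

(** It refines [\oo]: what holds for all large [N] holds along it, so ordinary limits are not
    changed. *)
Definition nat_ultrafilter : set_system nat :=
  sval (cid (@ultraFilterLemma nat \oo _)).

#[global] Instance nat_ultrafilterP : UltraFilter nat_ultrafilter.
Proof. by rewrite /nat_ultrafilter; case: cid => ? []. Qed.

Lemma nat_ultrafilter_eventually (P : set nat) :
  (\forall N \near \oo, P N) -> \forall N \near nat_ultrafilter, P N.
Proof. by rewrite /nat_ultrafilter; case: cid => G [_ +] /=; apply. Qed.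

Lemma ultra_bounded_cvg (R : realType) (u : nat -> R) (B : R) :
  (forall N, `|u N| <= B) -> cvg (u @ nat_ultrafilter).
Proof.
move=> uB; have := @segment_compact R (- B) B; rewrite compact_ultra.
have uF := ultra_fmap u nat_ultrafilterP.
have uI : (u @ nat_ultrafilter) `[- B, B]%classic.
  apply: (@filterE _ nat_ultrafilter) => N /=.
  by rewrite in_itv /= -ler_norml; exact: uB.
by move=> /(_ _ uF uI)[l [_ ul]]; apply/cvg_ex; exists l.
Qed.

Lemma compact_norm_le (R : realType) (m : nat) (K : R) :
  compact [set x : 'rV[R]_m | `|x| <= K].
Proof.
apply: bounded_closed_compact.
  exists K; split; first by rewrite num_real.
  by move=> t Kt x /= xK; rewrite (le_trans xK)// ltW.
have -> : [set x : 'rV[R]_m | `|x| <= K] = Num.norm @^-1` [set t | t <= K] by [].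
apply: closed_comp; last exact: closed_le.
by move=> x _; exact: norm_continuous.
Qed.

Section Integral.
Context {R : realType} {m : nat}.
Implicit Types (f g : 'rV[R]_m -> R) (x : 'rV[R]_m) (K : R).

Definition compactly_supported f :=
  (forall x, {for x, continuous f}) /\ exists K, supported K f.

Lemma compactly_supported_bounded f : compactly_supported f ->
  exists C K, [/\ 0 <= K, forall x, `|f x| <= C & supported K f].
Proof.
move=> [fc [K fK]].
have B0 : [set x : 'rV[R]_m | `|x| <= `|K|] !=set0 by exists 0; rewrite /= normr0.
have [|c _ cmax] := compact_EVT_max B0 (@compact_norm_le R m `|K|)
  (f := fun x => `|f x|).
  apply: continuous_subspaceT => x.
  by apply: continuous_comp; [exact: fc|exact: norm_continuous].
exists `|f c|, `|K|; split => // [x|x Kx]; last first.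
  by apply: fK; rewrite (le_lt_trans _ Kx)// ler_norm.
have [xK|xK] := leP `|x| `|K|; first by apply: cmax; apply/mem_set.
by rewrite fK ?normr0//; rewrite (le_lt_trans _ xK)// ler_norm.
Qed.

(* The limit along an ultrafilter exists for every bounded sequence, so no
   convergence of Riemann sums has to be proved. *)
Definition integral f : R := lim (riemann_sum ^~ f @ nat_ultrafilter).

Lemma integral_cvg f : compactly_supported f ->
  riemann_sum N f @[N --> nat_ultrafilter] --> integral f.
Proof.
move=> /compactly_supported_bounded[C [K [K0 fC fK]]].
apply: (ultra_bounded_cvg (B := C * (2 * K + 1) ^+ m)) => N.
exact: riemann_sum_bound.
Qed.

Lemma integral_lim f l :
  riemann_sum N f @[N --> nat_ultrafilter] --> l -> integral f = l.
Proof. exact: cvg_lim. Qed.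

Lemma integralD f g : compactly_supported f -> compactly_supported g ->
  integral (fun x => f x + g x) = integral f + integral g.
Proof.
move=> cf cg; apply: integral_lim.
under eq_fun do rewrite riemann_sumD.
by apply: cvgD; exact: integral_cvg.
Qed.

Lemma integralZ c f : compactly_supported f ->
  integral (fun x => c * f x) = c * integral f.
Proof.
move=> cf; apply: integral_lim.
under eq_fun do rewrite riemann_sumZ.
by apply: cvgM; [exact: cvg_cst|exact: integral_cvg].
Qed.

Lemma integral0 : integral (fun=> 0) = 0.
Proof.
apply: integral_lim; rewrite (_ : (fun N => _) = fun=> 0); first exact: cvg_cst.
by apply/funext => N; rewrite /riemann_sum big1 ?mulr0.
Qed.

Lemma compactly_supportedD f g :
  compactly_supported f -> compactly_supported g ->
  compactly_supported (fun x => f x + g x).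
Proof.
move=> [fc [K fK]] [gc [L gL]]; split; first by move=> x; exact: continuousD.
exists (Num.max K L) => x; rewrite gt_max => /andP[xK xL].
by rewrite fK// gL// addr0.
Qed.

Lemma compactly_supportedMl f g : (forall x, {for x, continuous f}) ->
  compactly_supported g -> compactly_supported (fun x => f x * g x).
Proof.
move=> fc [gc [L gL]]; split; first by move=> x; exact: continuousM.
by exists L => x xL; rewrite gL// mulr0.
Qed.

Lemma compactly_supported_sum (I : Type) (r : seq I) (P : pred I)
    (F : I -> 'rV[R]_m -> R) : (forall i, P i -> compactly_supported (F i)) ->
  compactly_supported (fun x => \sum_(i <- r | P i) F i x).
Proof.
move=> cF; elim: r => [|i r IH].
  under eq_fun do rewrite big_nil; split; first by move=> x; exact: cst_continuous.
  by exists 0.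
under eq_fun do rewrite big_cons; case Pi: (P i) => //.
by apply: compactly_supportedD => //; exact: cF.
Qed.

Lemma integral_sum (I : Type) (r : seq I) (P : pred I)
    (F : I -> 'rV[R]_m -> R) : (forall i, P i -> compactly_supported (F i)) ->
  integral (fun x => \sum_(i <- r | P i) F i x) =
  \sum_(i <- r | P i) integral (F i).
Proof.
move=> cF; elim: r => [|i r IH].
  under eq_fun do rewrite big_nil; by rewrite big_nil integral0.
under eq_fun do rewrite big_cons; rewrite big_cons; case Pi: (P i) => //.
by rewrite integralD ?IH//; [exact: cF|exact: compactly_supported_sum].
Qed.

Lemma integral_bound f C K : 0 <= K -> (forall x, {for x, continuous f}) ->
  (forall x, `|f x| <= C) -> supported K f ->
  `|integral f| <= C * (2 * K + 1) ^+ m.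
Proof.
move=> K0 fc fC fK; have cf : compactly_supported f by split => //; exists K.
apply: (ler_cvg_to (cvg_norm (integral_cvg cf)) (cvg_cst _)).
by apply: filterE => N; exact: riemann_sum_bound.
Qed.

Lemma integral_ge0 f : compactly_supported f -> (forall x, 0 <= f x) ->
  0 <= integral f.
Proof.
move=> cf f0.
apply: (ler_cvg_to (cvg_cst 0) (integral_cvg cf)); apply: filterE => N.
by rewrite mulr_ge0 ?invr_ge0 ?exprn_ge0// sumr_ge0.
Qed.

End Integral.

Section IntegralProperties.
Context {R : realType} {m : nat}.
Implicit Types (f g : 'rV[R]_m -> R) (x : 'rV[R]_m) (K : R).

(** Uniform continuity on the ball of radius [K + 1] by compactness. For larger [x], shifts shorter
    than 1 stay outside the support. *)
Lemma compactly_supported_uniform f e : compactly_supported f -> 0 < e ->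
  exists2 d, 0 < d & forall x h, `|h| < d -> `|f (x + h) - f x| < e.
Proof.
move=> [fc [K fK]] e0.
have e2 : 0 < e / 2 by rewrite divr_gt0.
have [d d0 dP] : exists2 d : R, 0 < d & forall h : 'rV[R]_m, `|h| < d ->
    forall x, `|x| <= K + 1 -> `|f (x + h) - f x| < e.
  have /(compact_near_coveringP _).1 cov := @compact_norm_le R m (K + 1).
  have [|d d0 dP] := (near_normP _ _).1 (cov 'rV[R]_m (nbhs (0 : 'rV[R]_m))
      (fun h x => `|f (x + h) - f x| < e) _ _).
    move=> x _; have /cvgrPdist_lt/(_ _ e2) := fc x.
    move=> /(@near_normP R 'rV[R]_m)[r r0 rP].
    have r2 : 0 < r / 2 by rewrite divr_gt0.
    exists ([set y | `|x - y| < r / 2], [set h | `|h| < r / 2]) => /=.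
      split; first by apply/(@near_normP R 'rV[R]_m); exists (r / 2).
      exact: (@near0_norm_lt R 'rV[R]_m).
    move=> [y h] /= [xy hr].
    rewrite -(subrKA (f x)) (le_lt_trans (ler_normD _ _))// [ltRHS]splitr.
    rewrite ltrD//; last by apply: rP; rewrite (lt_trans xy)//; lra.
    rewrite distrC; apply: rP; rewrite opprD addrA (le_lt_trans (ler_normB _ _))//.
    by rewrite [ltRHS]splitr ltrD.
  by exists d => // h hd; apply: dP; rewrite sub0r normrN.
exists (Num.min d 1); first by rewrite lt_min d0 ltr01.
move=> x h; rewrite lt_min => /andP[hd h1].
have [xK|xK] := leP `|x| (K + 1); first exact: dP.
rewrite !fK ?subrr ?normr0//; first by rewrite (lt_trans _ xK)// ltrDl.
have := ler_distD (x + h) x 0; rewrite !subr0 opprD addrA subrr add0r normrN.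
by move=> H; lra.
Qed.

(** A shift by one mesh is the cyclic shift of the index [z a]. Only the wrap-around layer is
    treated wrongly, and there both values vanish: the coordinate [a] is [- N.+1] on one side and
    just above [N.+1] on the other, beyond the support. *)
Lemma riemann_sum_translate N f a K : supported K f -> K < N.+1%:R ->
  riemann_sum N (fun x => f (x + N.+1%:R^-1 *: evec R a)) = riemann_sum N f.
Proof.
move=> fK KN; congr (_ * _).
pose s (z : {ffun 'I_m -> 'I_(grid_size N)}) : {ffun 'I_m -> 'I_(grid_size N)}
  := [ffun b => if b == a then ordS (z b) else z b].
have s_inj : injective s.
  move=> z1 z2 /ffunP z12; apply/ffunP => b; have := z12 b; rewrite !ffunE.
  by case: eqP => // _; exact: ordS_inj.
rewrite [RHS](reindex_inj s_inj) /=; apply: eq_bigr => z _.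
set n := N.+1%:R; have n0 : (n : R) != 0 by rewrite pnatr_eq0.
have [za|za] := eqVneq (val (z a)) (N.+1 * N.+1).*2.
  rewrite !fK//.
    apply: (lt_le_trans KN); apply: le_trans (rV_coord_norm _ a).
    rewrite !mxE ffunE eqxx /grid_coord /= za modnn sub0r mulNr normrN.
    by rewrite natrM mulfK// ger0_norm.
  apply: (lt_le_trans KN); apply: le_trans (rV_coord_norm _ a).
  rewrite !mxE /grid_coord !eqxx za mulr1 -muln2 natrM mulr_natr mulr2n addrK.
  rewrite natrM mulfK// ger0_norm ?addr_ge0 ?invr_ge0//.
  by rewrite lerDl invr_ge0.
congr f; apply/rowP => b; rewrite !mxE ffunE /=; case: eqP => [->|_].
  rewrite mulr1 /grid_coord /= modn_small.
    by rewrite -natr1 -/n; field.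
  have := ltn_ord (z a); rewrite {2}/grid_size ltnS leq_eqVlt (negbTE za) /=.
  by rewrite ltnS.
by rewrite mulr0 addr0.
Qed.

(** By shift invariance the difference quotient with step one mesh has Riemann sum zero. Subtracting
    it from the derivative leaves an error that is uniformly small by the mean value theorem and
    uniform continuity. *)
Lemma integral_partial f a K : supported K f ->
  (forall x, derivable f x (evec R a)) ->
  compactly_supported ('D_(evec R a) f) -> integral ('D_(evec R a) f) = 0.
Proof.
move=> fK fd cD; apply: integral_lim; apply/cvgrPdist_le => e e0.
(* The constant of [riemann_sum_bound] for support radius [|K| + 1]; the extra 1 makes room for the
   shift, since the mesh is at most 1. *)
pose C : R := (2 * (`|K| + 1) + 1) ^+ m.
have C0 : 0 < C by rewrite exprn_gt0// addr_gt0// mulr_gt0// ltr_wpDl.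
have [d d0 dP] := compactly_supported_uniform cD (divr_gt0 e0 C0).
apply: nat_ultrafilter_eventually.
have NK : \forall N \near \oo, `|K| < N.+1%:R :> R.
  near=> N; apply: (@lt_trans _ _ N%:R); last by rewrite ltr_nat.
  by near: N; exact: nbhs_infty_gtr.
have Nd : \forall N \near \oo, N.+1%:R^-1 < d.
  near=> N; rewrite invf_plt ?posrE// (@lt_trans _ _ N%:R)// ?ltr_nat//.
  by near: N; exact: nbhs_infty_gtr.
apply: filterS2 NK Nd => N KN nd; rewrite sub0r normrN.
set n := N.+1%:R in KN nd; have n0 : 0 < n :> R by [].
set h := n^-1; have h0 : 0 < h by rewrite invr_gt0.
(* Here [n] is the inverse of the mesh [h], so the second term is minus the difference quotient. *)
pose err x := 'D_(evec R a) f x + (- n) * (f (x + h *: evec R a) + (-1) * f x).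
have -> : riemann_sum N ('D_(evec R a) f) = riemann_sum N err.
  rewrite riemann_sumD riemann_sumZ riemann_sumD riemann_sumZ.
  rewrite (@riemann_sum_translate _ _ _ K) ?(le_lt_trans (ler_norm K))//.
  by rewrite mulN1r subrr mulr0 addr0.
have K1 : 0 <= `|K| + 1 by rewrite addr_ge0.
have fK0 x : `|K| < `|x| -> f x = 0.
  by move=> xK; apply: fK; rewrite (le_lt_trans _ xK)// ler_norm.
have he : `|h *: evec R a| <= h.
  apply: rV_norm_le; first exact: ltW.
  move=> b; rewrite !mxE /=; case: eqP; rewrite ?mulr1 ?mulr0 ?normr0 ?(ltW h0)//.
  by rewrite ger0_norm// ltW.
have h1 : h <= 1 by rewrite invf_le1// ler1n.
have mv x : exists2 c, 0 <= c <= h & err x =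
    'D_(evec R a) f x - 'D_(evec R a) f (x + c *: evec R a).
  have [//|c ch] := @mean_value_line _ _ f x (evec R a) 0 h (ltW h0).
  rewrite scale0r addr0 subr0 => E; exists c => //.
  by rewrite /err mulN1r E mulrA mulNr mulfV ?mulN1r// gt_eqF.
have := @riemann_sum_bound _ _ N err (e / C) (`|K| + 1) K1.
rewrite -/C divfK ?gt_eqF//; apply => [x|x xK].
  have [c /andP[c0 ch] ->] := mv x; rewrite distrC ltW// dP//.
  apply: le_lt_trans nd; apply: le_trans ch; apply: rV_norm_le => // b.
  rewrite !mxE /=; case: eqP; rewrite ?mulr1 ?mulr0 ?normr0//.
  by rewrite ger0_norm.
have far c : 0 <= c <= h -> `|K| < `|x + c *: evec R a|.
  move=> /andP[c0 ch].
  have ce : `|c *: evec R a| <= 1.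
    apply: rV_norm_le => // b; rewrite !mxE /=; case: eqP => _.
      by rewrite mulr1 ger0_norm// (le_trans ch).
    by rewrite mulr0 normr0.
  have := ler_distD (x + c *: evec R a) x 0.
  rewrite !subr0 opprD addrA subrr add0r normrN => H.
  have := le_trans H (lerD ce (lexx _)); lra.
have D0 c : 0 <= c <= h -> 'D_(evec R a) f (x + c *: evec R a) = 0.
  move=> ch; rewrite (@near_eq_derive _ _ _ _ (cst 0)) ?derive_cst//.
  apply/(@near_normP R 'rV[R]_m).
  exists (`|x + c *: evec R a| - `|K|); first by rewrite subr_gt0 far.
  move=> y xy; rewrite /= fK0//.
  have := ler_distD y (x + c *: evec R a) 0; rewrite !subr0 => H.
  by clear -xy H; lra.
have [c ch ->] := mv x; rewrite D0//.
have := D0 0; rewrite scale0r addr0 => -> //; first by rewrite subrr.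
by rewrite lexx ltW.
Unshelve. all: by end_near. Qed.

Definition signed_perm (s : {perm 'I_m}) (e : 'I_m -> bool) x : 'rV[R]_m :=
  \row_a ((-1) ^+ e a * x 0 (s a)).

(** Signed permutations of the coordinates map each grid onto itself, so the Riemann sums agree
    exactly. This is how reflections and coordinate exchanges are covered, which no path of
    invertible matrices with positive determinant could reach in all cases. *)
Lemma integral_signed_perm s e f : integral (fun x => f (signed_perm s e x)) =
  integral f.
Proof.
rewrite /integral; suff -> : riemann_sum ^~ (fun x => f (signed_perm s e x)) =
  riemann_sum ^~ f by [].
apply/funext => N; congr (_ * _).
pose t (z : {ffun 'I_m -> 'I_(grid_size N)}) : {ffun 'I_m -> 'I_(grid_size N)}
  := [ffun a => if e a then rev_ord (z (s a)) else z (s a)].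
have t_inj : injective t.
  move=> z1 z2 /ffunP z12; apply/ffunP => b; have := z12 (s^-1 b)%g.
  by rewrite !ffunE permKV; case: ifP => // _ /rev_ord_inj.
rewrite [RHS](reindex_inj t_inj) /=; apply: eq_bigr => z _; congr f.
apply/rowP => a; rewrite !mxE ffunE; case: (e a); last by rewrite expr0 mul1r.
rewrite expr1 mulN1r /grid_coord -mulNr /= opprB; congr (_ / _).
have zl := ltn_ord (z (s a)); rewrite [X in (_ < X)%N]/grid_size ltnS in zl.
by rewrite subSS natrB// -addnn natrD; ring.
Qed.

(** An interval of length [2 d] centred at [t] contains at least the integer part of [d * N.+1] grid
    points, and [2 <= d * N.+1] makes this at least half of [d * N.+1]. The first hypothesis keeps
    the interval inside the grid. *)
Lemma grid_count_ge N (t d : R) : `|t| + d < N.+1%:R -> 2 <= d * N.+1%:R ->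
  d * N.+1%:R / 2 <=
  \sum_(j < grid_size N) ((`|grid_coord j - t| < d)%R : nat)%:R :> R.
Proof.
move=> tdN d2; set n := N.+1 in tdN d2 *; have n0 : (0 : R) < n%:R by [].
have d0 : 0 < d by rewrite -(pmulr_lgt0 _ n0) (lt_le_trans _ d2).
have [tn1 tn2] : - t < n%:R - d /\ t < n%:R - d.
  by have := ler_norm t; have := ler_norm (- t); rewrite normrN; split; lra.
(* The position of [t - d] in units of the mesh, counted from the left end [- n] of the grid; the
   points counted below have the indices [q.+1, ..., q + p] that follow it. *)
pose lo := (n%:R + t - d) * n%:R.
have lo0 : 0 <= lo by rewrite mulr_ge0//; lra.
pose p := Num.truncn (d * n%:R); pose q := Num.truncn lo.
have /andP[q1 q2] : q%:R <= lo < q.+1%:R by exact: truncn_itv.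
have /andP[p1 p2] : p%:R <= d * n%:R < p.+1%:R.
  by apply: truncn_itv; rewrite mulr_ge0// ltW.
have loE : lo = (n * n)%:R + t * n%:R - d * n%:R.
  by rewrite natrM /lo mulrBl mulrDl.
have tn : t * n%:R <= (n * n)%:R by rewrite natrM ler_pM2r//; lra.
have qp : (q + p <= (n * n).*2)%N.
  by rewrite -(ler_nat R) natrD -addnn natrD; lra.
pose P : pred 'I_(grid_size N) := fun j => `|grid_coord j - t| < d.
have -> : \sum_(j < grid_size N) ((`|grid_coord j - t| < d)%R : nat)%:R =
    #|P|%:R :> R.
  rewrite -natr_sum; congr (_%:R).
  rewrite -sum1_card [RHS]big_mkcond /=; apply: eq_bigr => j _.
  by rewrite unfold_in /P; case: ifP.
have hlt (i : 'I_p) : (q.+1 + i < grid_size N)%N.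
  by rewrite ltnS (leq_trans _ qp)// addSnnS leq_add2l.
pose h (i : 'I_p) : 'I_(grid_size N) := Ordinal (hlt i).
have h_inj : injective h.
  by move=> i j /(congr1 val) /= /addnI /val_inj.
apply: (@le_trans _ _ p%:R); first by rewrite -natr1 in p2; lra.
rewrite ler_nat -[leqLHS]card_ord -(card_imset predT h_inj).
apply/subset_leq_card/fintype.subsetP => _ /imsetP[i _ ->].
rewrite unfold_in /P /grid_coord /= -/n.
have -> : ((q.+1 + i)%:R - (n * n)%:R) / n%:R - t =
    ((q.+1 + i)%:R - (n * n)%:R - t * n%:R) / n%:R :> R.
  by field; rewrite gt_eqF.
rewrite normrM [`|_^-1|]ger0_norm ?invr_ge0 ?(ltW n0)// ltr_pdivrMr//.
have i1 : (q.+1 + i)%:R <= q%:R + p%:R :> R.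
  by rewrite -natrD ler_nat addSnnS leq_add2l.
have i2 : q.+1%:R <= (q.+1 + i)%:R :> R by rewrite ler_nat leq_addr.
have dn : 0 < d * n%:R by rewrite mulr_gt0.
by rewrite ltr_norml; apply/andP; split; lra.
Qed.

(** On a cube of half-side [d] around [x] the function exceeds [f x / 2], and the Riemann sums of
    the indicator of this cube are eventually bounded below. *)
Lemma integral_gt0 f x : compactly_supported f -> (forall y, 0 <= f y) ->
  0 < f x -> 0 < integral f.
Proof.
move=> cf f0 fx0.
have c0 : 0 < f x / 2 by rewrite divr_gt0.
have [d d0 dP] : exists2 d : R, 0 < d &
    forall y, `|x - y| < d -> f x / 2 <= f y.
  have /cvgrPdist_lt/(_ _ c0)/(@near_normP R 'rV[R]_m)[d d0 dP] := cf.1 x.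
  exists d => // y /dP H; have := ler_norm (f x - f y); lra.
pose F (a : 'I_m) (t : R) : R := ((`|t - x 0 a| < d)%R : nat)%:R.
have lower : \forall N \near \oo,
    f x / 2 * (d / 2) ^+ m <= riemann_sum N f.
  have Nx : \forall N \near \oo, `|x| + d < N.+1%:R :> R.
    near=> N; apply: (@lt_trans _ _ N%:R); last by rewrite ltr_nat.
    by near: N; exact: nbhs_infty_gtr.
  have Nd : \forall N \near \oo, 2 <= d * N.+1%:R :> R.
    near=> N; rewrite mulrC -ler_pdivrMr// ltW// (@lt_trans _ _ N%:R)//.
      by near: N; exact: nbhs_infty_gtr.
    by rewrite ltr_nat.
  apply: filterS2 Nx Nd => N NX ND.
  apply: (@le_trans _ _ (riemann_sum N (fun y => f x / 2 *
    \prod_a F a (y 0 a)))); last first.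
    apply: riemann_sum_le => y.
    have [/forallP ya|] := boolP [forall a, `|y 0 a - x 0 a| < d]; last first.
      rewrite negb_forall => /existsP[a /negbTE ya].
      by rewrite (bigD1 a)//= /F ya mul0r mulr0 f0.
    rewrite big1 => [|a _]; last by rewrite /F ya.
    rewrite mulr1 dP// distrC.
    rewrite [ltLHS]/Num.Def.normr/= mx_normrE; apply: bigmax_lt => //.
    by move=> [i a] _ /=; rewrite (ord1 i) !mxE.
  rewrite riemann_sumZ ler_pM2l// riemann_sum_prod.
  rewrite -[X in _ ^+ X <= _]card_ord -prodr_const.
  apply: ler_prod => a _; rewrite divr_ge0 ?(ltW d0)//=.
  rewrite [leRHS]mulrC ler_pdivlMr// mulrAC; apply: grid_count_ge => //.
  by rewrite (le_lt_trans _ NX)// lerD2r rV_coord_norm.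
apply: (@lt_le_trans _ _ (f x / 2 * (d / 2) ^+ m)).
  by rewrite mulr_gt0// exprn_gt0// divr_gt0.
apply: (ler_cvg_to (cvg_cst _) (integral_cvg cf)).
exact: nat_ultrafilter_eventually.
Unshelve. all: by end_near. Qed.

End IntegralProperties.

(** * Derivatives of forms evaluated along maps *)

Section FormDerivative.
Context {R : realType}.

Lemma is_derive_prod (V : normedModType R) (I : eqType) (r : seq I)
    (F : I -> V -> R) x v : uniq r -> (forall i, derivable (F i) x v) ->
  is_derive x v (fun y => \prod_(i <- r) F i y)
    (\sum_(i <- r) 'D_v (F i) x * \prod_(j <- r | j != i) F j x).
Proof.
move=> + Fd; elim: r => [_|i r IH /= /andP[ir ur]].
  have -> : (fun y => \prod_(i <- [::]) F i y) = cst 1.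
    by apply/funext => y; rewrite big_nil.
  by rewrite big_nil; exact: is_derive_cst.
have -> : (fun y => \prod_(j <- i :: r) F j y) =
    F i * (fun y => \prod_(j <- r) F j y).
  by apply/funext => y; rewrite big_cons.
have {}IH := IH ur; have Fi := derivableP (Fd i).
apply: is_derive_eq; rewrite big_cons big_cons eqxx /=.
rewrite addrC; congr (_ + _).
  rewrite -[_ *: _]/(_ * _) mulrC; congr (_ * _).
  rewrite big_seq [RHS]big_seq_cond; apply: eq_bigl => j.
  by case: (boolP (j \in r)) => //= jr; apply/esym; apply: contraNneq ir => <-.
rewrite -[_ *: _]/(_ * _) mulr_sumr; apply: eq_big_seq => j jr.
rewrite big_cons; case: eqVneq => [ij|_]; last by rewrite mulrCA.
by rewrite -ij (negbTE ir) in jr.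
Qed.

Lemma derive_comp_vec (V W : normedModType R) (f : V -> W) (g : W -> R) x v :
  differentiable f x -> differentiable g (f x) ->
  'D_v (fun y => g (f y)) x = 'D_('D_v f x) g (f x).
Proof.
move=> fd gd; rewrite deriveE; last exact: differentiable_comp.
by rewrite diff_comp//= -!deriveE.
Qed.

Lemma deriveZv (V : normedModType R) (g : V -> R) x v c :
  differentiable g x -> 'D_(c *: v) g x = c * 'D_v g x.
Proof. by move=> gd; rewrite !deriveE// linearZ. Qed.

Lemma derive_sumv (V : normedModType R) (g : V -> R) x (I : Type) (r : seq I)
    (c : I -> R) (u : I -> V) : differentiable g x ->
  'D_(\sum_(i <- r) c i *: u i) g x = \sum_(i <- r) c i * 'D_(u i) g x.
Proof.
move=> gd; rewrite deriveE// linear_sum; apply: eq_bigr => i _.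
by rewrite linearZ -deriveE.
Qed.

Lemma derive_sum_fun (V : normedModType R) (I : Type) (r : seq I)
    (F : I -> V -> R) x v : (forall i, derivable (F i) x v) ->
  is_derive x v (fun y => \sum_(i <- r) F i y) (\sum_(i <- r) 'D_v (F i) x).
Proof.
move=> Fd; elim: r => [|i r IH].
  have -> : (fun y => \sum_(i <- [::]) F i y) = cst 0.
    by apply/funext => y; rewrite big_nil.
  by rewrite big_nil; exact: is_derive_cst.
have -> : (fun y => \sum_(j <- i :: r) F j y) =
    F i + (fun y => \sum_(j <- r) F j y).
  by apply/funext => y; rewrite big_cons.
by have Fi := derivableP (Fd i); rewrite big_cons; exact: is_deriveD.
Qed.

Section Form.
Context {m k : nat} (w : 'rV[R]_k -> 'M[R]_(m, k) -> R).

(** The product rule: one term for the moving base point and one for each moving row. It is obtained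
    by expanding over [basis_mx phi], which is why multilinearity is asked at all points near
    [f x]. *)
Lemma derive_form (V : normedModType R) (f : V -> 'rV[R]_k)
    (X : V -> 'M[R]_(m, k)) x v :
  (\forall z \near f x, multilinear (w z)) ->
  (forall phi, differentiable (w ^~ (basis_mx phi)) (f x)) ->
  differentiable f x ->
  (forall r b, derivable (fun y => X y r b) x v) ->
  'D_v (fun y => w (f y) (X y)) x =
  'D_('D_v f x) (w ^~ (X x)) (f x) +
  \sum_r w (f x) (set_row r ('D_v (fun y => row r (X y)) x) (X x)).
Proof.
move=> mw cd fd Xd.
have fc := differentiable_continuous fd.
have mwx := nbhs_singleton mw.
pose P (phi : {ffun 'I_m -> 'I_k}) y := \prod_r X y r (phi r).
have Pd phi : is_derive x v (P phi) (\sum_r 'D_v (fun y => X y r (phi r)) x *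
    \prod_(s | s != r) X x s (phi s)).
  rewrite /P; have := @is_derive_prod V _ (index_enum 'I_m)
    (fun r y => X y r (phi r)) x v (index_enum_uniq _) (fun r => Xd r (phi r)).
  exact.
have cfd phi : differentiable (fun y => w (f y) (basis_mx phi)) x.
  exact: (differentiable_comp fd (cd phi)).
have -> : 'D_v (fun y => w (f y) (X y)) x =
    'D_v (fun y => \sum_phi P phi y * w (f y) (basis_mx phi)) x.
  apply: near_eq_derive; have := near_preim fc mw.
  by apply: nearS => y mwy; exact: multilinear_expand.
have Td phi : is_derive x v (fun y => P phi y * w (f y) (basis_mx phi))
    (P phi x * 'D_('D_v f x) (w ^~ (basis_mx phi)) (f x) +
     (\sum_r 'D_v (fun y => X y r (phi r)) x *
      \prod_(s | s != r) X x s (phi s)) * w (f x) (basis_mx phi)).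
  have cd' : is_derive x v (fun y => w (f y) (basis_mx phi))
      ('D_('D_v f x) (w ^~ (basis_mx phi)) (f x)).
    by split; [exact: diff_derivable|exact: (derive_comp_vec v fd (cd phi))].
  have H := is_deriveM (Pd phi) cd'; apply: (is_derive_eq H).
  by congr (_ + _); rewrite -[_ *: _]/(_ * _)// mulrC.
have [_ ->] := derive_sum_fun (index_enum _) (fun phi => @ex_derive _ _ _ _ _ _ _ (Td phi)).
under eq_bigr do rewrite (@derive_val _ _ _ _ _ _ _ (Td _)).
rewrite big_split /=; congr (_ + _).
  have -> : 'D_('D_v f x) (w ^~ (X x)) (f x) =
    'D_('D_v f x) (fun z => \sum_phi P phi x * w z (basis_mx phi)) (f x).
    apply: near_eq_derive; apply: nearS mw => z mwz.
    exact: multilinear_expand.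
  have cdv phi : is_derive (f x) ('D_v f x) (fun z => P phi x * w z (basis_mx phi))
      (P phi x * 'D_('D_v f x) (w ^~ (basis_mx phi)) (f x)).
    have cd' := derivableP (diff_derivable (v := 'D_v f x) (cd phi)).
    exact: (is_deriveZ (P phi x) cd').
  have [_ ->] := derive_sum_fun (index_enum _) (fun phi => @ex_derive _ _ _ _ _ _ _ (cdv phi)).
  by apply: eq_bigr => phi _; rewrite (@derive_val _ _ _ _ _ _ _ (cdv phi)).
under eq_bigr do rewrite mulr_suml.
rewrite exchange_big /=; apply: eq_bigr => r _.
rewrite [RHS]multilinear_expand//; apply: eq_bigr => phi _; congr (_ * _).
rewrite [RHS](bigD1 r)//= set_rowE eqxx; congr (_ * _).
  have -> : (fun y => X y r (phi r)) = (fun y => row r (X y) 0 (phi r)).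
    by apply/funext => y; rewrite mxE.
  rewrite derivable_coord//; apply/derivable_mxP => i j.
  rewrite (_ : (fun y => _) = fun y => X y r j)//.
  by apply/funext => y; rewrite mxE.
by apply: eq_bigr => s /negbTE sr; rewrite set_rowE sr.
Qed.

Lemma ck_form l n (f : 'rV[R]_l -> 'rV[R]_k) (X : 'rV[R]_l -> 'M[R]_(m, k)) x :
  (\forall z \near f x, multilinear (w z)) ->
  (forall phi, ck n (w ^~ (basis_mx phi)) (f x)) ->
  vck n f x -> (forall r b, ck n (fun y => X y r b) x) ->
  ck n (fun y => w (f y) (X y)) x.
Proof.
move=> mw cw cf cX.
have E : \forall y \near x, \sum_(phi : {ffun 'I_m -> 'I_k})
    (\prod_r X y r (phi r)) * w (f y) (basis_mx phi) = w (f y) (X y).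
  have := near_preim (vck_continuous cf) mw.
  by apply: nearS => y mwy; rewrite -multilinear_expand.
apply: (ck_congr E).
apply: ck_sum => phi _; apply: ckM; first exact: ck_prod.
exact: (ck_comp cf (cw phi)).
Qed.

End Form.

Lemma row_jacobian k l (f : 'rV[R]_k -> 'rV[R]_l) x a : differentiable f x ->
  row a ('J f x) = 'D_(evec R a) f x.
Proof. by move=> fd; rewrite rowE -[delta_mx _ _]/(evec R a) -deriveEjacobian. Qed.

Lemma jacobian_coord k l (f : 'rV[R]_k -> 'rV[R]_l) x a b : differentiable f x ->
  'J f x a b = 'D_(evec R a) (fun y => f y 0 b) x.
Proof.
move=> fd; rewrite -derivable_coord; last exact: diff_derivable.
by rewrite -row_jacobian// [RHS]mxE.
Qed.

Lemma ck_jacobian k l n (f : 'rV[R]_k -> 'rV[R]_l) x a b : vck n.+1 f x ->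
  ck n (fun y => 'J f y a b) x.
Proof.
move=> cf; apply: ck_congr (ck_partial a (cf b)).
by apply: nearS (vck_near_differentiable cf) => y fd; rewrite jacobian_coord.
Qed.

Lemma derive_row_jacobian k l (f : 'rV[R]_k -> 'rV[R]_l) x a b : vck 2 f x ->
  'D_(evec R a) (fun y => row b ('J f y)) x =
  \row_j 'D_(evec R a) ('D_(evec R b) (fun y => f y 0 j)) x.
Proof.
move=> cf; apply/rowP => j; rewrite mxE derivable_coord; last first.
  apply/derivable_mxP => i j'.
  rewrite (_ : (fun y => _) = fun y => 'J f y b j').
    exact/diff_derivable/ck_differentiable/(ck_jacobian b j' cf).
  by apply/funext => y; rewrite mxE.
apply: near_eq_derive; apply: nearS (vck_near_differentiable cf) => y fd.
by rewrite mxE jacobian_coord.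
Qed.

(* The mixed second derivatives of f cancel in pairs, by antisymmetry. *)
Lemma divergence_insert m k (w : 'rV[R]_k -> 'M[R]_(m, k) -> R)
    (f W : 'rV[R]_m -> 'rV[R]_k) x :
  (\forall z \near f x, multilinear (w z)) -> alternating (w (f x)) ->
  (forall phi, ck 1 (w ^~ (basis_mx phi)) (f x)) ->
  vck 2 f x -> vck 1 W x ->
  \sum_a 'D_(evec R a) (fun y => w (f y) (set_row a (W y) ('J f y))) x =
  \sum_a ('D_(row a ('J f x)) (w ^~ (set_row a (W x) ('J f x))) (f x) +
          w (f x) (set_row a ('D_(evec R a) W x) ('J f x))).
Proof.
move=> mw aw cw cf cW; have fd := vck_differentiable cf.
have mwx := nbhs_singleton mw.
pose S a b := 'D_(evec R a) (fun y => row b ('J f y)) x.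
have SC a b : S a b = S b a.
  have SE c d : S c d = \row_j 'D_(evec R c) ('D_(evec R d) (fun y => f y 0 j)) x.
    exact: derive_row_jacobian.
  apply/rowP => j; rewrite !SE [LHS]mxE [RHS]mxE.
  exact: derive_swap (cf j).
transitivity (\sum_a
  ('D_(row a ('J f x)) (w ^~ (set_row a (W x) ('J f x))) (f x) +
   (w (f x) (set_row a ('D_(evec R a) W x) ('J f x)) +
    \sum_(b | b != a) w (f x) (set_row b (S a b) (set_row a (W x) ('J f x)))))).
  apply: eq_bigr => a _.
  have rowE b : (fun y => row b (set_row a (W y) ('J f y))) =
      if b == a then W else fun y => row b ('J f y).
    by apply/funext => y; rewrite row_set_row; case: eqP.
  have Xd r b : derivable (fun y => set_row a (W y) ('J f y) r b) x (evec R a).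
    have -> : (fun y => set_row a (W y) ('J f y) r b) =
      (fun y => if r == a then W y 0 b else 'J f y r b).
      by apply/funext => y; rewrite set_rowE.
    case: eqP => _; apply/diff_derivable.
      exact: ck_differentiable (cW b).
    exact: ck_differentiable (ck_jacobian r b cf).
  have cd phi : differentiable (w ^~ (basis_mx phi)) (f x).
    exact: ck_differentiable (cw phi).
  rewrite (derive_form mw cd fd Xd) row_jacobian //.
  apply: congr1.
  apply: etrans (bigD1 a isT) _.
  have E b : set_row b ('D_(evec R a) (fun y => row b (set_row a (W y) ('J f y))) x)
      (set_row a (W x) ('J f x)) = if b == a then
        set_row a ('D_(evec R a) W x) ('J f x) else
        set_row b (S a b) (set_row a (W x) ('J f x)).
    by rewrite rowE; case: eqP => // ->; exact: set_row_same.
  have Ea := E a; rewrite eqxx in Ea.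
  rewrite {1}Ea.
  apply: congr1.
  apply: eq_bigr => b ba.
  have Eb := E b; rewrite (negbTE ba) in Eb.
  exact: congr1 Eb.
under eq_bigr do rewrite addrA.
by rewrite big_split /= alternating_sym_cancel// addr0.
Qed.

End FormDerivative.

(** * One-variable estimates and extension by zero *)

Lemma mean_value_between (R : realType) (g g' : R -> R) (s t : R) :
  (forall c : R, is_derive c 1 g (g' c)) ->
  exists2 c, Num.min s t <= c <= Num.max s t & g s - g t = (s - t) * g' c.
Proof.
move=> gd.
have gc a b : {within `[a, b], continuous g}.
  by apply: derivable_within_continuous => c _; have [] := gd c.
have [st|/ltW ts] := leP s t.
  have [c cst E] := MVT_segment st (fun c _ => gd c) (gc s t).
  by exists c; [rewrite in_itv in cst|rewrite -opprB E mulrC -mulNr opprB].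
have [c cst E] := MVT_segment ts (fun c _ => gd c) (gc t s).
by exists c; [rewrite in_itv in cst|rewrite E mulrC].
Qed.

Lemma between_dist (R : realType) (s t c : R) :
  Num.min s t <= c <= Num.max s t -> `|c - t| <= `|s - t|.
Proof.
rewrite ge_min le_max.
have := ler_norm (s - t); have := ler_norm (- (s - t)); rewrite normrN.
move=> h1 h2 /andP[h3 h4]; rewrite ler_norml; apply/andP.
by case/orP: h3 => h3; case/orP: h4 => h4; split; lra.
Qed.

(** A function on the unit interval with zero derivative is constant. The increment estimate needs
    no values outside the interval, which suits a homotopy parameter. *)
Lemma flat_constant (R : realType) (G : R -> R) :
  (forall t e, 0 <= t <= 1 -> 0 < e -> exists2 d, 0 < d &
     forall s, 0 <= s <= 1 -> `|s - t| < d -> `|G s - G t| <= e * `|s - t|) ->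
  G 0 = G 1.
Proof.
move=> flat.
(* Clamping to the unit interval is 1-Lipschitz, so [G \o c] has derivative zero on the whole line,
   endpoints included. *)
pose c (t : R) := Num.min 1 (Num.max 0 t).
have c01 t : 0 <= c t <= 1.
  by rewrite le_min ler01 le_max lexx /= ge_min lexx.
have c_lip s t : `|c s - c t| <= `|s - t|.
  rewrite /c /Num.min /Num.max; do !case: ifP; rewrite -?leNgt; move=> *;
    rewrite ler_norml; apply/andP;
    have := ler_norm (s - t); have := ler_norm (- (s - t)); rewrite normrN;
    move=> *; split; lra.
have Gd (t : R) : is_derive t 1 (G \o c) 0.
  have H : (fun h : R => h^-1 *: (((G \o c) \o shift t) (h *: 1) - (G \o c) t))
      @ 0^' --> (0 : R).
    apply/cvgrPdist_le => e e0.
    have [d d0 dP] := flat _ _ (c01 t) e0.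
    apply/(@near_normP R R^o); exists d => // h; rewrite sub0r normrN => hd h0.
    rewrite sub0r normrN [h *: 1]mulr1 /= normrZ normfV.
    rewrite ler_pdivrMl ?normr_gt0// mulrC.
    have L : `|c (h + t) - c t| <= `|h| by rewrite (le_trans (c_lip _ _))// addrK.
    apply: le_trans (dP _ (c01 _) _) _; first exact: le_lt_trans hd.
    by rewrite ler_pM2l.
  by split; [apply/cvg_ex; exists 0|exact: cvg_lim].
have [x _] := mean_value_between 1 0 Gd.
rewrite mulr0 => /eqP; rewrite subr_eq0 => /eqP /=.
by rewrite /c (max_r ler01) minxx maxxx (min_r ler01) => ->.
Qed.

Section Cut.
Context {R : realType} {m : nat}.
Implicit Types (U K : set 'rV[R]_m) (h : 'rV[R]_m -> R) (x : 'rV[R]_m).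

(** Functions of the coordinates have arbitrary values outside the image of their chart; they must
    be set to zero there before being integrated over R^m. *)
Definition cut U h x : R := if `[< U x >] then h x else 0.

Lemma cut_in U h x : U x -> cut U h x = h x.
Proof. by rewrite /cut => Ux; case: asboolP. Qed.

Lemma cut_out U h x : ~ U x -> cut U h x = 0.
Proof. by rewrite /cut => Ux; case: asboolP. Qed.

Lemma open_near (T : topologicalType) (U : set T) (x : T) : open U -> U x ->
  \forall y \near x, U y.
Proof. by move=> oU Ux; apply: open_nbhs_nbhs. Qed.

(** At a point outside [U], possibly on its boundary, the complement of the closed set [K] is a
    neighbourhood on which the extension vanishes. Regularity and derivatives of [cut U h] follow
    from this dichotomy. *)
Lemma cut_germ U K h x : open U -> closed K -> K `<=` U ->
  (forall y, U y -> ~ K y -> h y = 0) ->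
  (U x /\ \forall y \near x, cut U h y = h y) \/
  (~ U x /\ \forall y \near x, cut U h y = 0).
Proof.
move=> oU cK KU h0; have [Ux|Ux] := pselect (U x).
  left; split => //.
  by apply: nearS (open_near oU Ux) => y; exact: cut_in.
right; split => //.
have Kx : (~` K) x by move=> /KU.
apply: nearS (open_near (closed_openC cK) Kx) => y Ky.
by have [Uy|] := pselect (U y); [rewrite cut_in// h0|exact: cut_out].
Qed.

Lemma ck_cut n U K h : open U -> closed K -> K `<=` U ->
  (forall y, U y -> ~ K y -> h y = 0) ->
  (forall y, U y -> ck n h y) -> forall x, ck n (cut U h) x.
Proof.
move=> oU cK KU h0 ch x; have [[Ux E]|[_ E]] := cut_germ x oU cK KU h0.
  by apply: ck_congr (ch x Ux); apply: nearS E => y ->.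
by apply: ck_congr (ck_cst n 0 x); apply: nearS E => y ->.
Qed.

Lemma derive_cut v U K h x : open U -> closed K -> K `<=` U ->
  (forall y, U y -> ~ K y -> h y = 0) -> 'D_v (cut U h) x = cut U ('D_v h) x.
Proof.
move=> oU cK KU h0; have [[Ux E]|[Ux E]] := cut_germ x oU cK KU h0.
  by rewrite cut_in//; exact: near_eq_derive.
by rewrite cut_out// (near_eq_derive _ (g := cst 0)) ?derive_cst.
Qed.

Lemma compactly_supported_compact K h : compact K ->
  (forall x, ~ K x -> h x = 0) -> (forall x, {for x, continuous h}) ->
  compactly_supported h.
Proof.
move=> cK h0 hc; split => //.
have [M [_ MK]] := compact_bounded cK; exists (M + 1) => x Mx.
apply: h0 => Kx; have := MK (M + 1); rewrite ltrDl ltr01 => /(_ isT x Kx) /=.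
by rewrite leNgt Mx.
Qed.

End Cut.

Lemma continuous_comp_at (T U V : topologicalType) (f : T -> U) (g : U -> V) x :
  {for x, continuous f} -> {for f x, continuous g} ->
  {for x, continuous (fun y => g (f y))}.
Proof. exact: continuous_comp. Qed.

Lemma continuous_snd_at (S T V : topologicalType) (f : T -> V) s x :
  {for x, continuous f} -> {for (s, x), continuous (fun p : S * T => f p.2)}.
Proof.
move=> fc; apply: (@continuous_comp_at _ _ _ snd f (s, x)); last exact: fc.
exact: cvg_snd.
Qed.

Section JointContinuity.
Context {R : realType} {T : topologicalType}.

Lemma continuous_prod_at (I : Type) (r : seq I) (F : I -> T -> R) x :
  (forall i, {for x, continuous (F i)}) ->
  {for x, continuous (fun y => \prod_(i <- r) F i y)}.
Proof.
move=> Fc; elim: r => [|i r IH].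
  have -> : (fun y => \prod_(i <- [::]) F i y) = cst 1.
    by apply/funext => y; rewrite big_nil.
  exact: cst_continuous.
have -> : (fun y => \prod_(j <- i :: r) F j y) =
    F i * (fun y => \prod_(j <- r) F j y).
  by apply/funext => y; rewrite big_cons.
exact: continuousM.
Qed.

Lemma continuous_det n (X : T -> 'M[R]_n) x :
  (forall i j, {for x, continuous (fun y => X y i j)}) ->
  {for x, continuous (fun y => \det (X y))}.
Proof.
move=> Xc; rewrite /determinant; apply: continuous_sum_at => s.
apply: continuousM; first exact: cst_continuous.
by apply: continuous_prod_at => i; exact: Xc.
Qed.

End JointContinuity.

(** * Change of variables *)

Section Homotopy.
Context {R : realType} {m : nat}.
Variables (U K S : set 'rV[R]_m) (phi u : 'rV[R]_m -> 'rV[R]_m)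
  (F : 'rV[R]_m -> R).
Hypotheses (oU : open U) (cK : compact K) (KU : K `<=` U) (cS : closed S)
  (cphi : forall x, U x -> vck 2 phi x) (cu : forall x, U x -> vck 2 u x)
  (cF : forall y, ck 1 F y) (FS : forall y, ~ S y -> F y = 0)
  (SK : forall t x, 0 <= t <= 1 -> U x -> S (phi x + t *: u x) -> K x).

(** The straight homotopy from [phi] to [phi + u]. The assumption [SK] makes it proper uniformly in
    [t]: all the pullbacks vanish on [U] outside one compact [K]. Accordingly [pull t] is the
    coefficient of the pullback of the top-degree form [F dz], with signed determinant, and [dpull]
    is its derivative in [t]. *)
Let path (t : R) x := phi x + t *: u x.
Let pathJ (t : R) x : 'M[R]_m := 'J phi x + t *: 'J u x.
Let pull t x := F (path t x) * \det (pathJ t x).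
Let dpull t x := 'D_(u x) F (path t x) * \det (pathJ t x) +
  \sum_r F (path t x) * \det (set_row r (row r ('J u x)) (pathJ t x)).

Let closedK : closed K.
Proof. by apply: compact_closed => //; exact: norm_hausdorff. Qed.

Let Fd y : differentiable F y.
Proof. exact: ck_differentiable (cF y). Qed.

Let vck_path t x : U x -> vck 2 (path t) x.
Proof.
move=> Ux b; apply: (@ck_congr _ _ _ (fun y => phi y 0 b + t * u y 0 b)).
  by apply: near_all => y; rewrite !mxE.
apply: ckD; first exact: cphi.
by apply: ckM; [exact: ck_cst|exact: cu].
Qed.

Let pathJ_coord t x a b : pathJ t x a b = 'J phi x a b + t * 'J u x a b.
Proof. by rewrite [LHS]mxE [X in _ + X]mxE. Qed.

Let pathJE t x : U x -> 'J (path t) x = pathJ t x.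
Proof.
move=> Ux; apply/matrixP => a b.
have dp := vck_differentiable (cphi Ux); have du := vck_differentiable (cu Ux).
have dpath := vck_differentiable (vck_path t Ux).
rewrite pathJ_coord.
have Dp := derivableP (diff_derivable (v := evec R a) (ck_differentiable (cphi Ux b))).
have Du := derivableP (diff_derivable (v := evec R a) (ck_differentiable (cu Ux b))).
have [_ E] := is_deriveD Dp (is_deriveZ t Du).
apply: etrans (jacobian_coord a b dpath) _.
apply: etrans (esym (congr2 (fun p q => p + t * q) (jacobian_coord a b dp)
  (jacobian_coord a b du))).
apply: etrans (congr1 (fun f => 'D_(evec R a) f x) _) E.
by apply/funext => y; rewrite [LHS]mxE [X in _ + X]mxE.
Qed.

(** The form [F dz] as a field of alternating forms, so that [derive_form] and [divergence_insert]
    apply to it. *)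
Let wdet (z : 'rV[R]_m) (X : 'M[R]_m) := F z * \det X.

Let wdet_multilinear z : multilinear (wdet z).
Proof.
by move=> r X b v c w; rewrite /wdet det_multilinear mulrDr !mulrA ![F z * _]mulrC.
Qed.

Let derive_wdet v X z : 'D_v (wdet ^~ X) z = 'D_v F z * \det X.
Proof.
have Dv := derivableP (diff_derivable (v := v) (Fd z)).
have -> : wdet ^~ X = (fun y => \det X *: F y).
  by apply/funext => y; rewrite /wdet mulrC.
by have [_ ->] := is_deriveZ (\det X) Dv; rewrite mulrC.
Qed.

Let pull_derive x t : U x -> is_derive (t : R) 1 (pull ^~ x) (dpull t x).
Proof.
move=> Ux.
have pd : is_derive (t : R) 1 (path ^~ x) (u x).
  have H : is_derive (t : R) 1 (fun s : R => s *: u x) (u x).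
    have dz : is_diff (t : R) ( *:%R ^~ (u x)) ( *:%R ^~ (u x)).
      exact: is_diff_scalel.
    split; first by apply: diff_derivable; exact: ex_diff.
    by rewrite deriveE//; have [_ ->] := dz; rewrite scale1r.
  have := is_deriveD (is_derive_cst (phi x) (t : R) 1) H.
  by rewrite add0r.
have Jd r b : is_derive (t : R) 1 (fun s => pathJ s x r b) ('J u x r b).
  have -> : (fun s => pathJ s x r b) =
      (fun s : R => 'J phi x r b + 'J u x r b * s).
    by apply/funext => s; rewrite pathJ_coord [s * _]mulrC.
  have H := is_deriveD (is_derive_cst ('J phi x r b) (t : R) 1)
    (is_deriveZ ('J u x r b) (is_derive_id (t : R) 1)).
  by apply: (is_derive_eq H); rewrite add0r [_ *: _]mulr1.
have pdiff : differentiable (path ^~ x) t.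
  by apply/derivable1_diffP; have [] := pd.
have detd : derivable (fun s => \det (pathJ s x)) t 1.
  apply: (@ex_derive _ _ _ _ _ _ _ (derive_sum_fun _ _)) => s.
  apply: derivableM; first exact: derivable_cst.
  apply: (@ex_derive _ _ _ _ _ _ _ (is_derive_prod (index_enum_uniq _) _)) => i.
  by have [] := Jd i (s i).
split.
  apply: (derivableM _ detd); apply: diff_derivable.
  exact: (differentiable_comp pdiff (Fd _)).
have wd : forall f, differentiable (wdet ^~ (basis_mx f)) (path t x).
  by move=> f; apply: differentiableM => //; exact: differentiable_cst.
have mw : \forall z \near path t x, multilinear (wdet z).
  by apply: near_all => z; exact: wdet_multilinear.
have Xd r b : derivable (fun s => pathJ s x r b) t 1 by have [] := Jd r b.
apply: etrans (@derive_form _ _ _ wdet R^o (path^~ x) (pathJ^~ x) t 1 mw wd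
  pdiff Xd) _.
rewrite derive_wdet; have [_ ->] := pd.
apply: congr1; apply: eq_bigr => r _.
congr (_ * \det (set_row _ _ _)); apply/rowP => b.
rewrite derivable_coord; last first.
  apply/derivable_mxP => i j; have [+ _] := Jd r j; apply: near_eq_derivable.
  by apply: near_all => s; rewrite [RHS]mxE.
rewrite [RHS]mxE; have [_ E] := Jd r b; apply: etrans E.
apply: near_eq_derive.
by apply: near_all => s; rewrite [LHS]mxE.
Qed.

(** The components of the pullback of the contraction of [F dz] with the variation field [u]; that
    [dpull] is their divergence is Cartan's homotopy formula for a form of top degree. *)
Let flux t b y := F (path t y) * \det (set_row b (u y) ('J (path t) y)).

Let ck_wdet z X : ck 1 (wdet ^~ X) z.
Proof. by apply: ckM; [exact: cF|exact: ck_cst]. Qed.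

Let dpull_divergence t x : U x ->
  dpull t x = \sum_b 'D_(evec R b) (flux t b) x.
Proof.
move=> Ux; have cp := vck_path t Ux.
rewrite (@divergence_insert _ _ _ wdet (path t) u x).
- rewrite big_split /=; congr (_ + _); last first.
    apply: eq_bigr => r _.
    by rewrite (pathJE t Ux) (row_jacobian r (vck_differentiable (cu Ux))).
  rewrite (pathJE t Ux); under eq_bigr do rewrite derive_wdet mulrC.
  rewrite -(derive_sumv _ _ _ (Fd _)) mulrC -(deriveZv _ _ (Fd _)).
  congr ('D_ _ _ _).
  apply/rowP => b; rewrite summxE mxE.
  (* Cramer's rule: the rows of the Jacobian, weighted by the determinants with [u] inserted, add up
     to [\det (pathJ t x) *: u x]. This collects the derivatives of [F] into a single one along
     [u]. *)
  have := alternating_cofactor (pathJ t x) 1%:M (u x) b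
    (@det_multilinear R m) (@det_alternating R m).
  rewrite mulmx1 => E.
  transitivity (\det (pathJ t x) * \det (set_row b (u x) 1%:M)).
    by rewrite det_set_row1 mulrC.
  by rewrite -E; apply: eq_bigr => a _; rewrite !mxE mulrC.
- by apply: near_all => z; exact: wdet_multilinear.
- move=> X r s rs Xrs; rewrite /wdet (det_alternating rs Xrs) mulr0 //.
- by move=> f; exact: ck_wdet.
- exact: vck_path.
- by apply: vckS; exact: cu.
Qed.

Let joint_fun_continuous (f : 'rV[R]_m -> R) t x : {for x, continuous f} ->
  {for (t, x), continuous (fun p : R * 'rV[R]_m => f p.2)}.
Proof. exact: continuous_snd_at. Qed.

Let joint_path_continuous t x : U x ->
  {for (t, x), continuous (fun p : R * 'rV[R]_m => path p.1 p.2)}.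
Proof.
move=> Ux; apply: continuous_mx => i b; rewrite (ord1 i).
have E : (fun p : R * 'rV[R]_m => path p.1 p.2 0 b) =
    (fun p : R * 'rV[R]_m => phi p.2 0 b) +
    (fst * (fun p : R * 'rV[R]_m => u p.2 0 b)).
  by apply/funext => p; rewrite [LHS]mxE [X in _ + X]mxE.
rewrite E; apply: continuousD.
  exact/(@joint_fun_continuous (fun y => phi y 0 b))/(ck_continuous (cphi Ux b)).
apply: continuousM; first exact: cvg_fst.
exact/(@joint_fun_continuous (fun y => u y 0 b))/(ck_continuous (cu Ux b)).
Qed.

Let joint_pathJ_continuous t x a b : U x ->
  {for (t, x), continuous (fun p : R * 'rV[R]_m => pathJ p.1 p.2 a b)}.
Proof.
move=> Ux.
have E : (fun p : R * 'rV[R]_m => pathJ p.1 p.2 a b) =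
    (fun p : R * 'rV[R]_m => 'J phi p.2 a b) +
    (fst * (fun p : R * 'rV[R]_m => 'J u p.2 a b)).
  by apply/funext => p; rewrite pathJ_coord.
rewrite E; apply: continuousD.
  apply: (@joint_fun_continuous (fun y => 'J phi y a b)).
  exact: ck_continuous (ck_jacobian a b (cphi Ux)).
apply: continuousM; first exact: cvg_fst.
apply: (@joint_fun_continuous (fun y => 'J u y a b)).
exact: ck_continuous (ck_jacobian a b (cu Ux)).
Qed.

Let joint_dpull_continuous t x : U x ->
  {for (t, x), continuous (fun p : R * 'rV[R]_m => dpull p.1 p.2)}.
Proof.
move=> Ux.
have E : (fun p : R * 'rV[R]_m => dpull p.1 p.2) =
    (fun p : R * 'rV[R]_m => \sum_b u p.2 0 b * 'D_(evec R b) F (path p.1 p.2)) *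
    (fun p : R * 'rV[R]_m => \det (pathJ p.1 p.2)) +
    (fun p : R * 'rV[R]_m => \sum_r F (path p.1 p.2) *
       \det (set_row r (row r ('J u p.2)) (pathJ p.1 p.2))).
  apply/funext => p; rewrite /dpull (derive_linear_rV _ (Fd _)) //.
have pc := joint_path_continuous (t := t) Ux.
rewrite E; apply: continuousD.
  apply: continuousM; last first.
    by apply: continuous_det => i j; exact: joint_pathJ_continuous.
  apply: continuous_sum_at => b; apply: continuousM.
    exact/(@joint_fun_continuous (fun y => u y 0 b))/(ck_continuous (cu Ux b)).
  apply: (@continuous_comp_at _ _ _ _ ('D_(evec R b) F) _ pc).
  exact: (ck_continuous (ck_partial b (cF _))).
apply: continuous_sum_at => r; apply: continuousM.
  apply: (@continuous_comp_at _ _ _ _ F _ pc).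
  exact: ck_continuous (cF _).
apply: continuous_det => i j.
have -> : (fun p : R * 'rV[R]_m =>
    set_row r (row r ('J u p.2)) (pathJ p.1 p.2) i j) =
  (fun p => if i == r then 'J u p.2 r j else pathJ p.1 p.2 i j).
  by apply/funext => p; rewrite set_rowE; case: eqP => // _; rewrite [LHS]mxE.
case: eqP => _; last exact: joint_pathJ_continuous.
apply: (@joint_fun_continuous (fun y => 'J u y r j)).
exact: ck_continuous (ck_jacobian r j (cu Ux)).
Qed.

Let F_far t x : 0 <= t <= 1 -> U x -> ~ K x ->
  F (path t x) = 0 /\ forall v, 'D_v F (path t x) = 0.
Proof.
move=> t01 Ux Kx; have nS : (~` S) (path t x) by move=> /(SK t01 Ux).
split=> [|v]; first exact: FS.
rewrite (near_eq_derive _ (g := cst 0)) ?derive_cst//.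
by apply: nearS (open_near (closed_openC cS) nS) => y; exact: FS.
Qed.

Let pull_far t x : 0 <= t <= 1 -> U x -> ~ K x -> pull t x = 0.
Proof. by move=> t01 Ux Kx; rewrite /pull (F_far t01 Ux Kx).1 mul0r. Qed.

Let dpull_far t x : 0 <= t <= 1 -> U x -> ~ K x -> dpull t x = 0.
Proof.
move=> t01 Ux Kx; have [F0 D0] := F_far t01 Ux Kx.
by rewrite /dpull D0 F0 mul0r add0r big1// => r _; rewrite mul0r.
Qed.

Let flux_far t b x : 0 <= t <= 1 -> U x -> ~ K x -> flux t b x = 0.
Proof. by move=> t01 Ux Kx; rewrite /flux (F_far t01 Ux Kx).1 mul0r. Qed.

Let ck_set_row_J n (v : 'rV[R]_m -> 'rV[R]_m) (p : 'rV[R]_m -> 'rV[R]_m) b x :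
  vck n v x -> vck n.+1 p x ->
  forall r c, ck n (fun y => set_row b (v y) ('J p y) r c) x.
Proof.
move=> cv cp r c.
have -> : (fun y => set_row b (v y) ('J p y) r c) =
  (fun y => if r == b then v y 0 c else 'J p y r c).
  by apply/funext => y; rewrite set_rowE.
by case: eqP => _; [exact: cv|exact: ck_jacobian].
Qed.

Let ck_flux t b x : U x -> ck 1 (flux t b) x.
Proof.
move=> Ux; have cp := vck_path t Ux.
apply: (@ck_form _ _ _ wdet _ 1 (path t)
  (fun y => set_row b (u y) ('J (path t) y))).
- by apply: near_all => z; exact: wdet_multilinear.
- by move=> f; exact: ck_wdet.
- exact: vckS.
- by apply: ck_set_row_J => //; apply: vckS; exact: cu.
Qed.

Let cutK_supported h : (forall x, U x -> ~ K x -> h x = 0) ->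
  forall x, ~ K x -> cut U h x = 0.
Proof.
by move=> h0 x Kx; have [Ux|/cut_out->//] := pselect (U x);
  rewrite cut_in// h0.
Qed.

Let cut_pull_cs t : 0 <= t <= 1 -> compactly_supported (cut U (pull t)).
Proof.
move=> t01; have far := fun x => @pull_far t x t01.
apply: (compactly_supported_compact cK (cutK_supported far)) => x.
apply: (ck_continuous (n := 1)); apply: (ck_cut oU closedK KU far) => y Uy.
have cp := vck_path t Uy.
apply: (@ck_congr _ _ _ (fun y => wdet (path t y) ('J (path t) y))).
  by apply: nearS (open_near oU Uy) => z Uz; rewrite /wdet pathJE.
apply: ck_form.
- by apply: near_all => z; exact: wdet_multilinear.
- by move=> f; exact: ck_wdet.
- exact: vckS.
- by move=> r b; exact: ck_jacobian.
Qed.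

Let derive_cut_flux t b x : 0 <= t <= 1 ->
  'D_(evec R b) (cut U (flux t b)) x = cut U ('D_(evec R b) (flux t b)) x.
Proof.
by move=> t01; apply: derive_cut oU closedK KU _ => y; exact: flux_far.
Qed.

Let ck_cut_flux t b x : 0 <= t <= 1 -> ck 1 (cut U (flux t b)) x.
Proof.
move=> t01; apply: (ck_cut oU closedK KU) => y; first exact: flux_far.
exact: ck_flux.
Qed.

Let flux_cs t b : 0 <= t <= 1 ->
  compactly_supported ('D_(evec R b) (cut U (flux t b))).
Proof.
move=> t01; apply: (compactly_supported_compact cK) => x.
  move=> Kx; rewrite (near_eq_derive _ (g := cst 0)) ?derive_cst//.
  apply: nearS (open_near (closed_openC closedK) Kx) => y Ky.
  by apply: cutK_supported => // z; exact: flux_far.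
exact: (ck_partial b (ck_cut_flux b x t01)).
Qed.

Let cut_dpullE t : 0 <= t <= 1 -> cut U (dpull t) =
  (fun x => \sum_b 'D_(evec R b) (cut U (flux t b)) x).
Proof.
move=> t01; apply/funext => x.
under eq_bigr do rewrite derive_cut_flux//.
have [Ux|Ux] := pselect (U x).
  by rewrite cut_in// dpull_divergence//; apply: eq_bigr => b _; rewrite cut_in.
by rewrite cut_out// big1// => b _; rewrite cut_out.
Qed.

Let cut_dpull_cs t : 0 <= t <= 1 -> compactly_supported (cut U (dpull t)).
Proof.
move=> t01; rewrite cut_dpullE//; apply: compactly_supported_sum => b _.
exact: flux_cs.
Qed.

Let integral_cut_dpull t : 0 <= t <= 1 -> integral (cut U (dpull t)) = 0.
Proof.
move=> t01; rewrite cut_dpullE// integral_sum => [|b _]; last exact: flux_cs.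
apply: big1 => b _.
have [_ [L fL]] : compactly_supported (cut U (flux t b)).
  apply: (compactly_supported_compact cK) => x.
    by apply: cutK_supported => y; exact: flux_far.
  exact: ck_continuous (ck_cut_flux b x t01).
apply: (integral_partial fL) => [x|]; last exact: flux_cs.
exact/diff_derivable/ck_differentiable/ck_cut_flux.
Qed.

(** Joint continuity in [(t, x)] and compactness of [K]; this uniformity replaces differentiation
    under the integral sign. *)
Let dpull_uniform t e : 0 < e -> exists2 d, 0 < d &
  forall s, `|s - t| < d -> forall x, K x -> `|dpull s x - dpull t x| <= e.
Proof.
move=> e0; have e2 : 0 < e / 2 by rewrite divr_gt0.
have /(compact_near_coveringP _).1 cov := cK.
have [|d d0 dP] := (near_normP _ _).1 (cov R (nbhs (t : R^o))
    (fun s x => `|dpull s x - dpull t x| <= e) _ _).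
  move=> x Kx; have /cvgrPdist_lt/(_ _ e2) := joint_dpull_continuous (t := t) (KU Kx).
  move=> [[A B] /= [At Bx] AB]; exists (B, A) => //= -[y s] /= [By As].
  have H1 := AB (s, y) (conj As By).
  have H2 := AB (t, y) (conj (nbhs_singleton At) By).
  by rewrite distrC in H1; exact: dist_le_splitr H1 H2.
by exists d => // s sd; apply: dP; rewrite distrC.
Qed.

(* The t-derivative of the pullback of F by phi + t u is a divergence, so its
   integral does not depend on t. *)
Lemma integral_homotopy :
  integral (cut U (fun x => F (phi x) * \det ('J phi x))) =
  integral (cut U (fun x => F (phi x + u x) * \det ('J phi x + 'J u x))).
Proof.
have -> : (fun x => F (phi x) * \det ('J phi x)) = pull 0.
  by apply/funext => x; rewrite /pull /path /pathJ !scale0r !addr0.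
have -> : (fun x => F (phi x + u x) * \det ('J phi x + 'J u x)) = pull 1.
  by apply/funext => x; rewrite /pull /path /pathJ !scale1r.
apply: (@flat_constant R (fun t => integral (cut U (pull t)))) => t e t01 e0.
have [M [_ MK]] := compact_bounded cK.
pose L := `|M| + 1.
have KL x : ~ (`|x| <= L) -> ~ K x.
  move=> xL Kx; apply: xL; apply: MK Kx.
  by rewrite (le_lt_trans (ler_norm M))// ltrDl.
have L0 : 0 <= L by rewrite addr_ge0.
pose C : R := (2 * L + 1) ^+ m.
have C0 : 0 < C by rewrite exprn_gt0// ltr_wpDl// mulr_ge0.
have [d d0 dP] := dpull_uniform t (divr_gt0 e0 C0).
exists d => // s s01 sd.
(* The last summand has integral zero, so adding it changes nothing; by the mean value theorem in
   [t], [err] becomes [s - t] times a difference of values of [dpull], which is at most [e / C] on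
   [K]. *)
pose err x := cut U (pull s) x + ((-1) * cut U (pull t) x +
  (- (s - t)) * cut U (dpull t) x).
have c1 := cut_pull_cs s01; have c2 := cut_pull_cs t01.
have c3 := cut_dpull_cs t01.
have zc (c : R) (g : 'rV[R]_m -> R) : compactly_supported g ->
    compactly_supported (fun x => c * g x).
  move=> cg; apply: (@compactly_supportedMl _ _ (fun=> c)) => // x.
  exact: cst_continuous.
have c23 := compactly_supportedD (zc (-1) _ c2) (zc (- (s - t)) _ c3).
have -> : integral (cut U (pull s)) - integral (cut U (pull t)) = integral err.
  rewrite integralD// integralD ?integralZ//; try exact: zc.
  by rewrite integral_cut_dpull// mulr0 addr0 mulN1r.
have [errc _] := compactly_supportedD c1 c23.
have -> : e * `|s - t| = e / C * `|s - t| * C.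
  by rewrite mulrAC divfK// gt_eqF.
apply: integral_bound => // [x|x].
  rewrite /err; have [Kx|Kx] := pselect (K x); last first.
    rewrite !cutK_supported//; try by move=> y; (exact: pull_far || exact: dpull_far).
    by rewrite !mulr0 !addr0 normr0 mulr_ge0// divr_ge0 ?ltW.
  have Ux := KU Kx; rewrite !(cut_in _ Ux).
  have [c cst E] := mean_value_between s t (fun c => pull_derive c Ux).
  have -> : pull s x + (-1 * pull t x + - (s - t) * dpull t x) =
      (s - t) * (dpull c x - dpull t x).
    by rewrite addrA mulN1r E mulNr mulrBr.
  rewrite normrM mulrC ler_wpM2r//; apply: dP => //.
  exact: le_lt_trans (between_dist cst) sd.
move=> xL; rewrite /err !cutK_supported ?mulr0 ?addr0//.
all: try by move=> y; (exact: pull_far || exact: dpull_far).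
all: by apply: KL => /le_lt_trans/(_ xL); rewrite ltxx.
Qed.

End Homotopy.

(** * Linear and affine changes of variables *)

Section ChangeOfVariables.
Context {R : realType} {m : nat}.
Implicit Types (A B : 'M[R]_m) (f : 'rV[R]_m -> R) (x v : 'rV[R]_m) (K : R).

Lemma rV_mul_bound A : exists2 C, 0 < C & forall x, `|x *m A| <= C * `|x|.
Proof.
exists (1 + \sum_a \sum_b `|A a b|).
  by rewrite ltr_pwDl// sumr_ge0// => a _; rewrite sumr_ge0.
move=> x; apply: rV_norm_le => [|b].
  by rewrite mulr_ge0// addr_ge0// sumr_ge0// => a _; rewrite sumr_ge0.
rewrite mxE (le_trans (ler_norm_sum _ _ _))// mulrDl mul1r mulr_suml.
rewrite (@le_trans _ _ (\sum_a (\sum_b `|A a b|) * `|x|))//; last first.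
  by rewrite lerDr.
apply: ler_sum => a _; rewrite normrM mulrC; apply: ler_pM => //.
  by rewrite (bigD1 b)//= lerDl sumr_ge0.
exact: rV_coord_norm.
Qed.

Lemma vck_affine n c A v x : vck n (fun y => c + (y - v) *m A) x.
Proof.
move=> b; apply: (@ck_congr _ _ _
  (fun y => c 0 b + \sum_a (y 0 a - v 0 a) * A a b)).
  apply: near_all => y; rewrite !mxE; congr (_ + _).
  by apply: eq_bigr => a _; rewrite !mxE.
apply: ckD; first exact: ck_cst.
apply: ck_sum => a _; apply: ckM; last exact: ck_cst.
by apply: ckB; [exact: ck_coord|exact: ck_cst].
Qed.

Lemma jacobian_affine c A v x : 'J (fun y => c + (y - v) *m A) x = A.
Proof.
apply/row_matrixP => a.
have fd := vck_differentiable (vck_affine 1 c A v x).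
apply: etrans (row_jacobian a fd) _.
rewrite /derive; apply: cvg_lim => //.
rewrite (_ : (fun h : R => _) = fun h : R => (h^-1 * h) *: row a A); last first.
  apply/funext => h /=; rewrite opprD addrACA subrr add0r -mulmxBl opprB addrA.
  by rewrite subrK addrK -scalemxAl scalerA rowE.
apply: cvg_near_cst; apply/(@near_normP R R^o); exists 1 => // h _ h0.
by rewrite mulVf// scale1r.
Qed.

Lemma integral_ext f g : f =1 g -> integral f = integral g.
Proof. by move=> /funext ->. Qed.

Lemma cut_setT f : cut setT f = f.
Proof. by apply/funext => x; rewrite cut_in. Qed.

(** The homotopy from the identity with constant variation [v]. The identity is written in affine
    form so that [jacobian_affine] gives its Jacobian. *)
Lemma integral_translate f v K : (forall y, ck 1 f y) -> supported K f ->
  integral (fun x => f (x + v)) = integral f.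
Proof.
move=> cf fK; have cS : closed [set y : 'rV[R]_m | `|y| <= K].
  by apply: compact_closed; [exact: norm_hausdorff|exact: compact_norm_le].
have := @integral_homotopy R m setT [set y | `|y| <= K + `|v|]
  [set y | `|y| <= K] (fun x => 0 + (x - 0) *m 1%:M) (fun=> v) f openT
  (@compact_norm_le R m _) (@subsetT _ _) cS.
rewrite !cut_setT => H.
rewrite (integral_ext (g := fun x => f (0 + (x - 0) *m 1%:M + v) *
    \det ('J (fun x => 0 + (x - 0) *m 1%:M) x + 'J (fun=> v) x))); last first.
  move=> x; rewrite jacobian_affine.
  have -> : 'J (fun=> v) x = 0.
    apply/matrixP => a b; rewrite jacobian_coord ?derive_cst ?mxE//.
  by rewrite addr0 det1 mulr1 add0r subr0 mulmx1.
rewrite -H.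
- by apply: integral_ext => x; rewrite jacobian_affine det1 mulr1 add0r subr0 mulmx1.
- by move=> x _; exact: vck_affine.
- by move=> x _ b; exact: ck_cst.
- exact: cf.
- by move=> y /negP; rewrite -ltNge => /fK.
move=> t x /andP[t0 t1] _ /=; rewrite add0r subr0 mulmx1 => xK.
have := ler_distD (x + t *: v) x 0; rewrite !subr0 opprD addrA subrr add0r.
rewrite normrN normrZ ger0_norm// => /le_trans; apply.
by rewrite addrC lerD// ler_piMl.
Qed.

(** The homotopy along the segment from [A] to [B]. Properness is the point: as the matrices of the
    segment stay invertible, their inverses are uniformly bounded and the preimages of the support
    stay in one ball. *)
Lemma integral_segment f A B K : (forall y, ck 1 f y) -> supported K f ->
  (forall t, 0 <= t <= 1 -> \det (A + t *: (B - A)) != 0) ->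
  integral (fun x => f (x *m A) * \det A) =
  integral (fun x => f (x *m B) * \det B).
Proof.
move=> cf fK dAB; have cS : closed [set y : 'rV[R]_m | `|y| <= K].
  by apply: compact_closed; [exact: norm_hausdorff|exact: compact_norm_le].
pose P (t : R) := A + t *: (B - A).
(* The sum of the absolute values of the entries of the inverse is continuous in [t], being read off
   from the adjugate and the determinant, so it has a maximum on the unit interval; adding 1 makes
   the bound positive. *)
have [C C0 CP] : exists2 C, 0 < C & forall t x, 0 <= t <= 1 ->
    `|x| <= C * `|x *m P t|.
  have bc i j (t : R) : {for t, continuous (fun t => P t i j)}.
    have -> : (fun t => P t i j) = fun t : R => A i j + t * (B i j - A i j).
      by apply/funext => s; rewrite !mxE.
    apply: continuousD; first exact: cst_continuous.
    by apply: continuousM; [exact: cvg_id|exact: cst_continuous].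
  pose n (t : R) := \sum_a \sum_b `|invmx (P t) a b|.
  have nc t : 0 <= t <= 1 -> {for t, continuous n}.
    move=> t01.
    apply: continuous_sum_at => a; apply: continuous_sum_at => b.
    apply: (@continuous_comp_at R R R (fun s => invmx (P s) a b) Num.norm);
      last exact: (@norm_continuous R R^o).
    have E : \forall s \near t, (\det (P s))^-1 * \adj (P s) a b = invmx (P s) a b.
      have := near_neq0 (continuous_det (fun i j => bc i j t)) (dAB t t01).
      by apply: nearS => s ds; rewrite /invmx unitmxE unitfE ds [RHS]mxE.
    apply: (near_eq_continuous E); apply: continuousM.
      by apply: continuousV; [exact: dAB|exact: continuous_det].
    have -> : (fun s => \adj (P s) a b) =
       fun s => (-1) ^+ (b + a) * \det (row' b (col' a (P s))).
      by apply/funext => s; rewrite mxE.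
    apply: continuousM; first exact: cst_continuous.
    apply: continuous_det => i j.
    have -> : (fun s => row' b (col' a (P s)) i j) =
      (fun s => P s (lift b i) (lift a j)) by apply/funext => s; rewrite 2!mxE.
    exact: bc.
  have [|c _ nmax] := @EVT_max R n 0 1 ler01.
    apply: continuous_in_subspaceT => t /set_mem /=; rewrite in_itv /=.
    exact: nc.
  exists (n c + 1).
    by rewrite ltr_wpDl// sumr_ge0// => a _; rewrite sumr_ge0.
  move=> t x t01; have uP : P t \in unitmx by rewrite unitmxE unitfE dAB.
  rewrite -{1}(mulmxK uP x).
  have nt : n t <= n c + 1 by rewrite (le_trans (nmax t _)) ?lerDl// in_itv.
  have n0 s : 0 <= n s by rewrite sumr_ge0// => a _; rewrite sumr_ge0.
  apply: rV_norm_le => [|b]; first by rewrite mulr_ge0// addr_ge0.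
  rewrite mxE (le_trans (ler_norm_sum _ _ _))//.
  rewrite (@le_trans _ _ (n t * `|x *m P t|))//; last by rewrite ler_wpM2r.
  rewrite /n mulr_suml; apply: ler_sum => a _; rewrite normrM mulrC.
  apply: ler_pM => //; last exact: rV_coord_norm.
  by rewrite (bigD1 b)//= lerDl sumr_ge0.
have := @integral_homotopy R m setT [set y | `|y| <= C * `|K|]
  [set y | `|y| <= K] (fun x => 0 + (x - 0) *m A)
  (fun x => 0 + (x - 0) *m (B - A)) f openT
  (@compact_norm_le R m _) (@subsetT _ _) cS.
rewrite !cut_setT => H.
have E1 : (fun x => f (x *m A) * \det A) = (fun x => f (0 + (x - 0) *m A) *
    \det ('J (fun x => 0 + (x - 0) *m A) x)).
  by apply/funext => x; rewrite jacobian_affine add0r subr0.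
have E2 : (fun x => f (x *m B) * \det B) = (fun x => f (0 + (x - 0) *m A +
      (0 + (x - 0) *m (B - A))) * \det ('J (fun x => 0 + (x - 0) *m A) x +
    'J (fun x => 0 + (x - 0) *m (B - A)) x)).
  apply/funext => x; rewrite !jacobian_affine !add0r !subr0 mulmxBr.
  by rewrite [A + _]addrC [_ + (_ - _)]addrC !subrK.
rewrite E1 E2; apply: H.
- by move=> x _; exact: vck_affine.
- by move=> x _; exact: vck_affine.
- exact: cf.
- by move=> y /negP; rewrite -ltNge => /fK.
move=> t x t01 _ /=; rewrite !add0r !subr0 scalemxAr -mulmxDr => xK.
by rewrite (le_trans (CP t x t01))// ler_pM2l// (le_trans xK)// ler_norm.
Qed.

End ChangeOfVariables.

Section LinearChangeOfVariables.
Context {R : realType}.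

(** The change of variables formula for [A], stated for all test functions so that it passes to
    products of invertible matrices; it then suffices to treat the factors of a decomposition. *)
Definition integral_scaling m (A : 'M[R]_m) := forall f K,
  (forall y, ck 1 f y) -> supported K f ->
  integral (fun x => f (x *m A)) * `|\det A| = integral f.

Lemma ck_comp_mul m n (A : 'M[R]_m) f x : ck n f (x *m A) ->
  ck n (fun y => f (y *m A)) x.
Proof.
move=> cf; have -> : (fun y => f (y *m A)) = fun y => f (0 + (y - 0) *m A).
  by apply/funext => y; rewrite add0r subr0.
by apply: ck_comp; [exact: vck_affine|rewrite add0r subr0].
Qed.

Lemma supported_comp_mul m (A : 'M[R]_m) K f : A \in unitmx ->
  supported K f -> exists L, supported L (fun x => f (x *m A)).
Proof.
move=> uA fK; have [C C0 CP] := rV_mul_bound (invmx A).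
exists (C * K) => x xK; apply: fK.
by rewrite -(ltr_pM2l C0) (lt_le_trans xK)// -{1}(mulmxK uA x).
Qed.

Lemma compactly_supported_ck m n K (f : 'rV[R]_m -> R) :
  (forall x, ck n f x) -> supported K f -> compactly_supported f.
Proof. by move=> cf fK; split; [move=> x; exact: ck_continuous|exists K]. Qed.

Lemma integral_scalingM m (A B : 'M[R]_m) : B \in unitmx ->
  integral_scaling A -> integral_scaling B -> integral_scaling (A *m B).
Proof.
move=> uB gA gB f K cf fK; have [L fL] := supported_comp_mul uB fK.
rewrite det_mulmx normrM mulrA -(gB f K cf fK); congr (_ * _).
rewrite -(gA _ L _ fL) => [|y]; last exact: ck_comp_mul.
by congr (_ * _); apply: integral_ext => x; rewrite mulmxA.
Qed.

Lemma integral_scaling_segment m (A : 'M[R]_m) :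
  (forall t, 0 <= t <= 1 -> 0 < \det (1%:M + t *: (A - 1%:M))) ->
  integral_scaling A.
Proof.
move=> dA f K cf fK.
have dA1 : 0 < \det A.
  by have := dA 1; rewrite scale1r addrC subrK ler01 lexx; exact.
have uA : A \in unitmx by rewrite unitmxE unitfE gt_eqF.
have [L fL] := supported_comp_mul uA fK.
have := @integral_segment R m f 1%:M A K cf fK (fun t t01 => lt0r_neq0 (dA t t01)).
rewrite (integral_ext (g := f)) => [->|x]; last by rewrite mulmx1 det1 mulr1.
rewrite [RHS](integral_ext (g := fun x => \det A * f (x *m A))); last first.
  by move=> x; rewrite mulrC.
rewrite integralZ; last first.
  by apply: compactly_supported_ck fL => x; exact: ck_comp_mul.
by rewrite mulrC gtr0_norm.
Qed.

(** The segment from the identity to [A] stays triangular with positive diagonal, hence has positive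
    determinant. *)
Lemma integral_scaling_trig m (A : 'M[R]_m) : is_trig_mx A ->
  (forall i, 0 < A i i) -> integral_scaling A.
Proof.
move=> /is_trig_mxP tA pA; apply: integral_scaling_segment => t /andP[t0 t1].
rewrite det_trig; last first.
  apply/is_trig_mxP => i j ij; rewrite !mxE tA// (_ : (i == j) = false).
    by rewrite mulr0n subrr mulr0 addr0.
  by apply/negbTE; rewrite -val_eqE neq_ltn ij.
apply: prodr_gt0 => i _; rewrite !mxE eqxx mulr1n.
have [->|t_neq0] := eqVneq t 0; first by rewrite mul0r addr0.
have tp : 0 < t by rewrite lt_neqAle eq_sym t_neq0.
have := mulr_gt0 tp (pA i); lra.
Qed.

Lemma integral_scaling_trig_tr m (A : 'M[R]_m) : is_trig_mx A^T ->
  (forall i, 0 < A i i) -> integral_scaling A.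
Proof.
move=> /is_trig_mxP tA pA; apply: integral_scaling_segment => t /andP[t0 t1].
rewrite -det_tr det_trig; last first.
  apply/is_trig_mxP => i j ij; have := tA i j ij; rewrite !mxE => ->.
  rewrite (_ : (j == i) = false).
    by rewrite mulr0n subrr mulr0 addr0.
  by apply/negbTE; rewrite -val_eqE neq_ltn ij orbT.
apply: prodr_gt0 => i _; rewrite !mxE eqxx mulr1n.
have [->|t_neq0] := eqVneq t 0; first by rewrite mul0r addr0.
have tp : 0 < t by rewrite lt_neqAle eq_sym t_neq0.
have := mulr_gt0 tp (pA i); lra.
Qed.

Lemma integral_scaling_signed_perm m (A : 'M[R]_m) s e :
  (forall x, x *m A = signed_perm s e x) -> `|\det A| = 1 -> integral_scaling A.
Proof.
move=> As dA f K _ _; rewrite dA mulr1 -[RHS](integral_signed_perm s e).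
by apply: integral_ext => x; rewrite As.
Qed.

Lemma integral_scaling_perm m (s : {perm 'I_m}) :
  integral_scaling (perm_mx s : 'M[R]_m).
Proof.
apply: (@integral_scaling_signed_perm _ _ s^-1%g (fun=> false)) => [x|].
  rewrite -[s]fingroup.invgK -col_permE; apply/rowP => j.
  by rewrite !mxE mul1r fingroup.invgK.
by rewrite det_perm normrX normrN1 expr1n.
Qed.

(** LUP decomposition: permutations and sign changes preserve the grids, and triangular factors with
    positive diagonal are joined to the identity by a segment. *)
Lemma integral_scaling_unit m (A : 'M[R]_m) : A \in unitmx ->
  integral_scaling A.
Proof.
case: m A => [|m] A uA.
  move=> f K _ _; rewrite det_mx00 normr1 mulr1.
  by apply: integral_ext => x; congr f; apply/rowP => -[].
have := cormen_lup_correct A; have := cormen_lup_perm A.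
have := cormen_lup_lower A; have := cormen_lup_upper A.
case: (cormen_lup A) => -[P L] U /= up low /is_perm_mxP[s ->] PA.
have {}PA : perm_mx s *m A = L *m U by exact: PA.
have detL : \det L = 1.
  rewrite det_trig; last first.
    apply/is_trig_mxP => i j ij; rewrite low 1?ltnW//.
    by rewrite -val_eqE (ltn_eqF ij).
  by apply: big1 => i _; rewrite low// eqxx.
have uL : L \in unitmx by rewrite unitmxE detL unitr1.
have uU : U \in unitmx.
  have : (L *m U) \in unitmx by rewrite -PA unitmx_mul unitmx_perm.
  by rewrite unitmx_mul => /andP[].
have Ud i : U i i != 0.
  have : \det U != 0 by rewrite -unitfE -unitmxE.
  rewrite -det_tr det_trig => [/prodf_neq0/(_ i isT)|]; first by rewrite mxE.
  by apply/is_trig_mxP => j k jk; rewrite mxE up.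
(* The signs of the pivots are split off: [D] is an involution and [V], the product of [D] and [U],
   has the positive diagonal [|U i i|]. *)
pose D : 'M[R]_m.+1 := diag_mx (\row_i Num.sg (U i i)).
have DD : D *m D = 1%:M.
  rewrite mulmx_diag; apply/matrixP => i j; rewrite !mxE.
  by rewrite -expr2 sqr_sg Ud.
pose V := D *m U.
have VE i j : V i j = Num.sg (U i i) * U i j.
  by rewrite /V mul_diag_mx !mxE.
have -> : A = perm_mx s^-1%g *m (L *m (D *m V)).
  by rewrite /V [D *m (D *m U)]mulmxA DD mul1mx -PA mulmxA -perm_mxM fingroup.mulVg perm_mx1 mul1mx.
have uV : V \in unitmx by rewrite unitmx_mul uU andbT; case/mulmx1_unit: DD.
have uD : D \in unitmx by case/mulmx1_unit: DD.
clearbody V.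
apply: integral_scalingM; first by rewrite !unitmx_mul uL uD uV.
  exact: integral_scaling_perm.
apply: integral_scalingM; first by rewrite unitmx_mul uD uV.
  apply: integral_scaling_trig.
    apply/is_trig_mxP => i j ij; rewrite low 1?ltnW//.
    by rewrite -val_eqE (ltn_eqF ij).
  by move=> i; rewrite low// eqxx.
apply: integral_scalingM; first exact: uV.
  apply: (@integral_scaling_signed_perm _ _ 1%g (fun i => U i i < 0)).
    move=> x; apply/rowP => j; rewrite mul_mx_diag !mxE perm1 mulrC.
    by rewrite sgr_def Ud.
  rewrite det_diag normr_prod big1// => i _; rewrite mxE.
  by rewrite normr_sg Ud.
apply: integral_scaling_trig_tr.
  by apply/is_trig_mxP => i j ij; rewrite mxE VE (up _ _ ij) mulr0.
by move=> i; rewrite VE -normrEsg normr_gt0.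
Qed.

End LinearChangeOfVariables.

(** * Nonlinear changes of variables near a point *)

Section LocalChangeOfVariables.
Context {R : realType} {m : nat}.

Lemma open_norm_ball (x0 : 'rV[R]_m) (d : R) : open [set x | `|x0 - x| < d].
Proof.
rewrite openE => x /= xd; apply/(@near_normP R 'rV[R]_m).
exists (d - `|x0 - x|) => [|y xy /=]; first by rewrite subr_gt0.
have := ler_distD x x0 y; lra.
Qed.

Lemma compact_norm_ball (x0 : 'rV[R]_m) (d : R) :
  compact [set x | `|x0 - x| <= d].
Proof.
apply: bounded_closed_compact.
  exists (`|x0| + d); split; first by rewrite num_real.
  move=> t dt x /= xd; have := ler_distD x0 x 0; rewrite !subr0 distrC; lra.
have -> : [set x : 'rV[R]_m | `|x0 - x| <= d] =
    (fun x => `|x0 - x|) @^-1` [set t | t <= d] by [].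
apply: closed_comp; last exact: closed_le.
move=> x _; apply: (@continuous_comp_at 'rV[R]_m 'rV[R]_m R (fun x => x0 - x)
    Num.norm x).
  by apply: continuousB; [exact: cst_continuous|exact: cvg_id].
exact: norm_continuous.
Qed.

Lemma jacobianD (f g : 'rV[R]_m -> 'rV[R]_m) x : vck 1 f x -> vck 1 g x ->
  'J (fun y => f y + g y) x = 'J f x + 'J g x.
Proof.
move=> cf cg; have df := vck_differentiable cf; have dg := vck_differentiable cg.
have Ef b : (fun y => (f y + g y) 0 b) = (fun y => f y 0 b + g y 0 b).
  by apply/funext => y; rewrite mxE.
have dfg : differentiable (fun y => f y + g y) x.
  by apply: (@vck_differentiable _ _ _ 0) => b; rewrite Ef; exact: ckD.
apply/matrixP => a b; rewrite [RHS]mxE.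
have Df := derivableP (diff_derivable (v := evec R a) (ck_differentiable (cf b))).
have Dg := derivableP (diff_derivable (v := evec R a) (ck_differentiable (cg b))).
have [_ E] := is_deriveD Df Dg.
apply: etrans (jacobian_coord a b dfg) _.
apply: etrans (esym (congr2 (fun p q => p + q) (jacobian_coord a b df)
  (jacobian_coord a b dg))).
exact: etrans (congr1 (fun h => 'D_(evec R a) h x) (Ef b)) E.
Qed.

Lemma integral_affine (f : 'rV[R]_m -> R) K (A : 'M[R]_m) c x0 :
  (forall y, ck 1 f y) -> supported K f -> 0 < \det A ->
  integral (fun x => f (c + (x - x0) *m A) * \det A) = integral f.
Proof.
move=> cf fK dA; have uA : A \in unitmx by rewrite unitmxE unitfE gt_eqF.
pose v := c - x0 *m A.
rewrite -(integral_translate v cf fK).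
have cfv y : ck 1 (fun y => f (y + v)) y.
  apply: (@ck_comp _ _ _ 1 (fun y => y + v) f); last exact: cf.
  move=> b; apply: (@ck_congr _ _ _ (fun y => y 0 b + v 0 b)).
    by apply: near_all => z; rewrite !mxE.
  by apply: ckD; [exact: ck_coord|exact: ck_cst].
have fvK : supported (K + `|v|) (fun y => f (y + v)).
  move=> y yK; apply: fK.
  have := ler_distD (y + v) y 0; rewrite !subr0 opprD addrA subrr add0r normrN.
  lra.
rewrite -(integral_scaling_unit uA cfv fvK) gtr0_norm// mulrC.
rewrite -integralZ; last first.
  have [L fL] := supported_comp_mul uA fvK.
  by apply: compactly_supported_ck fL => x; exact: (ck_comp_mul (cfv _)).
by apply: integral_ext => x; rewrite mulrC /v mulmxBl addrCA.
Qed.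

(** The homotopy joins [tau] to its affine approximation at [x0], for which the formula is known.
    The radii [d] and [r] depend on [tau] only, so one pair serves every [f]. *)
Lemma integral_local_change_of_variables (U : set 'rV[R]_m)
    (tau : 'rV[R]_m -> 'rV[R]_m) x0 :
  open U -> U x0 -> (forall x, U x -> vck 2 tau x) -> 0 < \det ('J tau x0) ->
  exists d r : R, [/\ 0 < d, 0 < r, [set x | `|x0 - x| < d] `<=` U &
    forall f, (forall y, ck 1 f y) -> (forall y, r < `|tau x0 - y| -> f y = 0) ->
    integral (cut [set x | `|x0 - x| < d]
      (fun x => f (tau x) * \det ('J tau x))) = integral f].
Proof.
move=> oU Ux0 ctau; set A := 'J tau x0 => dA.
have uA : A \in unitmx by rewrite unitmxE unitfE gt_eqF.
have [C C0 CP] := rV_mul_bound (invmx A).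
have {}CP (x : 'rV[R]_m) : `|x| <= C * `|x *m A| by have := CP (x *m A); rewrite mulmxK.
have dtau := vck_differentiable (ctau _ Ux0).
(* With [C] a bound for the inverse of [A], an error of at most [|x - x0| / (2 C)] is half of what
   [A] is sure to move [x] away from [tau x0]. *)
have e0 : 0 < (2 * C)^-1 by rewrite invr_gt0 mulr_gt0.
have /(@near_normP R 'rV[R]_m)[d1 d10 dP1] := open_near oU Ux0.
have /(@near_normP R 'rV[R]_m)[d2 d20 dP2] := differentiable_approx dtau e0.
pose d := Num.min d1 d2; have d0 : 0 < d by rewrite lt_min d10.
(* If a point of the homotopy lies within [r] of [tau x0], then [|x - x0| <= d / 4 + |x - x0| / 2],
   hence [|x - x0| <= d / 2]: the preimages of the support stay in a compact ball inside the open
   one. *)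
pose r := d / (4 * C); have r0 : 0 < r by rewrite divr_gt0// mulr_gt0.
pose B := [set x | `|x0 - x| < d].
have BU : B `<=` U by move=> x; rewrite /B /= lt_min => /andP[+ _]; exact: dP1.
exists d, r; split => // f cf fr.
pose phi x := tau x0 + (x - x0) *m A.
pose u x := tau x - phi x.
have usmall x : B x -> `|u x| <= (2 * C)^-1 * `|x - x0|.
  rewrite /B /= lt_min => /andP[_ xd]; have := dP2 (x - x0).
  rewrite sub0r normrN distrC xd => /(_ isT).
  rewrite [x0 + _]addrC subrK; congr (`|_| <= _).
  by rewrite /u /phi opprD addrA /A /jacobian mul_rV_lin1.
have cphi x : vck 2 phi x by exact: vck_affine.
have Jphi x : 'J phi x = A by exact: jacobian_affine.
have phiE x : phi x = tau x0 + (x - x0) *m A by [].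
have uE x : u x = tau x - phi x by [].
have cu x : B x -> vck 2 u x.
  move=> /BU Ux b; apply: (@ck_congr _ _ _ (fun y => tau y 0 b - phi y 0 b)).
    by apply: near_all => y; rewrite [RHS]mxE [X in _ = _ + X]mxE.
  by apply: ckB; [exact: ctau|exact: cphi].
clearbody phi u.
have cS : closed [set y | `|tau x0 - y| <= r].
  by apply: compact_closed; [exact: norm_hausdorff|exact: compact_norm_ball].
have KB : [set x | `|x0 - x| <= d / 2] `<=` B.
  by move=> x; rewrite /B /=; lra.
have H := @integral_homotopy R m B _ _ phi u f (@open_norm_ball x0 d)
  (@compact_norm_ball x0 (d / 2)) KB cS (fun x _ => cphi x) cu cf.
have EL : cut B (fun x => f (phi x) * \det ('J phi x)) =
    (fun x => f (tau x0 + (x - x0) *m A) * \det A).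
  apply/funext => x; have [Bx|Bx] := pselect (B x).
    by rewrite (cut_in _ Bx) Jphi phiE.
  rewrite (cut_out _ Bx) fr ?mul0r// opprD addrA subrr add0r normrN.
  have := CP (x - x0); rewrite distrC => xC.
  have {Bx} : d <= `|x0 - x| by rewrite leNgt; exact/negP.
  move=> /le_trans/(_ xC) dC; rewrite /r ltr_pdivrMr ?mulr_gt0//.
  lra.
have ER : cut B (fun x => f (phi x + u x) * \det ('J phi x + 'J u x)) =
    cut B (fun x => f (tau x) * \det ('J tau x)).
  apply/funext => x; have [Bx|Bx] := pselect (B x); last by rewrite !cut_out.
  rewrite !(cut_in _ Bx) -(jacobianD (vckS (cphi x)) (vckS (cu x Bx))).
  have phiu : (fun y => phi y + u y) = tau.
    by apply/funext => y; rewrite uE addrC subrK.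
  by rewrite phiu -[phi x + u x]/((fun y => phi y + u y) x) phiu.
apply: etrans (congr1 integral (esym ER)) _; apply: etrans (esym (H _ _)) _.
- by move=> y /negP; rewrite -ltNge => /fr.
- move=> t x /andP[t0 t1] Bx /=.
  rewrite phiE -addrA opprD addrA subrr add0r normrN => H1.
  have h1 := CP (x - x0); have h2 := usmall x Bx.
  have h3 : `|(x - x0) *m A| <= r + `|u x|.
    rewrite -[X in `|X|](addrK (t *: u x)) (le_trans (ler_normB _ _))//.
    by rewrite lerD// normrZ ger0_norm// ler_piMl.
  rewrite distrC.
  have h4 : C * (r + (2 * C)^-1 * `|x - x0|) = d / 4 + `|x - x0| / 2.
    by rewrite /r; field; rewrite gt_eqF.
  have h5 : C * `|(x - x0) *m A| <= C * (r + (2 * C)^-1 * `|x - x0|).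
    by rewrite ler_pM2l// (le_trans h3)// lerD2l.
  rewrite h4 in h5; lra.
apply: etrans (congr1 integral EL) _.
apply: (@integral_affine f (`|tau x0| + r)) => // y yr.
  apply: fr; have := ler_distD (tau x0) y 0; rewrite !subr0 distrC; lra.
Qed.

End LocalChangeOfVariables.

(** * Charts and partitions of unity *)

Section SmoothOn.
Context {R : realType} {k : nat}.

Lemma smooth_on_partial (V : normedModType R) (U : set 'rV[R]_k)
    (f : 'rV[R]_k -> V) a : smooth_on U f -> smooth_on U ('D_(evec R a) f).
Proof.
by move=> sf s x Ux; have := sf (rcons s a) x Ux; rewrite /iter_partial foldr_rcons.
Qed.

(** Smoothness is given through iterated partial derivatives, whereas [ck] asks for
    differentiability; [differentiable_partials] bridges the two. *)
Lemma smooth_on_ck (U : set 'rV[R]_k) (f : 'rV[R]_k -> R) n x :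
  open U -> smooth_on U f -> U x -> ck n f x.
Proof.
move=> oU; elim: n f => [|n IH] f sf Ux; first by have [] := sf [::] x Ux.
split; last by move=> a; exact: (IH _ (smooth_on_partial a sf) Ux).
apply: nearS (open_near oU Ux) => y Uy; apply: differentiable_partials => a.
  by apply: nearS (open_near oU Uy) => z Uz; have [_] := sf [::] z Uz; exact.
by have [] := sf [:: a] y Uy.
Qed.

Lemma near_derivable_coord (V : normedModType R) l (f : V -> 'rV[R]_l) x v b :
  derivable f x v -> derivable (fun y => f y 0 b) x v.
Proof. by move=> /derivable_mxP; exact. Qed.

Lemma smooth_on_coord l (U : set 'rV[R]_k) (f : 'rV[R]_k -> 'rV[R]_l) b :
  open U -> smooth_on U f -> smooth_on U (fun x => f x 0 b).
Proof.
move=> oU sf.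
have E s : forall x, U x ->
    iter_partial s (fun x => f x 0 b) x = iter_partial s f x 0 b.
  elim: s => [//|a s IH] x Ux /=.
  rewrite derivable_coord; last by have [_] := sf s x Ux; exact.
  by apply: near_eq_derive; apply: nearS (open_near oU Ux); exact: IH.
move=> s x Ux; have [sc sd] := sf s x Ux.
have Es : \forall y \near x, iter_partial s f y 0 b =
    iter_partial s (fun x => f x 0 b) y.
  by apply: nearS (open_near oU Ux) => y Uy; rewrite E.
split.
  apply: (near_eq_continuous Es).
  apply: (@continuous_comp_at _ _ _ _ (fun z : 'rV[R]_l => z 0 b) _ sc).
  exact: matrix_normedtype.coord_continuous.
move=> a; apply: (@near_eq_derivable _ _ _ (fun y => iter_partial s f y 0 b)).
  exact: Es.
exact: near_derivable_coord (sd a).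
Qed.

Lemma smooth_on_vck l (U : set 'rV[R]_k) (f : 'rV[R]_k -> 'rV[R]_l) n x :
  open U -> smooth_on U f -> U x -> vck n f x.
Proof.
by move=> oU sf Ux b; apply: (smooth_on_ck _ oU) Ux; exact: smooth_on_coord.
Qed.

End SmoothOn.

Section ManifoldCharts.
Context {R : realType} {m : nat} (M : smooth_manifold R m).
Implicit Types (i j l : chart M) (x : 'rV[R]_m) (p q : M).

Lemma image_of_coord i p : dom i p -> image_of i (coord i p).
Proof. by move=> ip; exists p. Qed.

Lemma dom_param i x : image_of i x -> dom i (param i x).
Proof. by case=> p ip <-; rewrite coordK. Qed.

Lemma paramK i x : image_of i x -> coord i (param i x) = x.
Proof. by case=> p ip <-; rewrite coordK. Qed.

Lemma open_image_of i : open (image_of i).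
Proof. exact: coord_open. Qed.

Lemma overlapP i j x :
  overlap i j x <-> image_of i x /\ dom j (param i x).
Proof.
split=> [[p [ip jp] <-]|[ix jx]].
  by split; [exists p|rewrite coordK].
by exists (param i x); [split => //; exact: dom_param|exact: paramK].
Qed.

Lemma overlap_coord i j p : dom i p -> dom j p -> overlap i j (coord i p).
Proof. by exists p. Qed.

Lemma open_preimage_param i (W : set M) x : open W -> image_of i x ->
  W (param i x) -> \forall y \near x, image_of i y /\ W (param i y).
Proof.
move=> oW ix Wx.
have H := near_preim (param_continuous ix) (open_near oW Wx).
by apply: nearS2 _ (open_near (open_image_of (i := i)) ix) H => y.
Qed.

Lemma open_image_sub i (W : set M) : open W ->
  open (coord i @` (dom i `&` W)).
Proof.
move=> oW; rewrite openE => _ [p [ip Wp] <-].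
have ix := image_of_coord ip.
have := open_preimage_param oW ix; rewrite coordK// => /(_ Wp).
move=> H; apply: nearS H => y [iy Wy].
by exists (param i y); [split => //; exact: dom_param|exact: paramK].
Qed.

Lemma open_overlap i j : open (overlap i j).
Proof. exact/open_image_sub/dom_open. Qed.

Lemma near_coord i p (P : set 'rV[R]_m) : dom i p ->
  (\forall y \near coord i p, P y) -> \forall q \near p, dom i q /\ P (coord i q).
Proof.
move=> ip Px; have H := near_preim (coord_continuous ip) Px.
by apply: nearS2 _ (open_near (dom_open i) ip) H => q.
Qed.

Lemma near_param i (W : set M) x : image_of i x ->
  (\forall q \near param i x, W q) -> \forall y \near x, W (param i y).
Proof. by move=> ix; exact: near_preim (param_continuous ix). Qed.

Lemma transition_image i j x : overlap i j x -> image_of j (transition i j x).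
Proof. by move=> /overlapP[_ jx]; exists (param i x). Qed.

Lemma param_transition i j x : overlap i j x ->
  param j (transition i j x) = param i x.
Proof. by move=> /overlapP[_ jx]; rewrite /transition /= coordK. Qed.

Lemma vck_transition n i j x : overlap i j x -> vck n (transition i j) x.
Proof.
by apply: smooth_on_vck; [exact: open_overlap|exact: transition_smooth].
Qed.

Lemma compact_param i (K : set 'rV[R]_m) : compact K -> K `<=` image_of i ->
  compact (param i @` K).
Proof.
move=> cK Ki; apply: continuous_compact => //.
by apply: continuous_in_subspaceT => x /set_mem /Ki; exact: param_continuous.
Qed.

Lemma closed_param i (K : set 'rV[R]_m) : compact K -> K `<=` image_of i ->
  closed (param i @` K).
Proof.
by move=> cK Ki; apply: compact_closed; [exact: mfd_hausdorff|exact: compact_param].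
Qed.

Definition mck n (psi : M -> R) :=
  forall i x, image_of i x -> ck n (fun y => psi (param i y)) x.

Lemma mck_continuous n psi p : mck n psi -> {for p, continuous psi}.
Proof.
move=> cpsi; have [i ip] := dom_cover p.
have E : \forall q \near p, psi (param i (coord i q)) = psi q.
  by apply: nearS (open_near (dom_open i) ip) => q iq; rewrite coordK.
apply: (near_eq_continuous E).
apply: (@continuous_comp_at _ _ _ (coord i) (fun y => psi (param i y))).
  exact: coord_continuous.
exact: ck_continuous (cpsi i _ (image_of_coord ip)).
Qed.

End ManifoldCharts.

Section Bumps.
Context {R : realType}.

(** This function is of class C^n but not smoother, which is enough here and has the same shape
    after differentiation. *)
Definition pos_pow n (t : R) : R := Num.max 0 t ^+ n.+1.

Lemma pos_pow_ge0 n t : 0 <= pos_pow n t.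
Proof. by rewrite exprn_ge0// le_max lexx. Qed.

Lemma pos_pow_gt0 n t : 0 < t -> 0 < pos_pow n t.
Proof. by move=> t0; rewrite exprn_gt0// lt_max t0 orbT. Qed.

Lemma pos_pow_eq0 n t : t <= 0 -> pos_pow n t = 0.
Proof. by move=> t0; rewrite /pos_pow max_l// expr0n. Qed.

Lemma is_derive_pos_pow n (t : R) :
  is_derive t 1 (pos_pow n.+1) (n.+2%:R * pos_pow n t).
Proof.
have [t0|t0|->] := ltgtP t 0.
- rewrite pos_pow_eq0 ?ltW// mulr0.
  apply: (@near_eq_is_derive R R^o R^o (cst 0)).
  apply/(@near_normP R R^o); exists (- t); first by rewrite oppr_gt0.
  move=> s ts; rewrite /= pos_pow_eq0//.
  have := ler_norm (s - t); rewrite distrC; lra.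
- apply: (@near_eq_is_derive R R^o R^o (fun s : R => s ^+ n.+2)).
    apply/(@near_normP R R^o); exists t => // s ts.
    rewrite /pos_pow max_r//; have := ler_norm (t - s); lra.
  split; first exact: exprn_derivable.
  rewrite exp_derive /pos_pow max_r ?ltW//.
  by rewrite -[_ *: 1]/(_ * 1) mulr1.
rewrite pos_pow_eq0// mulr0.
have H : (fun h : R => h^-1 *: ((pos_pow n.+1 \o shift 0) (h *: 1)
    - pos_pow n.+1 0)) @ 0^' --> (0 : R).
  apply/cvgrPdist_le => e e0.
  apply/(@near_normP R R^o); exists (Num.min e 1); first by rewrite lt_min e0 ltr01.
  move=> h; rewrite sub0r normrN lt_min => /andP[he h1] h0.
  rewrite sub0r normrN [h *: 1]mulr1 /= addr0 [pos_pow _ 0]pos_pow_eq0// subr0.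
  rewrite normrZ normfV ler_pdivrMl ?normr_gt0// normrX.
  have mh : `|Num.max 0 h| <= `|h|.
    by rewrite /Num.max; case: ifP => // _; rewrite normr0 normr_ge0.
  rewrite (le_trans (lerXn2r n.+2 _ _ mh)) ?nnegrE// exprS ler_wpM2l//.
  rewrite exprS; apply: le_trans (ltW he).
  by rewrite ler_piMr// exprn_ile1// ltW.
by split; [apply/cvg_ex; exists 0|exact: cvg_lim].
Qed.

Lemma ck_pos_pow k n (g : 'rV[R]_k -> R) x : ck n g x ->
  ck n (fun y => pos_pow n (g y)) x.
Proof.
elim: n => [|n IH] cg.
  have -> : (fun y => pos_pow 0 (g y)) = (fun y => Num.max 0 (g y)).
    by apply/funext => y; rewrite /pos_pow expr1.
  apply: (@continuous_max _ _ (cst 0) g x) => //; exact: cst_continuous.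
have pd (t : R) : differentiable (pos_pow n.+1) t.
  by apply/derivable1_diffP; have [] := is_derive_pos_pow n t.
case: (cg) => gd Dg; split.
  by apply: nearS gd => y gy; exact: differentiable_comp.
move=> a; apply: (ck_congr _ (ckM (ckM (ck_cst n n.+2%:R x) (IH (ckS cg))) (Dg a))).
apply: nearS gd => y gy.
rewrite [RHS](@derive_comp_vec _ _ R^o g (pos_pow n.+1))//.
rewrite -['D_(evec R a) g y in RHS]mulr1.
have := @deriveZv R R^o (pos_pow n.+1) (g y) 1 ('D_(evec R a) g y) (pd _).
rewrite -[_ *: 1]/(_ * 1) => ->.
by have [_ ->] := is_derive_pos_pow n (g y); rewrite mulrC.
Qed.

(** Positive exactly on an open cube, that is, a ball for the maximum norm of row vectors; a product
    over coordinates spares any regularity question about the norm. *)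
Definition box_bump m n (x0 : 'rV[R]_m) (d : R) (y : 'rV[R]_m) : R :=
  \prod_a pos_pow n (d ^+ 2 - (y 0 a - x0 0 a) ^+ 2).

Lemma ck_box_bump m n (x0 : 'rV[R]_m) d x : ck n (box_bump n x0 d) x.
Proof.
apply: ck_prod => a _; apply: ck_pos_pow; apply: ckB; first exact: ck_cst.
have c : ck n (fun y : 'rV[R]_m => y 0 a - x0 0 a) x.
  by apply: ckB; [exact: ck_coord|exact: ck_cst].
by apply: ck_congr (ckM c c); apply: near_all => y; rewrite expr2.
Qed.

Lemma box_bump_ge0 m n (x0 : 'rV[R]_m) d y : 0 <= box_bump n x0 d y.
Proof. by apply: prodr_ge0 => a _; exact: pos_pow_ge0. Qed.

Lemma box_bump_gt0 m n (x0 : 'rV[R]_m) d : 0 < d -> 0 < box_bump n x0 d x0.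
Proof.
move=> d0; apply: prodr_gt0 => a _; apply: pos_pow_gt0.
by rewrite subrr expr0n subr0 exprn_gt0.
Qed.

Lemma box_bump_eq0 m n (x0 : 'rV[R]_m) d y : 0 <= d ->
  d < `|x0 - y| -> box_bump n x0 d y = 0.
Proof.
move=> d0 xd; apply/eqP; apply: contraTT xd => /prodf_neq0 nz; rewrite -leNgt.
apply: rV_norm_le => // a; rewrite leNgt; apply/negP => da.
have := nz a isT; rewrite pos_pow_eq0 ?eqxx// subr_le0 -[leRHS]real_normK ?num_real//.
rewrite lerXn2r ?nnegrE// distrC; apply/ltW.
by have := da; rewrite !mxE.
Qed.

End Bumps.

(* Same as compact_cover, without its assumption that the space is pointed. *)
Lemma compact_finite_cover (T : topologicalType) (O : T -> set T) :
  compact [set: T] -> (forall p, open (O p)) -> (forall p, O p p) ->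
  exists s : seq T, forall q, exists2 p, p \in s & O p q.
Proof.
move=> /(compact_near_coveringP _).1 cov oO OI.
pose F : set_system (seq T) :=
  filter_from setT (fun s : seq T => [set s' : seq T | {subset s <= s'}]).
have FF : Filter F.
  apply: filter_from_filter; first by exists [::].
  move=> s1 s2 _ _; exists (s1 ++ s2) => // s H.
  by split=> p ps; apply: H; rewrite mem_cat ps ?orbT.
have [|s _ sP] := cov _ F (fun (s : seq T) q => exists2 p, p \in s & O p q) FF.
  move=> p _; exists (O p, [set s : seq T | p \in s]) => /=.
    split; first exact: open_near.
    by exists [:: p] => // s H; apply: H; rewrite mem_head.
  by move=> [q s] /= [pq ps]; exists p.
by exists s => q; apply: sP.
Qed.

Section PartitionOfUnity.
Context {R : realType} {m : nat} (M : smooth_manifold R m).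
Implicit Types (i j : chart M) (p q : M) (psi : M -> R) (K : set 'rV[R]_m).

Definition chart_supported i K psi :=
  [/\ compact K, K `<=` image_of i &
    forall q, psi q != 0 -> dom i q /\ K (coord i q)].

(** A box bump in the chart [i], extended by zero to [M]. Regularity at points outside the chart
    domain holds because the image of the compact [K] is closed in the Hausdorff space [M], so the
    function vanishes near them. *)
Lemma bump_exists n i p (W : set M) : dom i p -> nbhs p W -> exists K psi,
  [/\ chart_supported i K psi, mck n psi, forall q, 0 <= psi q, 0 < psi p &
    forall x, K x -> W (param i x)].
Proof.
move=> ip Wp; have ix := image_of_coord ip.
have Wx : \forall y \near coord i p, W (param i y).
  by apply: near_param; rewrite ?coordK.
have /(@near_normP R 'rV[R]_m)[d1 d10 dP1] := Wx.
have /(@near_normP R 'rV[R]_m)[d2 d20 dP2] := open_near (open_image_of (i := i)) ix.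
pose d := Num.min d1 d2 / 2.
have dm0 : 0 < Num.min d1 d2 by rewrite lt_min d10.
have d0 : 0 < d by rewrite divr_gt0.
have dlt y : `|coord i p - y| <= d ->
    `|coord i p - y| < d1 /\ `|coord i p - y| < d2.
  move=> yd; apply/andP; rewrite -lt_min (le_lt_trans yd)//.
  by rewrite /d gtr_pMr// invf_lt1// ltr1n.
pose K := [set y | `|coord i p - y| <= d].
have cK : compact K by exact: compact_norm_ball.
have KI : K `<=` image_of i by move=> y /dlt[_]; exact: dP2.
pose psi q := if `[< dom i q >] then box_bump n (coord i p) d (coord i q) else 0.
have supp : chart_supported i K psi.
  split => // q; rewrite /psi; case: asboolP => [iq|_]; last by rewrite eqxx.
  move=> nz; split => //; rewrite /K /= leNgt; apply: contra nz => /box_bump_eq0.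
  by move=> ->//; exact: ltW.
exists K, psi; split => //.
- move=> j x jx; have [dx|dx] := pselect (dom i (param j x)).
    have ov : overlap j i x by apply/overlapP.
    apply: (@ck_congr _ _ _ (fun y => box_bump n (coord i p) d (transition j i y))).
      apply: nearS (open_near (open_overlap (i := j) (j := i)) ov) => y.
      by move=> /overlapP[_ iy]; rewrite /psi; case: asboolP.
    by apply: ck_comp; [exact: vck_transition|exact: ck_box_bump].
  have nC : (~` (param i @` K)) (param j x).
    by move=> [y /KI /dom_param iy E]; apply: dx; rewrite -E.
  have H := near_param jx (open_near (closed_openC (closed_param cK KI)) nC).
  apply: ck_congr (ck_cst n 0 x); apply: nearS H => y nCy.
  have [_ _ sup] := supp.
  apply/esym/eqP; apply/negPn/negP => /sup[iy Ky]; apply: nCy.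
  by exists (coord i (param j y)) => //; rewrite coordK.
- by move=> q; rewrite /psi; case: asboolP => // _; exact: box_bump_ge0.
- by rewrite /psi; case: asboolP => // _; exact: box_bump_gt0.
- by move=> x /dlt[xd _]; exact: dP1.
Qed.

(** Finitely many bumps divided by their positive sum. The sets [W p] prescribe how small the
    supports must be around each point; they will be neighbourhoods in which an integral over [M]
    can be computed in one chart. *)
Lemma partition_of_unity n (ch : M -> chart M) (W : M -> set M) :
  compact [set: M] -> (forall p, dom (ch p) p) -> (forall p, nbhs p (W p)) ->
  exists (N : nat) (pt : 'I_N -> M) (K : 'I_N -> set 'rV[R]_m)
    (psi : 'I_N -> M -> R),
  [/\ forall s, chart_supported (ch (pt s)) (K s) (psi s),
      forall s, mck n (psi s), forall s q, 0 <= psi s q,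
      forall s x, K s x -> W (pt s) (param (ch (pt s)) x) &
      forall q, \sum_s psi s q = 1].
Proof.
move=> cM chP Wp.
have bump p : exists t : set 'rV[R]_m * (M -> R),
    [/\ chart_supported (ch p) t.1 t.2, mck n t.2, forall q, 0 <= t.2 q,
      0 < t.2 p & forall x, t.1 x -> W p (param (ch p) x)].
  by have [K [psi H]] := bump_exists n (chP p) (Wp p); exists (K, psi).
have [t tP] := boolp.choice bump.
pose O p := [set q | 0 < (t p).2 q].
have oO p : open (O p).
  rewrite openE => q /= q0; have [_ ct _ _ _] := tP p.
  suff : \forall q' \near q, 0 < (t p).2 q' by [].
  apply: (@near_preim M R (t p).2 q (fun z => 0 < z)).
    exact: mck_continuous ct.
  apply/(@near_normP R R^o); exists ((t p).2 q) => // z zq.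
  by have := ler_norm ((t p).2 q - z); lra.
have OI p : O p p by have [_ _ _ p0 _] := tP p.
have [ps cov] := compact_finite_cover cM oO OI.
pose pt := tnth (in_tuple ps).
pose S q := \sum_(s < size ps) (t (pt s)).2 q.
have S0 q : 0 < S q.
  have [p /(tnthP (in_tuple ps))[s ps_] pq] := cov q.
  rewrite /S (bigD1 s)//=; apply: ltr_wpDr.
    by apply: sumr_ge0 => s' _; have [_ _ + _ _] := tP (pt s'); apply.
  by rewrite /pt -ps_.
exists (size ps), pt, (fun s => (t (pt s)).1), (fun s q => (t (pt s)).2 q / S q).
split.
- move=> s; have [[cK KI sup] _ _ _ _] := tP (pt s); split => // q nz.
  by apply: sup; apply: contraNneq nz => ->; rewrite mul0r.
- move=> s j x jx; have [_ ct _ _ _] := tP (pt s).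
  apply: ckM; first exact: ct; apply: ckV; first by rewrite gt_eqF.
  by apply: ck_sum => s' _; have [_ ct' _ _ _] := tP (pt s'); exact: ct'.
- move=> s q; have [_ _ t0 _ _] := tP (pt s).
  by rewrite divr_ge0// ltW.
- by move=> s x; have [_ _ _ _] := tP (pt s); exact.
- by move=> q; rewrite -mulr_suml mulfV ?gt_eqF ?S0.
Qed.

End PartitionOfUnity.

(** * The divergence theorem on a closed oriented manifold *)

Section Densities.
Context {R : realType} {m : nat} (M : smooth_manifold R m).
Implicit Types (i j l : chart M) (p q : M).

(** The transformation law of the coefficient of a top-degree form; with positive transition
    determinants it coincides with that of a density. *)
Definition density (rho : chart M -> 'rV[R]_m -> R) := forall i j x,
  overlap i j x ->
  rho i x = rho j (transition i j x) * \det ('J (transition i j) x).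

(* A vector field times a density, equivalently an (m-1)-form. *)
Definition vector_density (V : chart M -> 'rV[R]_m -> 'rV[R]_m) :=
  forall i j x, overlap i j x ->
  V i x *m 'J (transition i j) x =
  \det ('J (transition i j) x) *: V j (transition i j x).

Definition divergence (V : 'rV[R]_m -> 'rV[R]_m) x : R :=
  \sum_a 'D_(evec R a) (fun y => V y 0 a) x.

Lemma divergence_trace (V : 'rV[R]_m -> 'rV[R]_m) x : vck 1 V x ->
  divergence V x = \tr ('J V x).
Proof.
move=> cV; apply: eq_bigr => a _; apply/esym.
exact: (jacobian_coord a a (vck_differentiable cV)).
Qed.

(** In the chart [i] the components of [V] are determinants with the other expression of [V]
    inserted, so [divergence_insert] removes the second derivatives of the transition map; what
    remains is a trace, which is invariant under conjugation. *)
Lemma divergence_density V : oriented M -> vector_density V ->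
  (forall i x, image_of i x -> vck 1 (V i) x) ->
  density (fun i => divergence (V i)).
Proof.
move=> oM dV cV i j x ov.
set tau := transition i j; pose W y := V j (tau y).
have ctau n := vck_transition n ov.
have cVj := cV j _ (transition_image ov).
have cW : vck 1 W x by move=> b; exact: (ck_comp (ctau 1%N) (cVj b)).
pose w (z X : 'M[R]_m) : R := \det X.
pose D (z : 'rV[R]_m) (X : 'M[R]_m) : R := \det X.
(* Cramer's rule applied to the transformation law of [V], after dividing by the nonzero
   determinant. *)
have Vi y : overlap i j y -> forall a,
    V i y 0 a = D (tau y) (set_row a (W y) ('J tau y)).
  move=> oy a; have dJ := oM i j y oy; rewrite -/tau in dJ.
  apply: (mulIf (lt0r_neq0 dJ)); rewrite /D.
  rewrite -{1}(det_set_row1 (V i y) a) -det_mulmx mul_set_row mul1mx.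
  by rewrite dV// multilinearZ 1?mulrC//; exact: det_multilinear.
transitivity (\sum_a 'D_(evec R a)
    (fun y => D (tau y) (set_row a (W y) ('J tau y))) x).
  apply: eq_bigr => a _; apply: near_eq_derive.
  by apply: nearS (open_near (open_overlap (i := i) (j := j)) ov) => y oy;
    exact: Vi.
rewrite (@divergence_insert _ _ _ D tau W x); first last.
- exact: cW.
- exact: ctau.
- by move=> phi; exact: ck_cst.
- exact: det_alternating.
- by apply: near_all => z; exact: det_multilinear.
have dtau := vck_differentiable (ctau 1%N).
have dW a : 'D_(evec R a) W x = row a ('J tau x *m 'J (V j) (tau x)).
  have dVj := vck_differentiable cVj.
  apply/rowP => b; rewrite derivable_coord; last first.
    exact/diff_derivable/(vck_differentiable cW).
  have E := derive_comp_rV (evec R a) dtau (ck_differentiable (cVj b)).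
  apply: etrans E _; rewrite [RHS]mxE [RHS]mxE; apply: eq_bigr => c _.
  exact: (congr2 (fun p q : R => p * q) (esym (jacobian_coord a c dtau))
    (esym (jacobian_coord c b dVj))).
have dJ := oM i j x ov; rewrite -/tau in dJ.
have uJ : 'J tau x \in unitmx by rewrite unitmxE unitfE gt_eqF.
(* The derivatives of [W] are the rows of the product of the two Jacobians. Inserting ['J tau x] and
   its inverse on the right gives the form needed by [alternating_trace], with a conjugate of
   ['J (V j)]. *)
transitivity (\sum_a \det (set_row a
    (row a (('J tau x *m 'J (V j) (tau x) *m invmx ('J tau x)) *m 'J tau x))
    ('J tau x))).
  apply: eq_bigr => a _; rewrite mulmxKV// -dW.
  by rewrite derive_cst add0r.
rewrite alternating_trace; [|exact: det_multilinear|exact: det_alternating].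
by rewrite mxtrace_mulC (mulKmx uJ) -(divergence_trace cVj).
Qed.

Section Integration.
Hypotheses (cM : compact [set: M]) (oM : oriented M).

Definition local_integral i (psi : M -> R) (rho : 'rV[R]_m -> R) : R :=
  integral (cut (image_of i) (fun x => psi (param i x) * rho x)).

Lemma ck_cut_chart n i K psi (rho : 'rV[R]_m -> R) x :
  chart_supported i K psi -> mck n psi ->
  (forall y, image_of i y -> ck n rho y) ->
  ck n (cut (image_of i) (fun y => psi (param i y) * rho y)) x.
Proof.
move=> [cK KI sup] cpsi crho.
have clK : closed K by apply: compact_closed => //; exact: norm_hausdorff.
apply: (ck_cut (open_image_of (i := i)) clK KI) => y iy.
  move=> Ky; have [->|/sup[_]] := eqVneq (psi (param i y)) 0.
    by rewrite mul0r.
  by rewrite paramK.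
by apply: ckM; [exact: cpsi|exact: crho].
Qed.

Lemma cut_chart_supported i K psi (rho : 'rV[R]_m -> R) x :
  chart_supported i K psi -> ~ K x ->
  cut (image_of i) (fun y => psi (param i y) * rho y) x = 0.
Proof.
move=> [cK KI sup] Kx; have [ix|/cut_out->//] := pselect (image_of i x).
rewrite cut_in//; have [->|/sup[_]] := eqVneq (psi (param i x)) 0.
  by rewrite mul0r.
by rewrite paramK.
Qed.

Lemma cut_chart_cs i K psi (rho : 'rV[R]_m -> R) :
  chart_supported i K psi -> mck 1 psi ->
  (forall y, image_of i y -> ck 1 rho y) ->
  compactly_supported (cut (image_of i) (fun y => psi (param i y) * rho y)).
Proof.
move=> sup cpsi crho; have [cK _ _] := sup.
apply: (compactly_supported_compact cK) => x.
  exact: cut_chart_supported.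
exact: ck_continuous (ck_cut_chart x sup cpsi crho).
Qed.

Lemma local_integral_change_of_chart j K psi p i :
  chart_supported j K psi -> mck 1 psi -> dom i p ->
  exists2 W, nbhs p W & forall rho, density rho ->
    (forall l x, image_of l x -> ck 1 (rho l) x) ->
    (forall l x, image_of l x -> rho l x != 0 -> W (param l x)) ->
    local_integral j psi (rho j) = local_integral i psi (rho i).
Proof.
move=> sup cpsi ip; have [cK KI supP] := sup.
have [jp|jp] := pselect (dom j p); last first.
  have oC : open (~` (param j @` K)).
    exact: closed_openC (closed_param cK KI).
  have pC : (~` (param j @` K)) p.
    by move=> [y /KI /dom_param jy E]; apply: jp; rewrite -E.
  exists (~` (param j @` K)); first exact: open_near.
  move=> rho _ _ rW.
  have zero l x : image_of l x -> psi (param l x) * rho l x = 0.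
    move=> lx; have [->|/supP[jq Kq]] := eqVneq (psi (param l x)) 0.
      by rewrite mul0r.
    have [->|/(rW _ _ lx) nC] := eqVneq (rho l x) 0; first by rewrite mulr0.
    by case: nC; exists (coord j (param l x)) => //; rewrite coordK.
  have cut0 l : cut (image_of l) (fun x => psi (param l x) * rho l x) = fun=> 0.
    apply/funext => x; have [lx|/cut_out->//] := pselect (image_of l x).
    by rewrite cut_in// zero.
  by rewrite /local_integral !cut0.
pose x0 := coord i p; have ov : overlap i j x0 by exact: overlap_coord.
have [d [r [d0 r0 BU cov]]] := integral_local_change_of_variables
  (open_overlap (i := i) (j := j)) ov (fun x ox => vck_transition 2 ox)
  (oM ov).
(* The first condition confines the density to the ball over which the source integral is cut, the
   second to the target ball outside which the test function must vanish. *)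
pose W := [set q | (dom i q /\ `|x0 - coord i q| < d) /\
  (dom j q /\ `|transition i j x0 - coord j q| <= r)].
have tx0 : transition i j x0 = coord j p.
  by rewrite /transition /= coordK.
exists W.
  suff : \forall q \near p, W q by [].
  have H1 : \forall q \near p, dom i q /\ `|x0 - coord i q| < d.
    apply: (near_coord (P := fun x => `|x0 - x| < d) ip).
    by apply/(@near_normP R 'rV[R]_m); exists d.
  have H2 : \forall q \near p, dom j q /\ `|transition i j x0 - coord j q| < r.
    apply: (near_coord (P := fun x => `|transition i j x0 - x| < r) jp).
    by rewrite tx0; apply/(@near_normP R 'rV[R]_m); exists r.
  by apply: nearS2 _ H1 H2 => q ? [? ?]; split => //; split => //; exact: ltW.
move=> rho drho crho rW.
pose f := cut (image_of j) (fun y => psi (param j y) * rho j y).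
rewrite /local_integral -/f -(cov f) => [|y|y ry].
- congr integral; apply/funext => x.
  have [Bx|Bx] := pselect (`|x0 - x| < d); last first.
    rewrite cut_out//; have [ix|/cut_out->//] := pselect (image_of i x).
    rewrite cut_in//; have [->|/(rW _ _ ix)[[_]]] := eqVneq (rho i x) 0.
      by rewrite mulr0.
    by rewrite paramK.
  have ox := BU x Bx; have [ix jx] := (overlapP i j x).1 ox.
  rewrite [LHS]cut_in// [RHS]cut_in// /f cut_in; last exact: transition_image.
  by rewrite param_transition// -mulrA -drho.
- exact: ck_cut_chart sup cpsi (crho j).
rewrite /f; have [jy|/cut_out->//] := pselect (image_of j y).
rewrite cut_in//; have [->|/(rW _ _ jy)[_ [_]]] := eqVneq (rho j y) 0.
  by rewrite mulr0.
by rewrite paramK// leNgt ry.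
Qed.

Lemma divergence_sum n (f : 'I_n -> 'rV[R]_m -> R) (V : 'rV[R]_m -> 'rV[R]_m) x :
  (forall s, ck 1 (f s) x) -> vck 1 V x ->
  (\forall y \near x, \sum_s f s y = 1) ->
  \sum_s divergence (fun y => f s y *: V y) x = divergence V x.
Proof.
move=> cf cV f1; rewrite /divergence exchange_big /=; apply: eq_bigr => a _.
have d s : derivable (fun y => (f s y *: V y) 0 a) x (evec R a).
  apply: diff_derivable; apply: (@ck_differentiable _ _ 0).
  apply: (@ck_congr _ _ _ (fun y => f s y * V y 0 a)).
    by apply: near_all => y; rewrite mxE.
  by apply: ckM; [exact: cf|exact: cV].
have [_ <-] := derive_sum_fun (index_enum 'I_n) d.
apply: near_eq_derive; apply: nearS f1 => y fy1.
rewrite -[RHS]mul1r -fy1 mulr_suml; apply: eq_bigr => s _.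
by rewrite mxE.
Qed.

Lemma integral_cut_divergence i K psi (V : 'rV[R]_m -> 'rV[R]_m) :
  chart_supported i K psi -> mck 2 psi ->
  (forall x, image_of i x -> vck 2 V x) ->
  integral (cut (image_of i) (divergence (fun y => psi (param i y) *: V y))) = 0.
Proof.
move=> sup cpsi cV; have [cK KI supP] := sup.
have clK : closed K by apply: compact_closed => //; exact: norm_hausdorff.
pose f a := cut (image_of i) (fun y => psi (param i y) * V y 0 a).
have cf a x : ck 2 (f a) x.
  by apply: (ck_cut_chart x sup cpsi) => y iy; exact: cV.
have f0 a x : ~ K x -> f a x = 0 by exact: cut_chart_supported.
have cs n (g : 'rV[R]_m -> R) : (forall x, ck n g x) ->
    (forall x, ~ K x -> g x = 0) -> compactly_supported g.
  move=> cg g0; apply: (compactly_supported_compact cK g0) => x.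
  exact: ck_continuous (cg x).
have fcs a : compactly_supported (f a) by exact: (cs 2%N _ (cf a) (f0 a)).
have dfcs a : compactly_supported ('D_(evec R a) (f a)).
  apply: (cs 1%N) => // x; first exact: ck_partial.
  move=> Kx; rewrite (near_eq_derive _ (g := cst 0)) ?derive_cst//.
  by apply: nearS (open_near (closed_openC clK) Kx) => y; exact: f0.
have -> : cut (image_of i) (divergence (fun y => psi (param i y) *: V y)) =
    (fun x => \sum_a 'D_(evec R a) (f a) x).
  apply/funext => x.
  have Df a : 'D_(evec R a) (f a) x = cut (image_of i) ('D_(evec R a)
      (fun y => psi (param i y) * V y 0 a)) x.
    apply: derive_cut (open_image_of (i := i)) clK KI _ => y iy Ky.
    by have := f0 a y Ky; rewrite /f cut_in.
  under eq_bigr do rewrite Df.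
  have [ix|ix] := pselect (image_of i x); last first.
    by rewrite cut_out// big1// => a _; rewrite cut_out.
  rewrite cut_in//; apply: eq_bigr => a _; rewrite cut_in//.
  by apply: near_eq_derive; apply: near_all => y; rewrite mxE.
rewrite integral_sum//; apply: big1 => a _.
have [_ [L fL]] := fcs a.
apply: (integral_partial fL) => // x.
exact/diff_derivable/(ck_differentiable (cf a x)).
Qed.

(** Two partitions of unity are used: [phi] defines an integral [L] over [M], and [psi] cuts [V]
    into pieces so small that [L] of each divergence is computed in one chart, where it is zero. A
    nonnegative continuous function with zero integral then vanishes. The functions [psi] are C^2
    because a derivative of [psi t] times [V] has to be C^1. *)
Theorem divergence_sign V : vector_density V ->
  (forall i x, image_of i x -> vck 2 (V i) x) ->
  (forall i x, image_of i x -> divergence (V i) x <= 0) ->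
  forall i x, image_of i x -> divergence (V i) x = 0.
Proof.
move=> dV cV div0.
have [ch chP] := boolp.choice (fun p : M => dom_cover p).
have [N1 [pt1 [K1 [phi [sup1 cphi phi0 _ phi1]]]]] :=
  partition_of_unity 1 cM chP (fun p => filterT).
(* The integral of a density over [M]. Its linearity and positivity are visible from this formula,
   its independence of the charts only for densities with small support, by [loc]. *)
pose L rho := \sum_s local_integral (ch (pt1 s)) (phi s) (rho (ch (pt1 s))).
(* All summands are transported to the chart [i], where the [phi s] add up to 1. The compact [K']
   provides the compact support that makes the integral additive. *)
have loc p i : dom i p -> exists2 W, nbhs p W & forall K' rho, density rho ->
    (forall l x, image_of l x -> ck 1 (rho l) x) ->
    (forall l x, image_of l x -> rho l x != 0 -> W (param l x)) ->
    compact K' -> K' `<=` image_of i ->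
    (forall x, image_of i x -> ~ K' x -> rho i x = 0) ->
    L rho = integral (cut (image_of i) (rho i)).
  move=> ip.
  have W_ex s : exists W, nbhs p W /\ forall rho, density rho ->
      (forall l x, image_of l x -> ck 1 (rho l) x) ->
      (forall l x, image_of l x -> rho l x != 0 -> W (param l x)) ->
      local_integral (ch (pt1 s)) (phi s) (rho (ch (pt1 s))) =
      local_integral i (phi s) (rho i).
    have [W pW HW] := local_integral_change_of_chart (sup1 s) (cphi s) ip.
    by exists W.
  have [W WP] := boolp.choice W_ex.
  exists [set q | forall s, W s q].
    by apply: near_forall => s; have [] := WP s.
  move=> K' rho drho crho rW cK' K'I rho0.
  have clK' : closed K' by apply: compact_closed => //; exact: norm_hausdorff.
  have cs s : compactly_supported (cut (image_of i)
      (fun x => phi s (param i x) * rho i x)).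
    have far x : image_of i x -> ~ K' x -> phi s (param i x) * rho i x = 0.
      by move=> ix K'x; rewrite rho0// mulr0.
    apply: (compactly_supported_compact cK') => x.
      move=> K'x; have [ix|/cut_out->//] := pselect (image_of i x).
      by rewrite cut_in// far.
    apply: (@ck_continuous _ _ 1).
    apply: (ck_cut (open_image_of (i := i)) clK' K'I far) => y iy.
    by apply: ckM; [exact: cphi|exact: crho].
  rewrite /L; transitivity (\sum_s local_integral i (phi s) (rho i)).
    apply: eq_bigr => s _; have [_] := WP s; apply => // l x lx nz.
    exact: (rW l x lx nz).
  rewrite /local_integral -integral_sum//; congr integral; apply/funext => x.
  have [ix|ix] := pselect (image_of i x); last first.
    by rewrite [RHS]cut_out// big1// => s _; rewrite cut_out.
  rewrite [RHS]cut_in//; under eq_bigr do rewrite cut_in//.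
  by rewrite -mulr_suml phi1 mul1r.
have loc_ex p : exists W, nbhs p W /\ forall K' rho, density rho ->
    (forall l x, image_of l x -> ck 1 (rho l) x) ->
    (forall l x, image_of l x -> rho l x != 0 -> W (param l x)) ->
    compact K' -> K' `<=` image_of (ch p) ->
    (forall x, image_of (ch p) x -> ~ K' x -> rho (ch p) x = 0) ->
    L rho = integral (cut (image_of (ch p)) (rho (ch p))).
  by have [W pW HW] := loc p (ch p) (chP p); exists W.
have [W WP] := boolp.choice loc_ex.
have [N2 [pt [K [psi [sup cpsi _ KW psi1]]]]] :=
  partition_of_unity 2 cM chP (fun p => (WP p).1).
(* Since the [psi t] add up to 1, so do the divergences of these pieces to that of [V]; the
   derivatives of the [psi t] cancel in the sum. *)
pose Vt t i y := psi t (param i y) *: V i y.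
have cVt t i x : image_of i x -> vck 2 (Vt t i) x.
  move=> ix b; apply: (@ck_congr _ _ _ (fun y => psi t (param i y) * V i y 0 b)).
    by apply: near_all => y; rewrite mxE.
  by apply: ckM; [exact: cpsi|exact: cV].
have dVt t : vector_density (Vt t).
  move=> i j x ov; rewrite /Vt -scalemxAl dV// !scalerA mulrC.
  by rewrite param_transition.
pose rho t i := divergence (Vt t i).
have crho t i x : image_of i x -> ck 1 (rho t i) x.
  move=> ix; apply: ck_sum => a _; exact: ck_partial (cVt t i x ix a).
have drho t : density (rho t).
  apply: divergence_density => // i x ix; exact/vckS/cVt.
have rho_far t l x : image_of l x -> rho t l x != 0 ->
    (param (ch (pt t)) @` K t) (param l x).
  move=> lx; apply: contra_neqP => nC; have [cK KI supP] := sup t.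
  have H := near_param lx (open_near (closed_openC (closed_param cK KI)) nC).
  apply: big1 => a _; rewrite (near_eq_derive _ (g := cst 0)) ?derive_cst//.
  apply: nearS H => y nCy; rewrite mxE.
  have [->|/supP[iy Ky]] := eqVneq (psi t (param l y)) 0; first by rewrite mul0r.
  by case: nCy; exists (coord (ch (pt t)) (param l y)) => //; rewrite coordK.
have L0 t : L (rho t) = 0.
  have [cK KI supP] := sup t.
  have [_ H] := WP (pt t); rewrite (H (K t) (rho t) (drho t) (crho t) _ cK KI).
  - exact: integral_cut_divergence (sup t) (cpsi t) (cV _).
  - by move=> l x lx /(rho_far _ _ _ lx)[y Ky <-]; exact: KW.
  - move=> x ix nK; apply/eqP; apply: contra_notT nK => /(rho_far _ _ _ ix).
    by move=> [y Ky E]; have := paramK ix; rewrite -E paramK//; [move=> <-|exact: KI].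
have rho_sum i x : image_of i x -> \sum_t rho t i x = divergence (V i) x.
  move=> ix; apply: divergence_sum.
  - by move=> t; exact: ckS (cpsi t i x ix).
  - by apply: vckS; exact: cV.
  by apply: near_all => y; exact: psi1.
have LV : L (fun i => divergence (V i)) = 0.
  transitivity (\sum_t L (rho t)); last by apply: big1 => t _; exact: L0.
  rewrite /L exchange_big /=; apply: eq_bigr => s _.
  rewrite /local_integral -integral_sum => [|t _]; last first.
    by apply: cut_chart_cs (sup1 s) (cphi s) _ => y; exact: crho.
  congr integral; apply/funext => x.
  have [ix|ix] := pselect (image_of (ch (pt1 s)) x); last first.
    by rewrite cut_out// big1// => t _; rewrite cut_out.
  rewrite cut_in//; under eq_bigr do rewrite cut_in//.
  by rewrite -mulr_sumr rho_sum.
have cdiv i x : image_of i x -> ck 1 (divergence (V i)) x.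
  by move=> ix; apply: ck_sum => a _; exact: ck_partial (cV i x ix a).
(* The sign is reversed to have nonnegative functions. Their integrals add up to zero, so each
   integral vanishes, and then each function by [integral_gt0]. *)
pose g s := cut (image_of (ch (pt1 s)))
  (fun x => phi s (param (ch (pt1 s)) x) * - divergence (V (ch (pt1 s))) x).
have cg s x : ck 1 (g s) x.
  by apply: ck_cut_chart (sup1 s) (cphi s) _ => y iy; exact: ckN (cdiv _ _ iy).
have gcs s : compactly_supported (g s).
  by apply: cut_chart_cs (sup1 s) (cphi s) _ => y iy; exact: ckN (cdiv _ _ iy).
have g0 s x : 0 <= g s x.
  rewrite /g; have [ix|/cut_out->//] := pselect (image_of (ch (pt1 s)) x).
  by rewrite cut_in// mulr_ge0// oppr_ge0 div0.
have Ig : \sum_s integral (g s) = 0.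
  transitivity (- L (fun i => divergence (V i))); last by rewrite LV oppr0.
  rewrite /L -sumrN; apply: eq_bigr => s _.
  have cs : compactly_supported (cut (image_of (ch (pt1 s)))
     (fun x => phi s (param (ch (pt1 s)) x) * divergence (V (ch (pt1 s))) x)).
    by apply: cut_chart_cs (sup1 s) (cphi s) _ => y; exact: cdiv.
  rewrite -mulN1r -integralZ//; congr integral; apply/funext => x.
  rewrite /g; have [ix|ix] := pselect (image_of (ch (pt1 s)) x); last first.
    by rewrite !cut_out// mulr0.
  by rewrite !cut_in// mulN1r mulrN.
have g_eq0 s x : g s x = 0.
  have Is : integral (g s) = 0.
    apply: (psumr_eq0P (P := predT) (F := fun s => integral (g s))) => // s' _.
    exact: integral_ge0.
  apply/eqP; apply: contraT => gx.
  suff : 0 < integral (g s) by rewrite Is ltxx.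
  by apply: (@integral_gt0 _ _ _ x) => //; rewrite lt_neqAle eq_sym gx g0.
(* The vanishing is known only in the charts carrying the [phi s]; it reaches the chart [i] through
   the density law, at a point where some [phi s] is nonzero. *)
move=> i x ix; pose p := param i x.
have [s sp] : exists s, phi s p != 0.
  apply: contrapT => /forallNP H; have := phi1 p.
  rewrite big1 => [/eqP|s _]; first by rewrite eq_sym oner_eq0.
  by apply/eqP; have := H s; case: eqP.
have [_ _ supP] := sup1 s; have [sp' _] := supP p sp.
set j := ch (pt1 s) in sp'.
have ov : overlap i j x by apply/overlapP.
rewrite (divergence_density oM dV _ ov); last first.
  by move=> l y ly; exact/vckS/cV.
have := g_eq0 s (transition i j x).
rewrite /g -/j cut_in; last exact: transition_image.
rewrite param_transition// => /eqP; rewrite mulf_eq0 (negbTE sp) oppr_eq0 /=.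
by move=> /eqP ->; rewrite mul0r.
Qed.

End Integration.
End Densities.

(** * Levi-Civita calculus in coordinates *)

Section MatrixCalculus.
Context {R : realType} {l : nat}.
Implicit Types (x : 'rV[R]_l).

Definition mxck m k n (A : 'rV[R]_l -> 'M[R]_(m, k)) x :=
  forall i j, ck n (fun y => A y i j) x.

Lemma vck_mxck k n (f : 'rV[R]_l -> 'rV[R]_k) x : vck n f x <-> mxck n f x.
Proof. by split=> [cf i b|cf b]; [rewrite (ord1 i)|]; exact: cf. Qed.

Lemma mxck_congr m k n (A B : 'rV[R]_l -> 'M[R]_(m, k)) x :
  (\forall y \near x, A y = B y) -> mxck n A x -> mxck n B x.
Proof.
by move=> AB cA i j; apply: ck_congr (cA i j); apply: nearS AB => y ->.
Qed.

Lemma mxck_cst m k n (A : 'M[R]_(m, k)) x : mxck n (fun=> A) x.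
Proof. by move=> i j; exact: ck_cst. Qed.

Lemma mxckD m k n (A B : 'rV[R]_l -> 'M[R]_(m, k)) x :
  mxck n A x -> mxck n B x -> mxck n (fun y => A y + B y) x.
Proof.
move=> cA cB i j; apply: ck_congr (ckD (cA i j) (cB i j)).
by apply: near_all => y; rewrite mxE.
Qed.

Lemma mxckB m k n (A B : 'rV[R]_l -> 'M[R]_(m, k)) x :
  mxck n A x -> mxck n B x -> mxck n (fun y => A y - B y) x.
Proof.
move=> cA cB i j; apply: ck_congr (ckB (cA i j) (cB i j)).
by apply: near_all => y; rewrite mxE [X in _ = _ + X]mxE.
Qed.

Lemma mxckZ m k n (c : 'rV[R]_l -> R) (A : 'rV[R]_l -> 'M[R]_(m, k)) x :
  ck n c x -> mxck n A x -> mxck n (fun y => c y *: A y) x.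
Proof.
move=> cc cA i j; apply: ck_congr (ckM cc (cA i j)).
by apply: near_all => y; rewrite mxE.
Qed.

Lemma mxckM m p k n (A : 'rV[R]_l -> 'M[R]_(m, p)) (B : 'rV[R]_l -> 'M[R]_(p, k)) x :
  mxck n A x -> mxck n B x -> mxck n (fun y => A y *m B y) x.
Proof.
move=> cA cB i j.
apply: (@ck_congr _ _ _ (fun y => \sum_c A y i c * B y c j)).
  by apply: near_all => y; rewrite mxE.
by apply: ck_sum => c _; apply: ckM; [exact: cA|exact: cB].
Qed.

Lemma mxck_tr m k n (A : 'rV[R]_l -> 'M[R]_(m, k)) x :
  mxck n A x -> mxck n (fun y => (A y)^T) x.
Proof.
by move=> cA i j; apply: ck_congr (cA j i); apply: near_all => y; rewrite mxE.
Qed.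

Lemma mxck_sum m k n (I : Type) (r : seq I) (A : I -> 'rV[R]_l -> 'M[R]_(m, k)) x :
  (forall i, mxck n (A i) x) -> mxck n (fun y => \sum_(i <- r) A i y) x.
Proof.
move=> cA i j; apply: (@ck_congr _ _ _ (fun y => \sum_(c <- r) A c y i j)).
  by apply: near_all => y; rewrite summxE.
by apply: ck_sum => c _; exact: cA.
Qed.

Lemma ck_det m n (A : 'rV[R]_l -> 'M[R]_m) x : mxck n A x ->
  ck n (fun y => \det (A y)) x.
Proof.
move=> cA; apply: ck_sum => s _; apply: ckM; first exact: ck_cst.
by apply: ck_prod => i _; exact: cA.
Qed.

(** Near [x] the inverse is the adjugate divided by the determinant, hence rational in the
    entries. *)
Lemma mxck_inv m n (A : 'rV[R]_l -> 'M[R]_m) x : A x \in unitmx ->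
  mxck n A x -> mxck n (fun y => invmx (A y)) x.
Proof.
rewrite unitmxE unitfE => uA cA; have cd := ck_det cA.
have E : \forall y \near x, (\det (A y))^-1 *: \adj (A y) = invmx (A y).
  apply: nearS (near_neq0 (ck_continuous cd) uA) => y dy.
  by rewrite /invmx unitmxE unitfE dy.
apply: (mxck_congr E); apply: mxckZ; first exact: ckV.
move=> i j; apply: (@ck_congr _ _ _ (fun y => cofactor (A y) j i)).
  by apply: near_all => y; rewrite mxE.
apply: ckM; first exact: ck_cst.
apply: ck_det => a b; apply: ck_congr (cA (lift j a) (lift i b)).
by apply: near_all => y; rewrite 2!mxE.
Qed.

Lemma mxck_jacobian k n (f : 'rV[R]_l -> 'rV[R]_k) x :
  vck n.+1 f x -> mxck n (fun y => 'J f y) x.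
Proof. by move=> cf i j; exact: ck_jacobian. Qed.

Lemma mxckS m k n (A : 'rV[R]_l -> 'M[R]_(m, k)) x : mxck n.+1 A x -> mxck n A x.
Proof. by move=> cA i j; exact: ckS. Qed.

Lemma mxck_derivable m k (A : 'rV[R]_l -> 'M[R]_(m, k)) x v :
  mxck 1 A x -> derivable A x v.
Proof.
move=> cA; apply/derivable_mxP => i j.
exact/diff_derivable/(ck_differentiable (cA i j)).
Qed.

Lemma mxck_derive m k n (A : 'rV[R]_l -> 'M[R]_(m, k)) x v :
  mxck n.+1 A x -> mxck n ('D_v A) x.
Proof.
move=> cA i j; apply: ck_congr (ck_derive v (cA i j)).
have cd : \forall y \near x, forall ij : 'I_m * 'I_k,
    differentiable (fun y => A y ij.1 ij.2) y.
  by apply: near_forall => -[a b]; have [] := cA a b.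
apply: nearS cd => y cd; rewrite derivable_coord//.
by apply/derivable_mxP => a b; apply: diff_derivable; exact: (cd (a, b)).
Qed.

Lemma vck_derive k n (f : 'rV[R]_l -> 'rV[R]_k) x v :
  vck n.+1 f x -> vck n ('D_v f) x.
Proof. by move=> /vck_mxck cf; apply/vck_mxck; exact: mxck_derive. Qed.

End MatrixCalculus.

Section MatrixDerivatives.
Context {R : realType}.

Lemma mxck_comp l k p q n (f : 'rV[R]_l -> 'rV[R]_k)
    (B : 'rV[R]_k -> 'M[R]_(p, q)) x :
  vck n f x -> mxck n B (f x) -> mxck n (fun y => B (f y)) x.
Proof. by move=> cf cB i j; exact: (ck_comp cf (cB i j)). Qed.

Lemma derive_mul_comp l q k m (a : 'rV[R]_l -> 'rV[R]_q)
    (B : 'rV[R]_m -> 'M[R]_(q, k)) (p : 'rV[R]_l -> 'rV[R]_m) x v :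
  vck 1 a x -> mxck 1 B (p x) -> vck 1 p x ->
  'D_v (fun y => a y *m B (p y)) x =
  'D_v a x *m B (p x) + 'D_('D_v p x) (fun z => a x *m B z) (p x).
Proof.
move=> ca cB cp; have dp := vck_differentiable cp.
have cBp : mxck 1 (fun y => B (p y)) x by exact: mxck_comp.
have caB : mxck 1 (fun y => a y *m B (p y)) x.
  by apply: mxckM => //; exact/vck_mxck.
have caxB : mxck 1 (fun z => a x *m B z) (p x).
  by apply: mxckM => //; exact: mxck_cst.
apply/rowP => b.
have dab := mxck_derivable (v := v) caB.
have daB := mxck_derivable (v := 'D_v p x) caxB.
apply: etrans (derivable_coord _ _ dab) _; rewrite [RHS]mxE [X in X + _]mxE.
apply: etrans _ (esym (congr1 (fun t => _ + t) (derivable_coord _ _ daB))).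
have Ea c := derivableP (diff_derivable (v := v) (ck_differentiable (ca c))).
have Eb c := derivableP (diff_derivable (v := v) (ck_differentiable (cBp c b))).
have EB c := derivableP (diff_derivable (v := 'D_v p x)
  (ck_differentiable (cB c b))).
have Eab c := is_deriveM (Ea c) (Eb c).
have EaB c := is_deriveZ (a x 0 c) (EB c).
have [_ S1] := derive_sum_fun (index_enum 'I_q)
  (fun c => @ex_derive _ _ _ _ _ _ _ (Eab c)).
have [_ S2] := derive_sum_fun (index_enum 'I_q)
  (fun c => @ex_derive _ _ _ _ _ _ _ (EaB c)).
have F1 : (fun y => (a y *m B (p y)) 0 b) =
    (fun y => \sum_c ((fun z => a z 0 c) * (fun z => B (p z) c b)) y).
  by apply/funext => y; rewrite mxE.
have F2 : (fun z => (a x *m B z) 0 b) =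
    (fun z => \sum_c (a x 0 c *: (fun z => B z c b)) z).
  by apply/funext => y; rewrite mxE.
apply: etrans (congr1 (fun h => 'D_v h x) F1) _; apply: etrans S1 _.
apply: etrans _ (esym (congr1 (fun h => _ + 'D_('D_v p x) h (p x)) F2)).
apply: etrans _ (esym (congr1 (fun t => _ + t) S2)).
rewrite -big_split /=; apply: eq_bigr => c _.
have [_ ->] := Eab c; have [_ ->] := EaB c.
rewrite [RHS]addrC; apply: congr2.
  exact: congr1 (derive_comp_vec v dp (ck_differentiable (cB c b))).
have dac := diff_derivable (v := v) (vck_differentiable ca).
apply: etrans (mulrC _ _) _.
exact: (congr1 (fun t => t * B (p x) c b) (esym (derivable_coord 0 c dac))).
Qed.

Lemma jacobian_comp l k p (f : 'rV[R]_l -> 'rV[R]_k)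
    (g : 'rV[R]_k -> 'rV[R]_p) x :
  vck 1 f x -> vck 1 g (f x) ->
  'J (fun y => g (f y)) x = 'J f x *m 'J g (f x).
Proof.
move=> cf cg; have df := vck_differentiable cf; have dg := vck_differentiable cg.
have dgf : differentiable (fun y => g (f y)) x.
  by apply: (@vck_differentiable _ _ _ 0) => b; exact: (ck_comp cf (cg b)).
apply/matrixP => a b; rewrite [RHS]mxE.
apply: etrans (jacobian_coord a b dgf) _.
apply: etrans (derive_comp_rV (evec R a) df (ck_differentiable (cg b))) _.
apply: eq_bigr => c _.
exact: (congr2 (fun p q : R => p * q) (esym (jacobian_coord a c df))
  (esym (jacobian_coord c b dg))).
Qed.

Lemma vck_comp l k p n (f : 'rV[R]_l -> 'rV[R]_k) (g : 'rV[R]_k -> 'rV[R]_p) x :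
  vck n f x -> vck n g (f x) -> vck n (fun y => g (f y)) x.
Proof. by move=> cf cg b; exact: (ck_comp cf (cg b)). Qed.

Lemma near_eq_jacobian l k (f g : 'rV[R]_l -> 'rV[R]_k) x : vck 1 f x ->
  (\forall y \near x, f y = g y) -> 'J f x = 'J g x.
Proof.
move=> cf fg; have df := vck_differentiable cf.
have dg := near_eq_differentiable fg df.
apply/matrixP => a b.
apply: etrans (jacobian_coord a b df) _; apply: etrans (esym (jacobian_coord a b dg)).
by apply: near_eq_derive; apply: nearS fg => y ->.
Qed.

Lemma near_eq_vck l k n (f g : 'rV[R]_l -> 'rV[R]_k) x :
  (\forall y \near x, f y = g y) -> vck n f x -> vck n g x.
Proof. by move=> fg cf b; apply: ck_congr (cf b); apply: nearS fg => y ->. Qed.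

Lemma derive_mul_jacobian l k (f : 'rV[R]_l -> 'rV[R]_k) x v :
  vck 1 f x -> v *m 'J f x = 'D_v f x.
Proof. by move=> cf; rewrite -deriveEjacobian//; exact: vck_differentiable cf. Qed.

End MatrixDerivatives.

Section BilinearForms.
Context {R : realType}.

Lemma bilDl k (P : 'M[R]_k) u v w : bil P (u + v) w = bil P u w + bil P v w.
Proof. by rewrite /bil !mulmxDl mxE. Qed.

Lemma bilZl k (P : 'M[R]_k) c v w : bil P (c *: v) w = c * bil P v w.
Proof. by rewrite /bil -!scalemxAl mxE. Qed.

Lemma bilDr k (P : 'M[R]_k) u v w : bil P w (u + v) = bil P w u + bil P w v.
Proof. by rewrite /bil linearD mulmxDr mxE. Qed.

Lemma bilZr k (P : 'M[R]_k) c v w : bil P w (c *: v) = c * bil P w v.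
Proof. by rewrite /bil linearZ -scalemxAr mxE. Qed.

Lemma bilBl k (P : 'M[R]_k) u v w : bil P (u - v) w = bil P u w - bil P v w.
Proof. by rewrite bilDl -scaleN1r bilZl mulN1r. Qed.

Lemma bil_sumr k (P : 'M[R]_k) (I : Type) (s : seq I) (c : I -> R) u w :
  bil P w (\sum_(i <- s) c i *: u i) = \sum_(i <- s) c i * bil P w (u i).
Proof.
elim: s => [|i s IH].
  by rewrite !big_nil -(scale0r 0) bilZr mul0r.
by rewrite !big_cons bilDr bilZr IH.
Qed.

Lemma bil_sum0 k (P : 'M[R]_k) (I : Type) (s : seq I) (u : I -> 'rV[R]_k) w :
  (forall i, bil P w (u i) = 0) -> bil P w (\sum_(i <- s) u i) = 0.
Proof.
move=> u0; rewrite (eq_bigr (fun i => 1 *: u i)) => [|i _]; last by rewrite scale1r.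
by rewrite bil_sumr big1// => i _; rewrite u0 mulr0.
Qed.

Lemma bil_sym k (P : 'M[R]_k) v w : P^T = P -> bil P v w = bil P w v.
Proof.
move=> sP; have -> : bil P v w = (v *m P *m w^T)^T 0 0 by rewrite mxE.
by rewrite !trmx_mul trmxK sP mulmxA.
Qed.

Lemma bil_mul k l (A : 'M[R]_(l, k)) (P : 'M[R]_k) v w :
  bil (A *m P *m A^T) v w = bil P (v *m A) (w *m A).
Proof. by rewrite /bil trmx_mul !mulmxA. Qed.

Lemma bil_evec k (P : 'M[R]_k) v l : bil P v (evec R l) = (v *m P) 0 l.
Proof. by rewrite /bil /evec trmx_delta -colE mxE. Qed.

Lemma bil_inj k (P : 'M[R]_k) u v : P \in unitmx ->
  (forall z, bil P u z = bil P v z) -> u = v.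
Proof.
move=> uP uv; apply: (can_inj (mulmxK uP)); apply/rowP => l.
by have := uv (evec R l); rewrite !bil_evec.
Qed.

Definition positive_definite k (P : 'M[R]_k) := forall v, v != 0 -> 0 < bil P v v.

Lemma positive_definite_unit k (P : 'M[R]_k) : positive_definite P -> P \in unitmx.
Proof.
move=> pP; rewrite -row_free_unit -kermx_eq0; apply/negPn/negP => nz.
have [i ri] : exists i, row i (kermx P) != 0.
  apply/existsP; apply: contraR nz; rewrite negb_exists => /forallP H.
  apply/eqP/row_matrixP => i; rewrite row0; apply/eqP; have := H i.
  by rewrite negbK.
have := pP _ ri; rewrite /bil -row_mul mulmx_ker row0 mul0mx mxE.
by rewrite ltxx.
Qed.

Definition pair_mx k (v w : 'rV[R]_k) : 'M[R]_(2, k) :=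
  \matrix_r (if r == 0 then v else w).

(** A bilinear form as a multilinear function of a two-row matrix, so that the calculus of m-forms
    also differentiates the metric. *)
Definition bil_form k (P : 'M[R]_k) (X : 'M[R]_(2, k)) : R :=
  bil P (row 0 X) (row 1 X).

Lemma bil_form_pair k (P : 'M[R]_k) v w : bil_form P (pair_mx v w) = bil P v w.
Proof. by rewrite /bil_form !rowK. Qed.

Lemma bil_form_set0 k (P : 'M[R]_k) u X :
  bil_form P (set_row 0 u X) = bil P u (row 1 X).
Proof. by rewrite /bil_form !row_set_row. Qed.

Lemma bil_form_set1 k (P : 'M[R]_k) u X :
  bil_form P (set_row 1 u X) = bil P (row 0 X) u.
Proof. by rewrite /bil_form !row_set_row. Qed.

Lemma bil_form_multilinear k (P : 'M[R]_k) : multilinear (bil_form P).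
Proof.
move=> r X b u c v; have [->|->] : r = 0 \/ r = 1.
  by case: r => -[|[|//]] ?; [left|right]; apply/val_inj.
  by rewrite !bil_form_set0 bilDl !bilZl.
by rewrite !bil_form_set1 bilDr !bilZr.
Qed.

End BilinearForms.

Section Christoffel.
Context {R : realType} {k : nat}.
Variable G : 'rV[R]_k -> 'M[R]_k.
Implicit Types (y v w z : 'rV[R]_k).

Lemma ck_bil n y v w : mxck n G y -> ck n (fun z => bil (G z) v w) y.
Proof.
move=> cG; apply: (mxckM (mxckM (mxck_cst n v y) cG) (mxck_cst n w^T y)).
Qed.

Lemma christoffel_sym y v w : (\forall z \near y, (G z)^T = G z) ->
  christoffel G y v w = christoffel G y w v.
Proof.
move=> sG; apply: (congr1 (mulmx^~ (invmx (G y)))); apply/rowP => l.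
rewrite [LHS]mxE [RHS]mxE.
have -> : 'D_(evec R l) (fun z => bil (G z) v w) y =
    'D_(evec R l) (fun z => bil (G z) w v) y.
  by apply: near_eq_derive; apply: nearS sG => z; exact: bil_sym.
by rewrite [X in _ * (X - _)]addrC.
Qed.

(** Koszul's formula for arbitrary constant [z]: both sides are linear in [z], and on basis vectors
    it is the definition of [christoffel]. *)
Lemma koszul y v w z : G y \in unitmx -> mxck 1 G y ->
  bil (G y) (christoffel G y v w) z =
  2^-1 * ('D_v (fun t => bil (G t) w z) y + 'D_w (fun t => bil (G t) v z) y
          - 'D_z (fun t => bil (G t) v w) y).
Proof.
move=> uG cG; rewrite /bil /christoffel mulmxKV// mxE.
have Dlin u a : 'D_u (fun t => bil (G t) a z) y =
    \sum_l z 0 l * 'D_u (fun t => bil (G t) a (evec R l)) y.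
  have d l : is_derive y u (fun t => z 0 l * bil (G t) a (evec R l))
      (z 0 l * 'D_u (fun t => bil (G t) a (evec R l)) y).
    have D := derivableP (diff_derivable (v := u)
      (ck_differentiable (ck_bil a (evec R l) cG))).
    exact: (is_deriveZ (z 0 l) D).
  have [_ S] := derive_sum_fun (index_enum 'I_k)
    (fun l => @ex_derive _ _ _ _ _ _ _ (d l)).
  have F : (fun t => bil (G t) a z) =
      (fun t => \sum_l z 0 l * bil (G t) a (evec R l)).
    apply/funext => t; rewrite -bil_sumr; congr bil.
    exact: row_sum_delta.
  apply: etrans (congr1 (fun h => 'D_u h y) F) _; apply: etrans S _.
  by apply: eq_bigr => l _; have [_] := d l.
rewrite (Dlin v w) (Dlin w v).
rewrite (derive_linear_rV z (ck_differentiable (ck_bil v w cG))).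
rewrite -big_split /= -sumrB mulr_sumr; apply: eq_bigr => l _.
by rewrite mxE [z^T l 0]mxE -mulrDr -mulrBr [RHS]mulrCA [RHS]mulrC.
Qed.

Lemma christoffel_linear y c u v w : G y \in unitmx -> mxck 1 G y ->
  christoffel G y (c *: u + v) w = c *: christoffel G y u w + christoffel G y v w.
Proof.
move=> uG cG; apply: (bil_inj uG) => z.
rewrite (bilDl (G y)) (bilZl (G y)).
rewrite (koszul (c *: u + v) w z uG cG) (koszul u w z uG cG) (koszul v w z uG cG).
have Dv a b : 'D_(c *: u + v) (fun t => bil (G t) a b) y =
    c * 'D_u (fun t => bil (G t) a b) y + 'D_v (fun t => bil (G t) a b) y.
  have d := ck_differentiable (ck_bil a b cG).
  by rewrite !deriveE// linearD linearZ.
have Db a b : 'D_a (fun t => bil (G t) (c *: u + v) b) y =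
    c * 'D_a (fun t => bil (G t) u b) y + 'D_a (fun t => bil (G t) v b) y.
  have d1 := derivableP (diff_derivable (v := a) (ck_differentiable (ck_bil u b cG))).
  have d2 := derivableP (diff_derivable (v := a) (ck_differentiable (ck_bil v b cG))).
  have [_ <-] := is_deriveD (is_deriveZ c d1) d2.
  apply: (congr1 (fun h => 'D_a h y)); apply/funext => t.
  by rewrite bilDl bilZl.
rewrite Dv (Db w) (Db z).
by move: ('D_w _ y) ('D_w _ y) ('D_z _ y) ('D_z _ y) ('D_u _ y) ('D_v _ y) => *; ring.
Qed.

(** Vanishing of the covariant derivative at one point, stated for a bare family of functions so
    that it covers both the calibration and the metric. *)
Definition parallel_at m (w : 'rV[R]_k -> 'M[R]_(m, k) -> R) y := forall v X,
  'D_v (w ^~ X) y =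
  \sum_r w y (set_row r (christoffel G y v (row r X)) X).

(** Compatibility of the connection with the metric: in the sum of two Koszul formulas the
    derivatives along the rows of [X] cancel. *)
Lemma metric_parallel y : (\forall z \near y, (G z)^T = G z) ->
  G y \in unitmx -> mxck 1 G y -> parallel_at (fun z => bil_form (G z)) y.
Proof.
move=> sG uG cG v X; rewrite big_ord_recl big_ord1.
have -> : lift ord0 ord0 = 1 :> 'I_2 by apply/val_inj.
apply: etrans _ (esym (congr2 (fun p q : R => p + q)
  (bil_form_set0 _ _ _) (bil_form_set1 _ _ _))).
rewrite (koszul _ _ _ uG cG).
rewrite (bil_sym _ _ (nbhs_singleton sG)) (koszul _ _ _ uG cG) /bil_form.
have S a b : 'D_v (fun t => bil (G t) a b) y = 'D_v (fun t => bil (G t) b a) y.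
  by apply: near_eq_derive; apply: nearS sG => z; exact: bil_sym.
have S' u a b : 'D_u (fun t => bil (G t) a b) y = 'D_u (fun t => bil (G t) b a) y.
  by apply: near_eq_derive; apply: nearS sG => z; exact: bil_sym.
rewrite (S' v (row 1 X) (row 0 X)).
set A := 'D_v _ y; set B := 'D_(row 0 X) _ y; set C := 'D_(row 1 X) _ y.
by field.
Qed.

End Christoffel.

Section CovariantCalculus.
Context {R : realType}.

Lemma derive_bil l k (P : 'rV[R]_k -> 'M[R]_k) (p a b : 'rV[R]_l -> 'rV[R]_k) x v :
  mxck 1 P (p x) -> vck 1 p x -> vck 1 a x -> vck 1 b x ->
  'D_v (fun y => bil (P (p y)) (a y) (b y)) x =
  'D_('D_v p x) (fun z => bil (P z) (a x) (b x)) (p x) +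
  (bil (P (p x)) ('D_v a x) (b x) + bil (P (p x)) (a x) ('D_v b x)).
Proof.
move=> cP cp ca cb.
pose X y := pair_mx (a y) (b y).
have X0 y : row 0 (X y) = a y by rewrite rowK.
have X1 y : row 1 (X y) = b y by rewrite rowK.
have mP : \forall z \near p x, multilinear (bil_form (P z)).
  by apply: near_all => z; exact: bil_form_multilinear.
have cd phi : differentiable (fun z => bil_form (P z) (basis_mx phi)) (p x).
  exact: ck_differentiable (ck_bil _ _ cP).
have Xd r j : derivable (fun y => X y r j) x v.
  have [->|->] : r = 0 \/ r = 1.
    by case: r => -[|[|//]] ?; [left|right]; apply/val_inj.
    have -> : (fun y => X y 0 j) = (fun y => a y 0 j).
      by apply/funext => y; rewrite -X0 [RHS]mxE.
    exact: diff_derivable (ck_differentiable (ca j)).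
  have -> : (fun y => X y 1 j) = (fun y => b y 0 j).
    by apply/funext => y; rewrite -X1 [RHS]mxE.
  exact: diff_derivable (ck_differentiable (cb j)).
have := derive_form mP cd (vck_differentiable cp) Xd.
rewrite big_ord_recl big_ord1.
have -> : lift ord0 ord0 = 1 :> 'I_2 by apply/val_inj.
have -> : (fun y => row ord0 (X y)) = a by apply/funext.
have -> : (fun y => row 1 (X y)) = b by apply/funext.
rewrite bil_form_set0 bil_form_set1 X0 X1.
have -> : (fun y => bil_form (P (p y)) (X y)) = (fun y => bil (P (p y)) (a y) (b y)).
  by apply/funext => y; rewrite /bil_form X0 X1.
have -> : (fun z => bil_form (P z) (X x)) = (fun z => bil (P z) (a x) (b x)).
  by apply/funext => y; rewrite /bil_form X0 X1.
exact.
Qed.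

(** For a parallel form the derivative at the base point consists of Christoffel terms; added to the
    derivatives of the rows they give the covariant derivatives of the rows. *)
Lemma derive_parallel l m k (G : 'rV[R]_k -> 'M[R]_k)
    (w : 'rV[R]_k -> 'M[R]_(m, k) -> R) (f : 'rV[R]_l -> 'rV[R]_k)
    (X : 'rV[R]_l -> 'M[R]_(m, k)) x v :
  (\forall z \near f x, multilinear (w z)) ->
  (forall phi, ck 1 (w ^~ (basis_mx phi)) (f x)) -> parallel_at G w (f x) ->
  vck 1 f x -> mxck 1 X x ->
  'D_v (fun y => w (f y) (X y)) x =
  \sum_r w (f x) (set_row r (cov_along G f (fun y => row r (X y)) x v) (X x)).
Proof.
move=> mw cw pw cf cX.
have cd phi := ck_differentiable (cw phi).
have Xd r b : derivable (fun y => X y r b) x v.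
  exact: diff_derivable (ck_differentiable (cX r b)).
apply: etrans (derive_form mw cd (vck_differentiable cf) Xd) _.
rewrite (pw _ (X x)) -big_split /=; apply: eq_bigr => r _.
rewrite /cov_along (multilinearD _ _ _ _ (nbhs_singleton mw)) addrC.
by rewrite (derive_mul_jacobian v cf).
Qed.

Lemma derive_metric l k (G : 'rV[R]_k -> 'M[R]_k) (f a b : 'rV[R]_l -> 'rV[R]_k) x v :
  (\forall z \near f x, (G z)^T = G z) -> G (f x) \in unitmx ->
  mxck 1 G (f x) -> vck 1 f x -> vck 1 a x -> vck 1 b x ->
  'D_v (fun y => bil (G (f y)) (a y) (b y)) x =
  bil (G (f x)) (cov_along G f a x v) (b x) +
  bil (G (f x)) (a x) (cov_along G f b x v).
Proof.
move=> sG uG cG cf ca cb; rewrite derive_bil//.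
have := metric_parallel sG uG cG ('D_v f x) (pair_mx (a x) (b x)).
rewrite big_ord_recl big_ord1.
have -> : lift ord0 ord0 = 1 :> 'I_2 by apply/val_inj.
rewrite (bil_form_set0 (G (f x))) (bil_form_set1 (G (f x))) !rowK /=.
have -> : (fun z => bil_form (G z) (pair_mx (a x) (b x))) =
    (fun z => bil (G z) (a x) (b x)).
  by apply/funext => z; rewrite bil_form_pair.
move=> ->; rewrite /cov_along bilDl bilDr (derive_mul_jacobian v cf).
by rewrite [RHS]addrACA [RHS]addrC.
Qed.

Lemma derive_mul_jacobianC l k (f : 'rV[R]_l -> 'rV[R]_k) x v w : vck 2 f x ->
  'D_v (fun y => w *m 'J f y) x = 'D_w (fun y => v *m 'J f y) x.
Proof.
move=> cf.
have cfu (u : 'rV[R]_l) : mxck 1 (fun y => u *m 'J f y) x.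
  by apply: mxckM; [exact: mxck_cst|exact: mxck_jacobian].
have E (u u' : 'rV[R]_l) j : 'D_u (fun y => u' *m 'J f y) x 0 j =
    'D_u ('D_u' (fun y => f y 0 j)) x.
  have H := derivable_coord 0 j (mxck_derivable (v := u) (cfu u')).
  apply: etrans H _.
  apply: near_eq_derive; apply: nearS (vck_near_differentiable cf) => y fd.
  rewrite -deriveEjacobian//; apply: derivable_coord; exact: diff_derivable.
by apply/rowP => j; rewrite !E; exact: derive_swap (cf j).
Qed.

(** The inhomogeneous transformation law of the Christoffel symbols. By nondegeneracy it can be
    tested against vectors, where Koszul's formula in both charts and the symmetry of the second
    derivatives of [tau] reduce it to algebra. *)
Lemma christoffel_change k (G1 G2 : 'rV[R]_k -> 'M[R]_k)
    (tau : 'rV[R]_k -> 'rV[R]_k) y v w :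
  (\forall z \near y, G1 z = 'J tau z *m G2 (tau z) *m ('J tau z)^T) ->
  (\forall z \near tau y, (G2 z)^T = G2 z) ->
  G1 y \in unitmx -> G2 (tau y) \in unitmx -> 'J tau y \in unitmx ->
  mxck 1 G1 y -> mxck 1 G2 (tau y) -> vck 2 tau y ->
  christoffel G1 y v w *m 'J tau y =
  christoffel G2 (tau y) (v *m 'J tau y) (w *m 'J tau y) +
  'D_v (fun z => w *m 'J tau z) y.
Proof.
move=> G12 sG2 u1 u2 uJ c1 c2 ctau.
have ctau1 : vck 1 tau y by exact: vckS.
pose D (a b : 'rV[R]_k) := 'D_a (fun z => b *m 'J tau z) y.
have DC a b : D a b = D b a by exact: derive_mul_jacobianC.
have cJ (a : 'rV[R]_k) : vck 1 (fun z => a *m 'J tau z) y.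
  by apply/vck_mxck; apply: mxckM; [exact: mxck_cst|exact: mxck_jacobian].
have dG a b c : 'D_a (fun t => bil (G1 t) b c) y =
    'D_(a *m 'J tau y) (fun z => bil (G2 z) (b *m 'J tau y) (c *m 'J tau y)) (tau y) +
    (bil (G2 (tau y)) (D a b) (c *m 'J tau y) +
     bil (G2 (tau y)) (b *m 'J tau y) (D a c)).
  rewrite (derive_mul_jacobian a ctau1).
  apply: etrans _ (derive_bil a c2 ctau1 (cJ b) (cJ c)).
  by apply: near_eq_derive; apply: nearS G12 => t ->; rewrite bil_mul.
have SG := nbhs_singleton sG2.
apply: (bil_inj u2) => z'.
(* The Jacobian is invertible, so every test vector in the target chart comes from the source
   chart. *)
have [z ->] : exists z, z' = z *m 'J tau y.
  by exists (z' *m invmx ('J tau y)); rewrite mulmxKV.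
rewrite -bil_mul -(nbhs_singleton G12) koszul// bilDl koszul// !dG -/(D v w).
rewrite (DC w v) (DC z v) (DC z w).
rewrite (bil_sym (D v z) (w *m _) SG).
move: (bil _ (D v w) _) (bil _ (w *m _) (D v z)) (bil _ (v *m _) (D w z)).
move: ('D_(v *m _) _ _) ('D_(w *m _) _ _) ('D_(z *m _) _ _) => a b c d e h.
by field.
Qed.

End CovariantCalculus.

(** * Mean curvature of an immersion *)

Section Submanifolds.
Context {R : realType} {m k : nat}.
Implicit Types (G : 'rV[R]_k -> 'M[R]_k) (f : 'rV[R]_m -> 'rV[R]_k).

Definition metric_germ G (y : 'rV[R]_k) := \forall z \near y,
  [/\ (G z)^T = G z, positive_definite (G z) & forall n, mxck n G z].

Definition immersion_germ f (x : 'rV[R]_m) := \forall y \near x,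
  (forall n, vck n f y) /\ row_free ('J f y).

Lemma metric_germ_sym G y : metric_germ G y -> \forall z \near y, (G z)^T = G z.
Proof. by apply: nearS => z []. Qed.

Lemma metric_germ_unit G y : metric_germ G y -> G y \in unitmx.
Proof. by move=> /nbhs_singleton[_ pG _]; exact: positive_definite_unit. Qed.

Lemma metric_germ_mxck n G y : metric_germ G y -> mxck n G y.
Proof. by move=> /nbhs_singleton[]. Qed.

Lemma immersion_germ_vck n f x : immersion_germ f x -> vck n f x.
Proof. by move=> /nbhs_singleton[]. Qed.

Lemma near_metric_germ G f x : metric_germ G (f x) -> immersion_germ f x ->
  \forall y \near x, metric_germ G (f y).
Proof.
move=> mG imf.
exact: near_preim (vck_continuous (immersion_germ_vck 0 imf)) (near_near mG).
Qed.

(** Each component of [christoffel] is bilinear in its vector arguments; this lets [ck_form] give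
    its regularity when the arguments vary as well. *)
Lemma multilinear_christoffel G y l : metric_germ G y ->
  multilinear (fun X : 'M[R]_(2, k) => christoffel G y (row 0 X) (row 1 X) 0 l).
Proof.
move=> mG; have sG := metric_germ_sym mG; have uG := metric_germ_unit mG.
have cG := metric_germ_mxck 1 mG.
have L0 (u : 'rV[R]_k) : christoffel G y 0 u = 0.
  have := christoffel_linear (-1) 0 0 u uG cG.
  by rewrite scaleN1r oppr0 addr0 scaleN1r addNr.
have L (p q : R) (u v z : 'rV[R]_k) : christoffel G y (p *: u + q *: v) z =
    p *: christoffel G y u z + q *: christoffel G y v z.
  apply: etrans (christoffel_linear _ _ _ _ uG cG) _; apply: congr1.
  have := christoffel_linear q v 0 z uG cG.
  by rewrite addr0 L0 addr0.
have C (u v : 'rV[R]_k) : christoffel G y u v = christoffel G y v u.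
  exact: christoffel_sym.
move=> r X b u c v; have [->|->] : r = 0 \/ r = 1.
  by case: r => -[|[|//]] ?; [left|right]; apply/val_inj.
  rewrite !row_set_row /=.
  apply: etrans (congr1 (fun t : 'rV[R]_k => t 0 l) (L b c u v (row 1 X))) _.
  by rewrite [LHS]mxE [X in X + _]mxE [X in _ + X]mxE.
rewrite !row_set_row /= (C _ u) (C _ v).
apply: etrans (congr1 (fun t : 'rV[R]_k => t 0 l) (C _ _)) _.
apply: etrans (congr1 (fun t : 'rV[R]_k => t 0 l) (L b c u v (row 0 X))) _.
by rewrite [LHS]mxE [X in X + _]mxE [X in _ + X]mxE.
Qed.

Lemma vck_christoffel l n G (p a b : 'rV[R]_l -> 'rV[R]_k) x :
  metric_germ G (p x) -> vck n p x -> vck n a x -> vck n b x ->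
  vck n (fun y => christoffel G (p y) (a y) (b y)) x.
Proof.
move=> mG cp ca cb c.
pose Gam (z : 'rV[R]_k) (X : 'M[R]_(2, k)) : R :=
  christoffel G z (row 0 X) (row 1 X) 0 c.
apply: (@ck_congr _ _ _ (fun y => Gam (p y) (pair_mx (a y) (b y)))).
  by apply: near_all => y; rewrite /Gam !rowK.
apply: (@ck_form _ _ _ Gam).
- by apply: nearS (near_near mG) => z; exact: multilinear_christoffel.
- move=> phi; rewrite /Gam /christoffel.
  set v := row 0 _; set w := row 1 _.
  have cb' u u' : forall n, ck n (fun y => bil (G y) u u') (p x).
    by move=> q; apply: ck_bil; exact: metric_germ_mxck.
  have -> : (fun z => christoffel G z v w 0 c) = (fun z => ((\row_l0 (2^-1 *
    ('D_v (fun y => bil (G y) w (evec R l0)) z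
     + 'D_w (fun y => bil (G y) v (evec R l0)) z
     - 'D_(evec R l0) (fun y => bil (G y) v w) z))) *m invmx (G z)) 0 c) by [].
  apply: mxckM; last first.
    by apply: mxck_inv; [exact: metric_germ_unit|exact: metric_germ_mxck].
  move=> i j; apply: (@ck_congr _ _ _ (fun z => 2^-1 *
    ('D_v (fun y => bil (G y) w (evec R j)) z
     + 'D_w (fun y => bil (G y) v (evec R j)) z
     - 'D_(evec R j) (fun y => bil (G y) v w) z))).
    by apply: near_all => z; rewrite [RHS]mxE.
  apply: ckM; first exact: ck_cst.
  by apply: ckB; [apply: ckD|]; apply: ck_derive.
- exact: cp.
- move=> r j; have [->|->] : r = 0 \/ r = 1.
    by case: r => -[|[|//]] ?; [left|right]; apply/val_inj.
    by apply: ck_congr (ca j); apply: near_all => y; rewrite [RHS]mxE.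
  by apply: ck_congr (cb j); apply: near_all => y; rewrite [RHS]mxE.
Qed.

Section AtPoint.
Variables (G : 'rV[R]_k -> 'M[R]_k) (f : 'rV[R]_m -> 'rV[R]_k) (x : 'rV[R]_m).
Hypotheses (mG : metric_germ G (f x)) (imf : immersion_germ f x).

Lemma induced_gram_sym : (induced_gram G f x)^T = induced_gram G f x.
Proof.
by rewrite /induced_gram !trmx_mul trmxK (nbhs_singleton (metric_germ_sym mG)) mulmxA.
Qed.

Lemma induced_gram_pos : positive_definite (induced_gram G f x).
Proof.
move=> v v0; rewrite /induced_gram bil_mul; have [_ + _] := nbhs_singleton mG.
apply; have [_ fr] := nbhs_singleton imf; by rewrite mulmx_free_eq0.
Qed.

Lemma induced_gram_unit : induced_gram G f x \in unitmx.
Proof. exact: positive_definite_unit induced_gram_pos. Qed.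

Lemma normal_partD u v : normal_part G f x (u + v) =
  normal_part G f x u + normal_part G f x v.
Proof. by rewrite /normal_part !mulmxDl opprD addrACA. Qed.

Lemma normal_partZ c u : normal_part G f x (c *: u) = c *: normal_part G f x u.
Proof. by rewrite /normal_part -!scalemxAl scalerBr. Qed.

Lemma normal_part_tangent w : normal_part G f x (w *m 'J f x) = 0.
Proof.
rewrite /normal_part; set J := 'J f x.
have -> : w *m J *m G (f x) *m J^T = w *m induced_gram G f x by rewrite !mulmxA.
by rewrite mulmxK ?subrr// induced_gram_unit.
Qed.

Lemma normal_part_orthogonal u w : bil (G (f x)) (normal_part G f x u) (w *m 'J f x) = 0.
Proof.
rewrite bilBl /normal_part /bil; set J := 'J f x.
have -> : u *m G (f x) *m J^T *m invmx (induced_gram G f x) *m J *m G (f x) *m (w *m J)^T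
   = u *m G (f x) *m J^T *m invmx (induced_gram G f x) *m induced_gram G f x *m w^T.
  by rewrite trmx_mul !mulmxA.
by rewrite mulmxKV ?induced_gram_unit// trmx_mul !mulmxA subrr.
Qed.

Lemma mean_curvature_orthogonal w :
  bil (G (f x)) (mean_curvature G f x) (w *m 'J f x) = 0.
Proof.
have sG := nbhs_singleton (metric_germ_sym mG).
rewrite bilZl bil_sym//.
rewrite bil_sum0 ?mulr0// => a; apply: bil_sum0 => b.
by rewrite bilZr bil_sym// normal_part_orthogonal mulr0.
Qed.

Lemma mxck_comp_metric n : mxck n (fun y => G (f y)) x.
Proof.
exact: mxck_comp (immersion_germ_vck n imf) (metric_germ_mxck n mG).
Qed.

Lemma mxck_immersion_jacobian n : mxck n (fun y => 'J f y) x.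
Proof. exact: mxck_jacobian (immersion_germ_vck n.+1 imf). Qed.

Lemma mxck_induced_gram n : mxck n (induced_gram G f) x.
Proof.
apply: mxckM; last exact/mxck_tr/mxck_immersion_jacobian.
by apply: mxckM; [exact: mxck_immersion_jacobian|exact: mxck_comp_metric].
Qed.

Lemma vck_normal_part n (W : 'rV[R]_m -> 'rV[R]_k) : vck n W x ->
  vck n (fun y => normal_part G f y (W y)) x.
Proof.
move=> /vck_mxck cW; apply/vck_mxck.
have cJ := mxck_immersion_jacobian n.
apply: mxckB => //; apply: mxckM => //; apply: mxckM; last first.
  by apply: mxck_inv; [exact: induced_gram_unit|exact: mxck_induced_gram].
apply: mxckM; last exact: mxck_tr.
by apply: mxckM => //; exact: mxck_comp_metric.
Qed.

Lemma vck_cov_along n (W : 'rV[R]_m -> 'rV[R]_k) v : vck n.+1 W x ->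
  vck n (fun y => cov_along G f W y v) x.
Proof.
move=> cW; apply/vck_mxck; apply: mxckD; first exact/vck_mxck/vck_derive.
apply/vck_mxck; apply: vck_christoffel => //.
- exact: immersion_germ_vck.
- apply/vck_mxck; apply: mxckM; first exact: mxck_cst.
  exact: mxck_immersion_jacobian.
- by apply/vck_mxck; apply: mxckS; exact/vck_mxck.
Qed.

Lemma vck_mean_curvature n : vck n (mean_curvature G f) x.
Proof.
apply/vck_mxck; apply: mxckZ; first exact: ck_cst.
apply: mxck_sum => a; apply: mxck_sum => b; apply: mxckZ.
  by apply: mxck_inv; [exact: induced_gram_unit|exact: mxck_induced_gram].
apply/vck_mxck; apply: vck_normal_part; apply: vck_cov_along.
apply/vck_mxck; apply: mxckM; first exact: mxck_cst.
exact: mxck_immersion_jacobian.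
Qed.

End AtPoint.

End Submanifolds.
Lemma jacobian_near_comp (R : realType) l k p (f : 'rV[R]_l -> 'rV[R]_k)
    (g : 'rV[R]_k -> 'rV[R]_p) h x : vck 1 f x -> vck 1 g (f x) ->
  (\forall y \near x, h y = g (f y)) -> 'J h x = 'J f x *m 'J g (f x).
Proof.
move=> cf cg hE; apply: etrans _ (jacobian_comp cf cg).
exact: esym (near_eq_jacobian (vck_comp cf cg) (nearS (fun z => @esym _ _ _) hE)).
Qed.

Section ChangeOfTarget.
Context {R : realType} {m k : nat}.
Variables (G1 G2 : 'rV[R]_k -> 'M[R]_k) (tau : 'rV[R]_k -> 'rV[R]_k).
Variables (f f' : 'rV[R]_m -> 'rV[R]_k) (x : 'rV[R]_m).
Hypotheses (mG1 : metric_germ G1 (f x)) (mG2 : metric_germ G2 (tau (f x))).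
Hypotheses (imf : immersion_germ f x) (ctau : forall n, vck n tau (f x)).
Hypothesis near_ctau : \forall z \near f x, vck 1 tau z.
Hypothesis utau : 'J tau (f x) \in unitmx.
Hypothesis G12 : \forall z \near f x,
  G1 z = 'J tau z *m G2 (tau z) *m ('J tau z)^T.
Hypothesis f'E : \forall y \near x, f' y = tau (f y).

Let near_jacobian_comp : \forall y \near x, 'J f' y = 'J f y *m 'J tau (f y).
Proof.
have H := near_preim (vck_continuous (immersion_germ_vck 0 imf)) near_ctau.
have H' := near_near f'E.
have I : \forall y \near x, vck 1 f y by apply: nearS imf => y [].
near=> y.
have cf : vck 1 f y by near: y.
have ct : vck 1 tau (f y) by near: y.
have E : \forall z \near y, f' z = tau (f z) by near: y.
exact: jacobian_near_comp cf ct E.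
Unshelve. all: by end_near. Qed.

Lemma induced_gram_target : induced_gram G2 f' x = induced_gram G1 f x.
Proof.
rewrite /induced_gram (nbhs_singleton near_jacobian_comp) (nbhs_singleton f'E).
by rewrite (nbhs_singleton G12) trmx_mul !mulmxA.
Qed.

Lemma normal_part_target u :
  normal_part G2 f' x (u *m 'J tau (f x)) = normal_part G1 f x u *m 'J tau (f x).
Proof.
rewrite /normal_part induced_gram_target (nbhs_singleton near_jacobian_comp).
by rewrite (nbhs_singleton f'E) (nbhs_singleton G12) trmx_mul mulmxBl !mulmxA.
Qed.

(** The second derivative of [tau] produced by the chain rule is the inhomogeneous term of
    [christoffel_change], so the covariant derivative transforms as a vector. *)
Lemma cov_along_target v w :
  cov_along G2 f' (fun y => w *m 'J f' y) x v =
  cov_along G1 f (fun y => w *m 'J f y) x v *m 'J tau (f x).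
Proof.
have cf n := immersion_germ_vck n imf.
have cwJ : vck 1 (fun y => w *m 'J f y) x.
  by apply/vck_mxck; apply: mxckM; [exact: mxck_cst|exact: mxck_immersion_jacobian].
have D : 'D_v (fun y => w *m 'J f' y) x =
    'D_v (fun y => w *m 'J f y) x *m 'J tau (f x) +
    'D_(v *m 'J f x) (fun z => (w *m 'J f x) *m 'J tau z) (f x).
  rewrite (derive_mul_jacobian v (cf 1%N)).
  apply: etrans _ (derive_mul_comp v cwJ (mxck_jacobian (ctau 2)) (cf 1%N)).
  by apply: near_eq_derive; apply: nearS near_jacobian_comp => y ->; rewrite mulmxA.
have Chr := christoffel_change (v *m 'J f x) (w *m 'J f x) G12 (metric_germ_sym mG2)
  (metric_germ_unit mG1) (metric_germ_unit mG2) utau (metric_germ_mxck 1 mG1)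
  (metric_germ_mxck 1 mG2) (ctau 2).
have E : christoffel G2 (f' x) (v *m 'J f' x) (w *m 'J f' x) =
    christoffel G2 (tau (f x)) (v *m 'J f x *m 'J tau (f x))
      (w *m 'J f x *m 'J tau (f x)).
  by rewrite (nbhs_singleton near_jacobian_comp) (nbhs_singleton f'E) !mulmxA.
apply: etrans (congr2 (fun p q => p + q) D E) _.
apply: etrans _ (esym (mulmxDl _ _ _)).
apply: etrans _ (esym (congr1 (fun q => _ + q) Chr)).
by apply: etrans (esym (addrA _ _ _)) _; apply: congr1; exact: addrC.
Qed.

Lemma mean_curvature_target :
  mean_curvature G2 f' x = mean_curvature G1 f x *m 'J tau (f x).
Proof.
rewrite /mean_curvature -scalemxAl mulmx_suml; congr (_ *: _).
apply: eq_bigr => a _; rewrite mulmx_suml; apply: eq_bigr => b _.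
by rewrite induced_gram_target -scalemxAl /second_ff cov_along_target normal_part_target.
Qed.

End ChangeOfTarget.

Section SecondFundamentalForm.
Context {R : realType} {m k : nat}.
Variables (G : 'rV[R]_k -> 'M[R]_k) (f : 'rV[R]_m -> 'rV[R]_k) (x : 'rV[R]_m).
Hypotheses (mG : metric_germ G (f x)) (imf : immersion_germ f x).

Lemma cov_along_jacobianC v w : cov_along G f (fun y => w *m 'J f y) x v =
  cov_along G f (fun y => v *m 'J f y) x w.
Proof.
rewrite /cov_along derive_mul_jacobianC; last exact: immersion_germ_vck.
by rewrite (christoffel_sym _ _ (metric_germ_sym mG)).
Qed.

Lemma second_ff_sym v w : second_ff G f x v w = second_ff G f x w v.
Proof. by rewrite /second_ff cov_along_jacobianC. Qed.

Lemma second_ff_linear c u v w :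
  second_ff G f x (c *: u + v) w = c *: second_ff G f x u w + second_ff G f x v w.
Proof.
have cwJ : vck 1 (fun y => w *m 'J f y) x.
  by apply/vck_mxck; apply: mxckM; [exact: mxck_cst|exact: mxck_immersion_jacobian].
rewrite /second_ff -normal_partZ -normal_partD; congr normal_part.
rewrite /cov_along mulmxDl -scalemxAl.
rewrite (christoffel_linear _ _ _ _ (metric_germ_unit mG) (metric_germ_mxck 1 mG)).
have d := vck_differentiable cwJ.
by rewrite !deriveE// linearD linearZ scalerDr addrACA.
Qed.

(** Linearity in the first slot comes from that of the covariant derivative; in the second it
    follows by symmetry. *)
Lemma second_ff_expand v w : second_ff G f x v w =
  \sum_a \sum_b (v 0 a * w 0 b) *: second_ff G f x (evec R a) (evec R b).
Proof.
have L (h : 'rV[R]_m -> 'rV[R]_k) :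
    (forall c u v, h (c *: u + v) = c *: h u + h v) ->
    forall u, h u = \sum_a u 0 a *: h (evec R a).
  move=> hl u; rewrite [in LHS](row_sum_delta u).
  have h0 : h 0 = 0.
    by have := hl (-1) 0 0; rewrite scaleN1r oppr0 addr0 scaleN1r addNr.
  elim: (index_enum _) => [|a s IH]; first by rewrite !big_nil.
  by rewrite !big_cons hl IH.
rewrite (L (second_ff G f x ^~ w)) => [|c u u']; last exact: second_ff_linear.
apply: eq_bigr => a _; rewrite (L (second_ff G f x (evec R a))) => [|c u u'].
  by rewrite scaler_sumr; apply: eq_bigr => b _; rewrite scalerA.
by rewrite ![second_ff G f x (evec R a) _]second_ff_sym second_ff_linear.
Qed.

End SecondFundamentalForm.

Lemma invmx_congruence (F : fieldType) n (S g : 'M[F]_n) :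
  S \in unitmx -> g \in unitmx -> S^T *m invmx (S *m g *m S^T) *m S = invmx g.
Proof.
move=> uS ug; have uSt : S^T \in unitmx by rewrite unitmx_tr.
have uP : S *m g *m S^T \in unitmx by rewrite !unitmx_mul uS ug uSt.
apply: (can_inj (mulKmx ug)); rewrite (mulmxV ug).
by apply: (can_inj (mulKmx uS)); rewrite mulmx1 !mulmxA (mulmxV uP) mul1mx.
Qed.

Section ChangeOfSource.
Context {R : realType} {m k : nat}.
Variables (G : 'rV[R]_k -> 'M[R]_k) (sigma : 'rV[R]_m -> 'rV[R]_m).
Variables (f f' : 'rV[R]_m -> 'rV[R]_k) (x : 'rV[R]_m).
Hypotheses (mG : metric_germ G (f (sigma x))) (imf : immersion_germ f (sigma x)).
Hypothesis csigma : \forall y \near x, forall n, vck n sigma y.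
Hypothesis usigma : 'J sigma x \in unitmx.
Hypothesis f'E : \forall y \near x, f' y = f (sigma y).

Let near_jacobian_comp : \forall y \near x, 'J f' y = 'J sigma y *m 'J f (sigma y).
Proof.
have H := near_preim (vck_continuous (nbhs_singleton csigma 0)) imf.
have H' := near_near f'E.
near=> y.
have [cf _] : (forall n, vck n f (sigma y)) /\ row_free ('J f (sigma y)) by near: y.
have ct : forall n, vck n sigma y by near: y.
have E : \forall z \near y, f' z = f (sigma z) by near: y.
exact: jacobian_near_comp (ct 1%N) (cf 1%N) E.
Unshelve. all: by end_near. Qed.

Let induced_gram_source : induced_gram G f' x =
  'J sigma x *m induced_gram G f (sigma x) *m ('J sigma x)^T.
Proof.
rewrite /induced_gram (nbhs_singleton near_jacobian_comp) (nbhs_singleton f'E).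
by rewrite trmx_mul !mulmxA.
Qed.

Let gram_inverse : ('J sigma x)^T *m invmx (induced_gram G f' x) *m 'J sigma x =
  invmx (induced_gram G f (sigma x)).
Proof.
apply: etrans (congr1 (fun P => ('J sigma x)^T *m invmx P *m 'J sigma x)
  induced_gram_source) _.
exact: invmx_congruence usigma (induced_gram_unit mG imf).
Qed.

Let normal_part_source u : normal_part G f' x u = normal_part G f (sigma x) u.
Proof.
rewrite /normal_part -[X in _ = _ - _ *m X *m _]gram_inverse.
rewrite (nbhs_singleton near_jacobian_comp) (nbhs_singleton f'E).
by rewrite trmx_mul !mulmxA.
Qed.

(** A change of source coordinates adds a second derivative of [sigma] followed by the differential
    of [f]; this term is tangent and the normal projection kills it. *)
Let second_ff_source v w : second_ff G f' x v w =
  second_ff G f (sigma x) (v *m 'J sigma x) (w *m 'J sigma x).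
Proof.
have cs n := nbhs_singleton csigma n.
have cwS : vck 1 (fun y => w *m 'J sigma y) x.
  by apply/vck_mxck; apply: mxckM; [exact: mxck_cst|exact: mxck_jacobian].
have cJ := mxck_immersion_jacobian imf 1.
have D : 'D_v (fun y => w *m 'J f' y) x =
    'D_v (fun y => w *m 'J sigma y) x *m 'J f (sigma x) +
    'D_(v *m 'J sigma x) (fun z => (w *m 'J sigma x) *m 'J f z) (sigma x).
  rewrite (derive_mul_jacobian v (cs 1%N)).
  apply: etrans _ (derive_mul_comp v cwS cJ (cs 1%N)).
  by apply: near_eq_derive; apply: nearS near_jacobian_comp => y ->; rewrite mulmxA.
have E : christoffel G (f' x) (v *m 'J f' x) (w *m 'J f' x) =
    christoffel G (f (sigma x)) (v *m 'J sigma x *m 'J f (sigma x))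
      (w *m 'J sigma x *m 'J f (sigma x)).
  by rewrite (nbhs_singleton near_jacobian_comp) (nbhs_singleton f'E) !mulmxA.
have C := etrans (congr2 (fun p q => p + q) D E) (esym (addrA _ _ _)).
apply: etrans (normal_part_source _) _.
apply: etrans (congr1 (normal_part G f (sigma x)) C) _.
apply: etrans (normal_partD _ _ _ _ _) _.
apply: etrans (congr1 (fun u => u + _) (normal_part_tangent mG imf _)) _.
exact: add0r.
Qed.

(** The inverse metric transforms contragrediently to the second fundamental form, so the trace is
    invariant. *)
Lemma mean_curvature_source : mean_curvature G f' x = mean_curvature G f (sigma x).
Proof.
apply: (congr1 (fun u => m%:R^-1 *: u)).
pose S := 'J sigma x; pose g' := invmx (induced_gram G f' x).
pose II c d := second_ff G f (sigma x) (evec R c) (evec R d).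
have rowS a b : (evec R a *m S) 0 b = S a b by rewrite -rowE mxE.
transitivity (\sum_a \sum_b \sum_c \sum_d (g' a b * (S a c * S b d)) *: II c d).
  apply: eq_bigr => a _; apply: eq_bigr => b _.
  apply: etrans (congr1 (fun u => g' a b *: u) (second_ff_source _ _)) _.
  apply: etrans (congr1 (fun u => g' a b *: u) (second_ff_expand mG imf _ _)) _.
  rewrite scaler_sumr; apply: eq_bigr => c _.
  rewrite scaler_sumr; apply: eq_bigr => d _.
  by rewrite scalerA !rowS.
transitivity (\sum_c \sum_d (S^T *m g' *m S) c d *: II c d); last first.
  by apply: (congr1 (fun P : 'M[R]_m => \sum_c \sum_d P c d *: II c d)).
clearbody S g' II.
under eq_bigr do rewrite exchange_big /=.
rewrite exchange_big /=; apply: eq_bigr => c _.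
under eq_bigr do rewrite exchange_big /=.
rewrite exchange_big /=; apply: eq_bigr => d _.
rewrite [X in _ = X *: _]mxE scaler_suml exchange_big /=; apply: eq_bigr => b _.
rewrite [X in _ = (X * _) *: _]mxE mulr_suml scaler_suml; apply: eq_bigr => a _.
by rewrite [S^T c a]mxE mulrCA mulrA.
Qed.

End ChangeOfSource.

(** * The divergence of the inserted mean curvature vector *)

Section DivergenceFormula.
Context {R : realType} {m k : nat}.
Variables (G : 'rV[R]_k -> 'M[R]_k) (f : 'rV[R]_m -> 'rV[R]_k) (x : 'rV[R]_m).
Variable w : 'rV[R]_k -> 'M[R]_(m, k) -> R.
Hypotheses (mG : metric_germ G (f x)) (imf : immersion_germ f x).
Hypotheses (mw : \forall z \near f x, multilinear (w z)) (aw : alternating (w (f x))).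
Hypotheses (cw : forall phi, ck 1 (w ^~ (basis_mx phi)) (f x)).
Hypothesis pw : parallel_at G w (f x).

(** The covariant analogue of [divergence_insert]: the array that cancels consists of the covariant
    derivatives of the coordinate fields, symmetric because the connection has no torsion. *)
Lemma divergence_parallel (W : 'rV[R]_m -> 'rV[R]_k) : vck 1 W x ->
  \sum_a 'D_(evec R a) (fun y => w (f y) (set_row a (W y) ('J f y))) x =
  \sum_a w (f x) (set_row a (cov_along G f W x (evec R a)) ('J f x)).
Proof.
move=> cW; have mwx := nbhs_singleton mw.
pose S a b := cov_along G f (fun y => evec R b *m 'J f y) x (evec R a).
have SC a b : S a b = S b a by exact: cov_along_jacobianC.
have Z := alternating_sym_cancel (W x) ('J f x) mwx aw SC.
apply: etrans _ (addr0 _); apply: etrans _ (congr1 (fun t => _ + t) Z).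
apply: etrans _ (big_split _ _ _ _ _); apply: eq_bigr => a _.
have rowE b : (fun y => row b (set_row a (W y) ('J f y))) =
    if b == a then W else fun y => evec R b *m 'J f y.
  by apply/funext => y; rewrite row_set_row; case: eqP => // _; rewrite rowE.
have cX : mxck 1 (fun y => set_row a (W y) ('J f y)) x.
  move=> r b; have cJ := mxck_immersion_jacobian imf 1.
  have -> : (fun y => set_row a (W y) ('J f y) r b) =
      (fun y => if r == a then W y 0 b else 'J f y r b).
    by apply/funext => y; rewrite set_rowE.
  by case: eqP => _; [exact: cW|exact: cJ].
apply: etrans (derive_parallel _ mw cw pw (immersion_germ_vck 1 imf) cX) _.
apply: etrans (bigD1 a isT) _; apply: congr2.
  by rewrite rowE eqxx set_row_same.
by apply: eq_bigr => b ba; rewrite rowE (negbTE ba).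
Qed.

Lemma divergence_mean_curvature : (0 < m)%N ->
  (forall v, normal_derivative G f (mean_curvature G f) x v = 0) ->
  \sum_a 'D_(evec R a)
    (fun y => w (f y) (set_row a (mean_curvature G f y) ('J f y))) x =
  - (m%:R * bil (G (f x)) (mean_curvature G f x) (mean_curvature G f x)) *
    w (f x) ('J f x).
Proof.
move=> m0 pH; have cH := vck_mean_curvature mG imf 1.
rewrite (divergence_parallel cH).
set H := mean_curvature G f; set g := induced_gram G f x; set J := 'J f x.
(* The coefficients of the tangential part of nabla_a H in the basis of coordinate fields. As the
   normal part vanishes, nabla_a H is row [a] of [C *m J], and the sum becomes the trace of [C]. *)
pose C := \matrix_a (cov_along G f H x (evec R a) *m G (f x) *m J^T *m invmx g).
have CJ a : cov_along G f H x (evec R a) = row a (C *m J).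
  rewrite row_mul rowK; have := pH (evec R a).
  by rewrite /normal_derivative /normal_part => /eqP; rewrite subr_eq0 => /eqP.
under eq_bigr do rewrite CJ.
rewrite (alternating_trace _ _ (nbhs_singleton mw) aw); congr (_ * _).
have sG := nbhs_singleton (metric_germ_sym mG).
have sg : g^T = g by exact: induced_gram_sym.
have sgi : (invmx g)^T = invmx g by rewrite trmx_inv sg.
(* H is normal at all nearby points, so its product with a coordinate field has derivative zero. In
   the other term, normality of H allows the derivative of the coordinate field to be replaced by
   its normal part, which is [second_ff]. *)
have covH a b : bil (G (f x)) (cov_along G f H x (evec R a)) (evec R b *m J) =
    - bil (G (f x)) (H x) (second_ff G f x (evec R a) (evec R b)).
  have cJ : vck 1 (fun y => evec R b *m 'J f y) x.
    by apply/vck_mxck; apply: mxckM; [exact: mxck_cst|exact: mxck_immersion_jacobian].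
  have P := derive_metric (evec R a) (metric_germ_sym mG) (metric_germ_unit mG)
    (metric_germ_mxck 1 mG) (immersion_germ_vck 1 imf) cH cJ.
  have Z : 'D_(evec R a) (fun y => bil (G (f y)) (mean_curvature G f y)
      (evec R b *m 'J f y)) x = 0.
    rewrite -[RHS](derive_cst 0 x (evec R a)); apply: near_eq_derive.
    apply: nearS2 _ (near_near imf) (near_metric_germ mG imf) => y imy mGy.
    exact: mean_curvature_orthogonal.
  rewrite Z in P; apply/eqP; rewrite -addr_eq0 /second_ff /normal_part.
  set u := cov_along G f (fun y => evec R b *m 'J f y) x (evec R a) in P *.
  rewrite (bil_sym (H x) _ sG) bilBl (bil_sym u _ sG) (bil_sym (_ *m J) _ sG).
  rewrite (mean_curvature_orthogonal mG imf) subr0.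
  by apply/eqP/esym.
have mH : m%:R *: H x = \sum_(a < m) \sum_(b < m)
    invmx g a b *: second_ff G f x (evec R a) (evec R b).
  by rewrite /H /mean_curvature scalerA divff ?scale1r// pnatr_eq0 -lt0n.
(* The trace of [C] contracts [covH] with the inverse induced metric, which turns the second
   fundamental form into [m%:R *: H x]. *)
rewrite -bilZr mH /mxtrace.
rewrite (eq_bigr (fun a => - bil (G (f x)) (H x) (\sum_(b < m)
    invmx g a b *: second_ff G f x (evec R a) (evec R b)))) => [|a _].
  rewrite sumrN; congr (- _).
  have := bil_sumr (G (f x)) (index_enum 'I_m) (fun=> 1) (fun a => \sum_(b < m)
    invmx g a b *: second_ff G f x (evec R a) (evec R b)) (H x).
  under eq_bigr do rewrite scale1r.
  by move=> ->; apply: eq_bigr => a _; rewrite mul1r.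
rewrite bil_sumr -sumrN mxE [LHS]mxE; apply: eq_bigr => b _.
rewrite -mulrN -covH mulrC.
have -> : invmx g b a = invmx g a b by rewrite -{1}sgi mxE.
by rewrite /bil trmx_mul trmx_delta mulmxA -colE [in RHS]mxE.
Qed.

End DivergenceFormula.

(** * Direct orthonormal frames *)

Section OrthonormalFrames.
Context {R : realType}.

Lemma positive_definite_congruence m (S g : 'M[R]_m) : S \in unitmx ->
  positive_definite g -> positive_definite (S *m g *m S^T).
Proof.
move=> uS pg v v0; rewrite bil_mul; apply: pg.
by apply: contra_neq v0 => /(canRL (mulmxK uS)) ->; rewrite mul0mx.
Qed.

(* Cholesky decomposition: eliminate the first row and column of g and recurse
   on the Schur complement. *)
Lemma orthonormal_frame_exists m (g : 'M[R]_m) : g^T = g ->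
  positive_definite g -> exists2 X : 'M[R]_m, orthonormal_frame g X & 0 < \det X.
Proof.
elim: m g => [|m IH] g sg pg.
  by exists 1%:M; [apply/matrixP => -[]|rewrite det_mx00].
pose a : R := g 0 0.
have a0 : 0 < a.
  have := pg (evec R 0); rewrite bil_evec /evec -rowE mxE; apply.
  by apply/eqP => /rowP/(_ 0)/eqP; rewrite !mxE !eqxx oner_eq0.
have sg' : (g : 'M[R]_(1 + m))^T = g by exact: sg.
pose b := ursubmx (g : 'M[R]_(1 + m)).
pose c := drsubmx (g : 'M[R]_(1 + m)).
have gE : g = block_mx (a%:M : 'M[R]_1) b b^T c.
  apply: etrans (esym (@submxK _ 1 m 1 m g)) _.
  have -> : dlsubmx (g : 'M[R]_(1 + m)) = b^T by rewrite /b trmx_ursub sg'.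
  rewrite [ulsubmx _]mx11_scalar; congr (block_mx (_%:M) _ _ _).
  by rewrite 2!mxE; congr (g _ _); apply/val_inj.
pose L : 'M[R]_(1 + m) := block_mx 1%:M 0 (- (a^-1 *: b^T)) 1%:M.
have dL : \det L = 1 by rewrite det_lblock !det1 mulr1.
have uL : L \in unitmx by rewrite unitmxE dL unitr1.
pose c' := c - a^-1 *: (b^T *m b).
have LgL : L *m g *m L^T = block_mx (a%:M : 'M[R]_1) 0 0 c'.
  apply: etrans (congr1 (fun P : 'M[R]_(1 + m) => L *m P *m L^T) gE) _.
  have bT : (- (a^-1 *: b^T))^T = - (a^-1 *: b).
    by apply/matrixP => i j; rewrite !mxE.
  rewrite /L mulmx_block tr_block_mx !trmx1 !trmx0 bT.
  rewrite mulmx_block !mul1mx !mulmx1 !mul0mx !mulmx0 !addr0.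
  rewrite mulNmx -scalemxAl mul_mx_scalar scalerA mulVf ?gt_eqF// scale1r addNr.
  rewrite mul0mx add0r mulmxN -scalemxAr mul_scalar_mx scalerA mulVf ?gt_eqF//.
  by rewrite scale1r addNr mulNmx -scalemxAl addrC.
have sc' : c'^T = c'.
  rewrite /c' linearB linearZ /= trmx_mul trmxK; congr (_ - _).
  by rewrite /c trmx_drsub sg'.
have pc' : positive_definite c'.
  move=> v v0.
  have r0 : row_mx (0 : 'rV[R]_1) v != 0.
    by apply: contra_neq v0 => H; have := congr1 rsubmx H; rewrite row_mxKr linear0.
  have := positive_definite_congruence uL pg r0; rewrite LgL /bil.
  rewrite mul_row_block !mul0mx !mulmx0 !add0r tr_row_mx mul_row_col.
  by rewrite trmx0 mulmx0 add0r.
have [X oX dX] := IH c' sc' pc'.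
pose s := (Num.sqrt a)^-1.
have s0 : 0 < s by rewrite invr_gt0 sqrtr_gt0.
have sas : s * a * s = 1.
  rewrite /s -{2}(sqr_sqrtr (ltW a0)) expr2 mulrA mulVf ?mul1r ?divff//.
    by rewrite gt_eqF// sqrtr_gt0.
  by rewrite gt_eqF// sqrtr_gt0.
pose D : 'M[R]_(1 + m) := block_mx (s%:M : 'M[R]_1) 0 0 X.
exists (D *m L).
  have E : D *m L *m g *m (D *m L)^T = D *m (L *m g *m L^T) *m D^T.
    by rewrite trmx_mul !mulmxA.
  apply: etrans E _; rewrite LgL /D tr_block_mx !trmx0 tr_scalar_mx !mulmx_block.
  rewrite !mul0mx !mulmx0 !addr0 !add0r -!scalar_mxM sas oX.
  by rewrite !mul0mx; exact: esym (scalar_mx_block 1 m 1).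
have dD : \det D = \det (s%:M : 'M[R]_1) * \det X by exact: det_ublock.
have -> : \det (D *m L) = s * \det X.
  by apply: etrans (det_mulmx _ _) _; rewrite dL mulr1 dD det_scalar1.
exact: mulr_gt0.
Qed.

End OrthonormalFrames.

(** * From manifolds and their charts to germs *)

Section ManifoldGerms.
Context {R : realType} {k : nat} (N : smooth_manifold R k).
Implicit Types (i j : chart N).

Lemma jacobian_transition_unit i j x : overlap i j x ->
  'J (transition i j) x \in unitmx.
Proof.
move=> ov; have ct := vck_transition 1 ov.
have ov' : overlap j i (transition i j x).
  apply/overlapP; split; first exact: transition_image.
  by rewrite param_transition//; apply: dom_param; case/overlapP: ov.
have E : \forall y \near x, y = transition j i (transition i j y).
  apply: nearS (open_near (open_overlap (i := i) (j := j)) ov) => y oy.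
  have iy : image_of i y by case/overlapP: oy.
  apply: etrans (esym (paramK iy)) _.
  exact: congr1 (esym (param_transition oy)).
have J := jacobian_near_comp ct (vck_transition 1 ov') E.
have J1 : 'J (fun y : 'rV[R]_k => y) x = 1%:M.
  apply/row_matrixP => a; rewrite rowE [RHS]rowE mulmx1.
  rewrite derive_mul_jacobian; first exact: derive_id.
  by move=> b; exact: ck_coord.
exact: (mulmx1_unit (etrans (esym J) J1)).1.
Qed.

Lemma metric_germ_gram (g : riemannian_metric N) i x : image_of i x ->
  metric_germ (gram g i) x.
Proof.
move=> ix; apply: nearS (open_near (open_image_of (i := i)) ix) => y iy; split.
- exact: gram_sym.
- by move=> v; exact: gram_pos.
- by move=> n a b; exact: (smooth_on_ck n (open_image_of (i := i)) (@gram_smooth _ _ _ g i a b) iy).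
Qed.

Context {m : nat} (w : diff_form N m).

Lemma multilinear_form i x : image_of i x -> multilinear (form w i x).
Proof.
move=> ix r X b u c v.
have rC z z' : row' r (set_row r z X) = row' r (set_row r z' X).
  by apply/matrixP => s l; rewrite !mxE !(eq_sym _ r) (negbTE (neq_lift r s)).
apply: (form_multilinear w ix _ (rC _ _) (rC _ _)).
by rewrite !row_set_row eqxx.
Qed.

Lemma alternating_form i x : image_of i x -> alternating (form w i x).
Proof. by move=> ix X r s; exact: form_alternate. Qed.

Lemma ck_diff_form n i x X : image_of i x -> ck n (form w i ^~ X) x.
Proof.
by move=> ix; exact: (smooth_on_ck n (open_image_of (i := i)) (@form_smooth _ _ _ _ w i X) ix).
Qed.

Lemma near_multilinear_form i x : image_of i x ->
  \forall y \near x, multilinear (form w i y).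
Proof.
move=> ix; apply: nearS (open_near (open_image_of (i := i)) ix) => y.
exact: multilinear_form.
Qed.

Lemma parallel_at_form (g : riemannian_metric N) i x : parallel_form g w ->
  image_of i x -> parallel_at (gram g i) (form w i) x.
Proof. by move=> pw ix v X; apply/eqP; rewrite -subr_eq0; apply/eqP; exact: pw. Qed.

End ManifoldGerms.

(** * The mean curvature vector density and minimality *)

Section MeanCurvatureField.
Context {R : realType} {m k : nat}.
Context {M : smooth_manifold R m} {N : smooth_manifold R k}.
Variables (g : riemannian_metric N) (w : diff_form N m) (F : M -> N).
Hypothesis F_imm : immersion F.
Implicit Types (i : chart M) (j : chart N).

Lemma local_domP i j x :
  local_dom F i j x <-> image_of i x /\ dom j (F (param i x)).
Proof.
split=> [[p [ip jp] <-]|[ix jx]].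
  by split; [exists p|rewrite coordK].
by exists (param i x); [split=> //; exact: dom_param|exact: paramK].
Qed.

Lemma open_local_dom i j : open (local_dom F i j).
Proof.
apply: open_image_sub; apply: open_comp; last exact: dom_open.
by move=> p _; case: F_imm => cF _; exact: cF.
Qed.

Lemma near_local_dom i j x : local_dom F i j x ->
  \forall y \near x, local_dom F i j y.
Proof. exact: open_near (open_local_dom (i := i) (j := j)). Qed.

Lemma local_expr_image i j x : local_dom F i j x -> image_of j (local_expr F i j x).
Proof. by move=> /local_domP[_ jx]; exact: image_of_coord. Qed.

Lemma immersion_germ_local i j x : local_dom F i j x ->
  immersion_germ (local_expr F i j) x.
Proof.
move=> lx; apply: nearS (near_local_dom lx) => y ly.
have [sf inj] := F_imm.2 i j.
have cf n : vck n (local_expr F i j) y.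
  exact: (smooth_on_vck n (open_local_dom (i := i) (j := j)) sf ly).
split=> //; apply: inj_row_free => v vJ.
have df := vck_differentiable (cf 1%N).
apply: (inj y ly); rewrite linear0 -deriveE//.
by rewrite (deriveEjacobian v df).
Qed.

Lemma metric_germ_local i j x : local_dom F i j x ->
  metric_germ (gram g j) (local_expr F i j x).
Proof. by move=> /local_expr_image; exact: metric_germ_gram. Qed.

Definition mean_curvature_field i j (x : 'rV[R]_m) : 'rV[R]_m :=
  \row_a form w j (local_expr F i j x)
    (set_row a (mean_curvature (gram g j) (local_expr F i j) x)
      ('J (local_expr F i j) x)).

(** Both the inserted vector and the coordinate fields transform by the differential of the target
    transition, which the compatibility of the form absorbs. *)
Lemma mean_curvature_field_target i j j' x :
  local_dom F i j x -> local_dom F i j' x ->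
  mean_curvature_field i j x = mean_curvature_field i j' x.
Proof.
move=> lx lx'; pose tau := transition j j'.
have ov y : local_dom F i j y -> local_dom F i j' y -> overlap j j' (local_expr F i j y).
  by move=> /local_domP[_ jy] /local_domP[_ jy']; exact: overlap_coord.
have fE y : local_dom F i j y -> local_expr F i j' y = tau (local_expr F i j y).
  by move=> /local_domP[_ jy]; rewrite /tau /transition /local_expr /= coordK.
have f'E : \forall y \near x, local_expr F i j' y = tau (local_expr F i j y).
  by apply: nearS (near_local_dom lx) => y; exact: fE.
have ovx := ov x lx lx'.
have near_ov := open_near (open_overlap (i := j) (j := j')) ovx.
have mG2 : metric_germ (gram g j') (tau (local_expr F i j x)).
  by rewrite -fE//; exact: metric_germ_local.
have imf := immersion_germ_local lx.
have ct n : vck n tau (local_expr F i j x) by exact: vck_transition.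
have nct : \forall z \near local_expr F i j x, vck 1 tau z.
  by apply: nearS near_ov => z; exact: vck_transition.
have G12 : \forall z \near local_expr F i j x,
    gram g j z = 'J tau z *m gram g j' (tau z) *m ('J tau z)^T.
  by apply: nearS near_ov => z; exact: gram_compat.
have HE := mean_curvature_target (metric_germ_local lx) mG2 imf ct nct
  (jacobian_transition_unit ovx) G12 f'E.
have JE := jacobian_near_comp (immersion_germ_vck 1 imf) (ct 1%N) f'E.
apply/rowP => a; rewrite [LHS]mxE [RHS]mxE.
apply: etrans (form_compat w _ ovx) _; rewrite mul_set_row.
apply: congr2; first exact: esym (fE x lx).
exact: (congr2 (set_row a) (esym HE) (esym JE)).
Qed.

(** The mean curvature vector is unchanged while the coordinate fields are multiplied by the
    Jacobian, so the law of a vector density is exactly [alternating_cofactor]. *)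
Lemma mean_curvature_field_source i i' j x :
  oriented M -> overlap i i' x -> local_dom F i j x ->
  mean_curvature_field i j x *m 'J (transition i i') x =
  \det ('J (transition i i') x) *: mean_curvature_field i' j (transition i i' x).
Proof.
move=> oM ov lx; set sigma := transition i i'.
have lx' : local_dom F i' j (sigma x).
  apply/local_domP; split; first exact: transition_image.
  by rewrite param_transition//; case/local_domP: lx.
have near_ov := open_near (open_overlap (i := i) (j := i')) ov.
have fE y : overlap i i' y -> local_expr F i j y = local_expr F i' j (sigma y).
  by move=> oy; rewrite /local_expr /= param_transition.
have f'E : \forall y \near x, local_expr F i j y = local_expr F i' j (sigma y).
  by apply: nearS near_ov => y; exact: fE.
have cs : \forall y \near x, forall n, vck n sigma y.
  by apply: nearS near_ov => y oy n; exact: vck_transition.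
have imf := immersion_germ_local lx'.
have HE := mean_curvature_source (metric_germ_local lx') imf cs
  (jacobian_transition_unit ov) f'E.
have JE := jacobian_near_comp (nbhs_singleton cs 1%N) (immersion_germ_vck 1 imf) f'E.
have ij := local_expr_image lx'.
apply/rowP => b; rewrite [LHS]mxE [RHS]mxE.
rewrite [X in _ = _ * X]mxE -alternating_cofactor; first last.
- exact: alternating_form.
- exact: multilinear_form.
apply: eq_bigr => a _; rewrite [X in X * _]mxE mulrC; apply: (congr1 (fun t => _ * t)).
apply: congr2; first exact: fE.
exact: (congr2 (set_row a) HE JE).
Qed.

Lemma vck_mean_curvature_field n i j x : local_dom F i j x ->
  vck n (mean_curvature_field i j) x.
Proof.
move=> lx a; have ij := local_expr_image lx; have imf := immersion_germ_local lx.
apply: (@ck_congr _ _ _ (fun y => form w j (local_expr F i j y)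
    (set_row a (mean_curvature (gram g j) (local_expr F i j) y)
      ('J (local_expr F i j) y)))).
  by apply: near_all => y; rewrite [RHS]mxE.
apply: ck_form.
- exact: near_multilinear_form.
- by move=> phi; exact: ck_diff_form.
- exact: immersion_germ_vck.
- move=> r b.
  have cJ := mxck_immersion_jacobian imf n.
  have cH := vck_mean_curvature (metric_germ_local lx) imf n.
  have E y : set_row a (mean_curvature (gram g j) (local_expr F i j) y)
      ('J (local_expr F i j) y) r b =
      if r == a then mean_curvature (gram g j) (local_expr F i j) y 0 b
      else 'J (local_expr F i j) y r b by rewrite set_rowE.
  rewrite (funext E); case: eqP => _; [exact: cH|exact: cJ].
Qed.

Lemma divergence_mean_curvature_field i j x : (0 < m)%N ->
  parallel_form g w -> parallel_mean_curvature g F -> local_dom F i j x ->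
  divergence (mean_curvature_field i j) x =
  - (m%:R * bil (gram g j (local_expr F i j x))
      (mean_curvature (gram g j) (local_expr F i j) x)
      (mean_curvature (gram g j) (local_expr F i j) x)) *
    form w j (local_expr F i j x) ('J (local_expr F i j) x).
Proof.
move=> m0 pw pH lx; have ij := local_expr_image lx.
have D := divergence_mean_curvature (metric_germ_local lx)
  (immersion_germ_local lx) (near_multilinear_form w ij) (alternating_form w ij)
  (fun phi => ck_diff_form w 1 (basis_mx phi) ij) (parallel_at_form pw ij) m0
  (fun v => pH i j x v lx).
apply: etrans _ D; apply: eq_bigr => a _; apply: (congr1 (fun h => 'D_(evec R a) h x)).
by apply/funext => y; rewrite [LHS]mxE.
Qed.

(** The angle is given on direct orthonormal frames. Such a frame [X] exists, and passing from it to
    the coordinate frame divides the value by the positive number [\det X]. *)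
Lemma form_jacobian_gt0 (theta : M -> R) i j x : is_angle g w F theta ->
  (forall p, 0 < cos (theta p)) -> local_dom F i j x ->
  0 < form w j (local_expr F i j x) ('J (local_expr F i j) x).
Proof.
move=> ang pos lx; have ij := local_expr_image lx.
have mG := metric_germ_local lx; have imf := immersion_germ_local lx.
have [X oX dX] := orthonormal_frame_exists (induced_gram_sym mG)
  (induced_gram_pos mG imf).
have [ix jx] := (local_domP i j x).1 lx.
have := pos (param i x); have [_ /(_ i j (dom_param ix) jx X dX)] := ang (param i x).
rewrite paramK// => /(_ oX) ->.
by rewrite alternating_mul ?pmulr_rgt0//; [exact: multilinear_form|exact: alternating_form].
Qed.

End MeanCurvatureField.

Theorem corollary1p1 (R : realType) (m n : nat) (hm : (2 <= m)%N)
    (Mbar : smooth_manifold R (m + n)) (gbar : riemannian_metric Mbar)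
    (Omega : diff_form Mbar m)
    (Omega_calibration : calibration gbar Omega)
    (Omega_parallel : parallel_form gbar Omega)
    (M : smooth_manifold R m) (M_oriented : oriented M)
    (F : M -> Mbar) (F_immersion : immersion F)
    (theta : M -> R) (theta_angle : is_angle gbar Omega F theta)
    (M_closed : compact [set: M])
    (H_parallel : parallel_mean_curvature gbar F)
    (cos_theta_gt0 : forall p : M, 0 < cos (theta p)) :
  minimal gbar F.
Proof.
have m0 : (0 < m)%N by exact: leq_trans hm.
(* A chart of the ambient manifold is picked at each image point, with no continuity in [p]. Since
   the field does not depend on the target chart, [V] agrees near each point with the field computed
   in one fixed chart, and so is regular. *)
have [jc jcP] := boolp.choice (fun p : M => dom_cover (F p)).
pose Vj := mean_curvature_field gbar Omega F.
pose V i x := Vj i (jc (param i x)) x.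
have lc (i : chart M) x : image_of i x -> local_dom F i (jc (param i x)) x.
  by move=> ix; apply/local_domP; split.
have VE i j x : local_dom F i j x -> V i x = Vj i j x.
  move=> lx; have [ix _] := (local_domP F i j x).1 lx.
  exact: (mean_curvature_field_target gbar Omega F_immersion (lc i x ix) lx).
have near_VE i j x : local_dom F i j x -> \forall y \near x, Vj i j y = V i y.
  move=> lx; apply: nearS (near_local_dom F_immersion lx) => y ly.
  exact: (esym (VE i j y ly)).
have divE i j x : local_dom F i j x -> divergence (V i) x =
  - (m%:R * bil (gram gbar j (local_expr F i j x))
      (mean_curvature (gram gbar j) (local_expr F i j) x)
      (mean_curvature (gram gbar j) (local_expr F i j) x)) *
    form Omega j (local_expr F i j x) ('J (local_expr F i j) x).
  move=> lx; have D := divergence_mean_curvature_field F_immersion m0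
    Omega_parallel H_parallel lx.
  apply: etrans _ D; apply: eq_bigr => a _; apply: near_eq_derive.
  apply: nearS (near_VE i j x lx) => y Ey.
  exact: (congr1 (fun v : 'rV[R]_m => v 0 a) (esym Ey)).
have bil0 i j x : local_dom F i j x -> forall v,
    0 <= bil (gram gbar j (local_expr F i j x)) v v.
  move=> lx v; have [->|v0] := eqVneq v 0; first by rewrite /bil !mul0mx mxE.
  by apply/ltW/gram_pos => //; exact: local_expr_image lx.
have dV : vector_density V.
  move=> i i' x ov; have ix : image_of i x by case/overlapP: ov.
  have lx := lc i x ix.
  have lx' : local_dom F i' (jc (param i x)) (transition i i' x).
    apply/local_domP; split; first exact: transition_image.
    by rewrite param_transition.
  rewrite (VE _ _ _ lx) (VE _ _ _ lx').
  exact: mean_curvature_field_source.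
have cV i x : image_of i x -> vck 2 (V i) x.
  move=> ix; have lx := lc i x ix.
  apply: near_eq_vck (near_VE _ _ _ lx) _.
  exact: vck_mean_curvature_field.
have sV i x : image_of i x -> divergence (V i) x <= 0.
  move=> ix; have lx := lc i x ix; rewrite (divE _ _ _ lx) mulNr oppr_le0.
  apply: mulr_ge0; last exact/ltW/(form_jacobian_gt0 _ theta_angle).
  by apply: mulr_ge0; [exact: ler0n|exact: bil0].
move=> i j x lx; have [ix _] := (local_domP F i j x).1 lx.
have := divergence_sign M_closed M_oriented dV cV sV ix.
rewrite (divE _ _ _ lx) mulNr => /eqP.
rewrite oppr_eq0 mulf_eq0 (gt_eqF (form_jacobian_gt0 F_immersion theta_angle cos_theta_gt0 lx)).
rewrite orbF mulf_eq0 pnatr_eq0 (gtn_eqF m0) /= => H0.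
(* After division by [m] and by the positive value of the form, what vanishes is the squared length
   of H; positivity of the ambient metric concludes. *)
apply/eqP; apply: contraTT H0 => H0; rewrite gt_eqF//; apply: gram_pos H0.
exact: local_expr_image lx.
Qed.
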